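(* Let $r\ge3$ be an integer with $r\not\equiv4\bmod8$ and $q=e^{2\pi\sqrt{-1}/r}$. Let $\mathcal C$ be the category of weight modules over $\overline U_q^H(\mathfrak{osp}(1|2))$ with its braiding $c$. Let $s\in\mathbb Z$ satisfy $q^{2s}=1$ and give $\mathcal C$ the pivotal structure determined by $s$. Then the natural automorphism $\theta:\mathrm{id}_{\mathcal C}\Rightarrow\mathrm{id}_{\mathcal C}$ with components $\theta_V=\mathrm{ptr}_R(c_{V,V})$ (right partial trace with respect to this pivotal structure) gives $\mathcal C$ the structure of a $\mathbb C$-linear ribbon category if and only if $s=r_0$.
   Context: $q^z=e^{2\pi\sqrt{-1}z/r}$; $[[n]]=\frac{q^{-n}-(-q)^n}{q+q^{-1}}$, $[[n]]!=\prod_{i=1}^n[[i]]$; $r_0$ is the least positive integer with $[[r_0]]=0$: $r_0=2r$ if $r$ is odd, $r$ if $r\equiv2\bmod4$, $r/2$ if $r\equiv0\bmod8$. $\overline U_q^H(\mathfrak{osp}(1|2))$ is the Hopf superalgebra over $\mathbb C$ with even generators $H,K^{\pm1}$, odd generators $E,F$ and relations $KK^{-1}=K^{-1}K=1$, $HK=KH$, $[H,E]=2E$, $[H,F]=-2F$, $KE=q^2EK$, $KF=q^{-2}FK$, $EF+FE=\frac{K-K^{-1}}{q-q^{-1}}$, $E^{r_0}=F^{r_0}=0$; $\Delta H=H\otimes1+1\otimes H$, $\Delta K=K\otimes K$, $\Delta E=1\otimes E+E\otimes K$, $\Delta F=K^{-1}\otimes F+F\otimes1$; $S(H)=-H$,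 $S(K)=K^{-1}$, $S(E)=-EK^{-1}$, $S(F)=-KF$. A weight module is a finite dimensional supermodule on which $H$ acts semisimply and $Kv=q^\lambda v$ whenever $Hv=\lambda v$; morphisms preserve parity. Braiding: $c_{V,W}=\tau\circ\Upsilon\circ\tilde R$ with $\tilde R=\sum_{l=0}^{r_0-1}(-1)^l\frac{q^{l(l-1)/2}(q-q^{-1})^l}{[[l]]!}E^l\otimes F^l$ acting with Koszul signs, $\Upsilon(v\otimes w)=q^{\lambda_v\lambda_w/2}v\otimes w$ on weight vectors, $\tau(v\otimes w)=(-1)^{\bar v\bar w}w\otimes v$. Pivotal structure determined by $s$: $V^\vee$ is the linear dual with $(x\cdot f)(v)=(-1)^{\bar f\bar x}f(S(x)v)$; with homogeneous dual bases $\{v_i\},\{v_i^\vee\}$, $\overleftarrow{\mathrm{ev}}_V(f\otimes v)=f(v)$, $\overleftarrow{\mathrm{coev}}_V(1)=\sum_iv_i\otimes v_i^\vee$, $\overrightarrow{\mathrm{ev}}^{(s)}_V(v\otimes f)=(-1)^{\bar f\bar v}f(K^{1-s}v)$, $\overrightarrow{\mathrm{coev}}^{(s)}_V(1)=\sum_i(-1)^{\bar v_i}v_i^\vee\otimes K^{s-1}v_i$. The right partial trace of $f\in\mathrm{End}(V\otimes W)$ is $(\mathrm{id}_V\otimes\overrightarrow{\mathrm{ev}}^{(s)}_W)(f\otimes\mathrm{id}_{W^\vee})(\mathrm{id}_V\otimes\overleftarrow{\mathrm{coev}}_W)$. A $\mathbb C$-linear ribbon category is a rigid braided category with a compatible twist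 $\theta$: $\theta_{V\otimes W}=c_{W,V}c_{V,W}(\theta_V\otimes\theta_W)$ and $\theta_{V^\vee}=\theta_V^\vee$. *)

(* Defs.v *)
From HB Require Import structures.
From mathcomp Require Import all_boot all_order all_algebra.
From mathcomp Require Import complex.
From mathcomp Require Import boolp classical_sets fsbigop.
From mathcomp Require Import reals sequences exp trigo.

Set Implicit Arguments.
Unset Strict Implicit.
Unset Printing Implicit Defensive.

Import Order.TTheory GRing.Theory Num.Theory.
Import passmx.

Local Open Scope ring_scope.

(** The data of a [k]-linear monoidal category with a braiding and with left
    and right duality maps.  The category is presented inside an ambient one:
    its objects are the [A : ob] such that [isob A], and its morphisms from
    [A] to [B] are the [f : hom A B] such that [ismor f].  All axioms below are
    relative to [isob] and [ismor], and include the closure of [isob] and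
    [ismor] under the structure. *)

Record cat_data (k : fieldType) := CatData {
  ob : Type;
  hom : ob -> ob -> lmodType k;
  isob : ob -> Prop;
  ismor : forall A B, hom A B -> Prop;
  idm : forall A, hom A A;
  comp : forall A B D, hom B D -> hom A B -> hom A D;
  tob : ob -> ob -> ob;
  tmor : forall A A' B B', hom A A' -> hom B B' -> hom (tob A B) (tob A' B');
  one : ob;
  asc : forall A B D, hom (tob (tob A B) D) (tob A (tob B D));
  asci : forall A B D, hom (tob A (tob B D)) (tob (tob A B) D);
  lu : forall A, hom (tob one A) A;
  lui : forall A, hom A (tob one A);
  ru : forall A, hom (tob A one) A;
  rui : forall A, hom A (tob A one);
  brd : forall A B, hom (tob A B) (tob B A);
  dual : ob -> ob;
  evl : forall A, hom (tob (dual A) A) one;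
  coevl : forall A, hom one (tob A (dual A));
  evr : forall A, hom (tob A (dual A)) one;
  coevr : forall A, hom one (tob (dual A) A)
}.

Arguments one {k c}.

Declare Scope cat_scope.
Delimit Scope cat_scope with cat.
Notation "g \c f" := (comp g f) (at level 50, left associativity) : cat_scope.
Notation "f \x g" := (tmor f g) (at level 40, left associativity) : cat_scope.
Notation "A \ox B" := (tob A B) (at level 40, left associativity) : cat_scope.
Notation "\id A" := (idm A) (at level 10, A at level 8) : cat_scope.

Section RibbonCategories.
Local Open Scope cat_scope.
Context {k : fieldType} (X : cat_data k).
Implicit Types A B D : ob X.

Definition inverse_mor A B (f : hom A B) (g : hom B A) : Prop :=
  [/\ ismor f, ismor g, g \c f = \id A & f \c g = \id B].

Definition is_iso A B (f : hom A B) : Prop := exists g, inverse_mor f g.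

Record linear_category : Prop := {
  mor_id : forall A, isob A -> ismor (\id A);
  mor_comp : forall A B D (g : hom B D) (f : hom A B),
    isob A -> isob B -> isob D -> ismor g -> ismor f -> ismor (g \c f);
  comp1m : forall A B (f : hom A B),
    isob A -> isob B -> ismor f -> \id B \c f = f;
  compm1 : forall A B (f : hom A B),
    isob A -> isob B -> ismor f -> f \c \id A = f;
  compA : forall A B D D' (h : hom D D') (g : hom B D) (f : hom A B),
    isob A -> isob B -> isob D -> isob D' ->
    ismor h -> ismor g -> ismor f -> h \c (g \c f) = (h \c g) \c f;
  mor_zero : forall A B, isob A -> isob B -> ismor (0 : hom A B);
  mor_lin : forall A B (a : k) (f g : hom A B),
    isob A -> isob B -> ismor f -> ismor g -> ismor (a *: f + g);
  comp_linl : forall A B D (a : k) (g g' : hom B D) (f : hom A B),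
    isob A -> isob B -> isob D -> ismor g -> ismor g' -> ismor f ->
    (a *: g + g') \c f = a *: (g \c f) + (g' \c f);
  comp_linr : forall A B D (a : k) (g : hom B D) (f f' : hom A B),
    isob A -> isob B -> isob D -> ismor g -> ismor f -> ismor f' ->
    g \c (a *: f + f') = a *: (g \c f) + (g \c f')
}.

Record linear_monoidal_category : Prop := {
  mon_linear :> linear_category;
  ob_one : isob (one : ob X);
  ob_tens : forall A B, isob A -> isob B -> isob (A \ox B);
  mor_tens : forall A A' B B' (f : hom A A') (g : hom B B'),
    isob A -> isob A' -> isob B -> isob B' ->
    ismor f -> ismor g -> ismor (f \x g);
  tens_id : forall A B, isob A -> isob B -> \id A \x \id B = \id (A \ox B);
  tens_comp : forall A A' A'' B B' B''
      (f' : hom A' A'') (f : hom A A') (g' : hom B' B'') (g : hom B B'),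
    isob A -> isob A' -> isob A'' -> isob B -> isob B' -> isob B'' ->
    ismor f' -> ismor f -> ismor g' -> ismor g ->
    (f' \c f) \x (g' \c g) = (f' \x g') \c (f \x g);
  tens_linl : forall A A' B B' (a : k) (f f' : hom A A') (g : hom B B'),
    isob A -> isob A' -> isob B -> isob B' -> ismor f -> ismor f' -> ismor g ->
    (a *: f + f') \x g = a *: (f \x g) + (f' \x g);
  tens_linr : forall A A' B B' (a : k) (f : hom A A') (g g' : hom B B'),
    isob A -> isob A' -> isob B -> isob B' -> ismor f -> ismor g -> ismor g' ->
    f \x (a *: g + g') = a *: (f \x g) + (f \x g');
  ascK : forall A B D, isob A -> isob B -> isob D ->
    inverse_mor (asc A B D) (asci A B D);
  luK : forall A, isob A -> inverse_mor (lu A) (lui A);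
  ruK : forall A, isob A -> inverse_mor (ru A) (rui A);
  asc_nat : forall A A' B B' D D'
      (f : hom A A') (g : hom B B') (h : hom D D'),
    isob A -> isob A' -> isob B -> isob B' -> isob D -> isob D' ->
    ismor f -> ismor g -> ismor h ->
    asc A' B' D' \c ((f \x g) \x h) = (f \x (g \x h)) \c asc A B D;
  lu_nat : forall A A' (f : hom A A'), isob A -> isob A' -> ismor f ->
    lu A' \c (\id one \x f) = f \c lu A;
  ru_nat : forall A A' (f : hom A A'), isob A -> isob A' -> ismor f ->
    ru A' \c (f \x \id one) = f \c ru A;
  triangle : forall A B, isob A -> isob B ->
    (\id A \x lu B) \c asc A one B = ru A \x \id B;
  pentagon : forall A B D D', isob A -> isob B -> isob D -> isob D' ->
    (\id A \x asc B D D') \c asc A (B \ox D) D' \c (asc A B D \x \id D')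
    = asc A B (D \ox D') \c asc (A \ox B) D D'
}.

(** [dual A] is both a left dual of [A], through [evl] and [coevl], and a
    right dual of [A], through [evr] and [coevr]. *)
Record rigid : Prop := {
  ob_dual : forall A, isob A -> isob (dual A);
  mor_evl : forall A, isob A -> ismor (evl A);
  mor_coevl : forall A, isob A -> ismor (coevl A);
  mor_evr : forall A, isob A -> ismor (evr A);
  mor_coevr : forall A, isob A -> ismor (coevr A);
  zigzag_l : forall A, isob A ->
    ru A \c (\id A \x evl A) \c asc A (dual A) A \c (coevl A \x \id A) \c lui A
    = \id A;
  zigzag_dual_l : forall A, isob A ->
    lu (dual A) \c (evl A \x \id (dual A)) \c asci (dual A) A (dual A)
      \c (\id (dual A) \x coevl A) \c rui (dual A)
    = \id (dual A);
  zigzag_r : forall A, isob A ->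
    lu A \c (evr A \x \id A) \c asci A (dual A) A \c (\id A \x coevr A) \c rui A
    = \id A;
  zigzag_dual_r : forall A, isob A ->
    ru (dual A) \c (\id (dual A) \x evr A) \c asc (dual A) A (dual A)
      \c (coevr A \x \id (dual A)) \c lui (dual A)
    = \id (dual A)
}.

Record braided : Prop := {
  brd_iso : forall A B, isob A -> isob B -> is_iso (brd A B);
  brd_nat : forall A A' B B' (f : hom A A') (g : hom B B'),
    isob A -> isob A' -> isob B -> isob B' -> ismor f -> ismor g ->
    brd A' B' \c (f \x g) = (g \x f) \c brd A B;
  hexagon : forall A B D, isob A -> isob B -> isob D ->
    asc B D A \c brd A (B \ox D) \c asc A B D
    = (\id B \x brd A D) \c asc B A D \c (brd A B \x \id D);
  hexagon_inv : forall A B D, isob A -> isob B -> isob D ->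
    asci D A B \c brd (A \ox B) D \c asci A B D
    = (brd A D \x \id B) \c asci A D B \c (\id A \x brd B D)
}.

Definition dual_mor A B (f : hom A B) : hom (dual B) (dual A) :=
  lu (dual A) \c (evl B \x \id (dual A)) \c asci (dual B) B (dual A)
    \c (\id (dual B) \x (f \x \id (dual A)))
    \c (\id (dual B) \x coevl A) \c rui (dual B).

Definition ptr_right A B (f : hom (A \ox B) (A \ox B)) : hom A A :=
  ru A \c (\id A \x evr B) \c asc A B (dual B) \c (f \x \id (dual B))
    \c asci A B (dual B) \c (\id A \x coevl B) \c rui A.

Definition ptr_twist A : hom A A := ptr_right (brd A A).

Record natural_automorphism (th : forall A, hom A A) : Prop := {
  nat_iso : forall A, isob A -> is_iso (th A);
  nat_nat : forall A B (f : hom A B), isob A -> isob B -> ismor f ->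
    th B \c f = f \c th A
}.

Record compatible_twist (th : forall A, hom A A) : Prop := {
  twist_nat : natural_automorphism th;
  twist_tens : forall A B, isob A -> isob B ->
    th (A \ox B) = brd B A \c brd A B \c (th A \x th B);
  twist_dual : forall A, isob A -> th (dual A) = dual_mor (th A)
}.

Record linear_ribbon_category (th : forall A, hom A A) : Prop := {
  rib_monoidal : linear_monoidal_category;
  rib_rigid : rigid;
  rib_braided : braided;
  rib_twist : compatible_twist th
}.

End RibbonCategories.

(** [V (x) W] is modelled by [Hom(V^*, W)], the pure tensor [v (x) w] being
    [f |-> f(v) w].  The map [tlift b] is the linear map on [V (x) W] induced
    by a bilinear [b]; see [tlift_pure] and [tens_pureE]. *)

Section TensorProduct.
Context {k : fieldType}.
Implicit Types U V W : vectType k.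

Definition ldual V : vectType k := 'Hom(V, k^o).

Definition dcoord V (i : 'I_(\dim {:V})) : ldual V :=
  linfun (coord (vbasis {:V}) i : V -> k^o).

Definition tens V W : vectType k := 'Hom(ldual V, W).

Definition pure V W (v : V) (w : W) : tens V W :=
  linfun (fun f : ldual V => (f v : k) *: w).

Definition tlift V W U (b : V -> W -> U) : 'Hom(tens V W, U) :=
  linfun (fun t : tens V W =>
    \sum_(i < \dim {:V}) b (vbasis {:V})`_i (t (dcoord i))).

Lemma linfunE V W (g : V -> W) : linear g -> linfun g =1 g.
Proof.
move=> gl; pose gg := HB.pack_for {linear V -> W} g
  (GRing.isLinear.Build k V W *:%R g gl).
exact: (lfunE gg).
Qed.

Lemma pureE V W (v : V) (w : W) (f : ldual V) : pure v w f = (f v : k) *: w.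
Proof.
rewrite /pure linfunE // => a x y.
by rewrite add_lfunE scale_lfunE scalerDl scalerA.
Qed.

Lemma dcoordE V (i : 'I_(\dim {:V})) (v : V) :
  dcoord i v = coord (vbasis {:V}) i v.
Proof. by rewrite /dcoord linfunE // => a x y; rewrite linearD linearZ. Qed.

Lemma tens_pureE V W (t : tens V W) :
  t = \sum_(i < \dim {:V}) pure (vbasis {:V})`_i (t (dcoord i)).
Proof.
apply/lfunP => f; rewrite sum_lfunE.
have {1}-> : f = \sum_(i < \dim {:V}) (f (vbasis {:V})`_i : k) *: dcoord i.
  apply/lfunP => v; rewrite sum_lfunE.
  rewrite {1}(coord_vbasis (memvf v)) linear_sum; apply: eq_bigr => i _.
  by rewrite linearZ scale_lfunE dcoordE /= [LHS]mulrC.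
by rewrite linear_sum; apply: eq_bigr => i _; rewrite linearZ pureE.
Qed.

Lemma tlift_pure V W U (b : V -> W -> U) :
  (forall w, linear (b^~ w)) -> (forall v, linear (b v)) ->
  forall v w, tlift b (pure v w) = b v w.
Proof.
move=> bl br v w.
pose bW v' := HB.pack_for {linear W -> U} (b v')
  (GRing.isLinear.Build k W U *:%R (b v') (br v')).
pose bV w' := HB.pack_for {linear V -> U} (b^~ w')
  (GRing.isLinear.Build k V U *:%R (b^~ w') (bl w')).
rewrite /tlift linfunE; last first.
  move=> a x y; rewrite scaler_sumr -big_split; apply: eq_bigr => i _.
  by rewrite add_lfunE scale_lfunE br.
rewrite [in RHS](coord_vbasis (memvf v)).
have -> : b (\sum_(i < \dim {:V})
             coord (vbasis {:V}) i v *: (vbasis {:V})`_i) w =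
          bV w (\sum_(i < \dim {:V})
             coord (vbasis {:V}) i v *: (vbasis {:V})`_i) by [].
rewrite linear_sum; apply: eq_bigr => i _.
by rewrite pureE dcoordE linearZ -[LHS]/(bW _ _) linearZ.
Qed.

Definition tmap V V' W W' (f : 'Hom(V, V')) (g : 'Hom(W, W')) :
    'Hom(tens V W, tens V' W') :=
  tlift (fun v w => pure (f v) (g w)).

End TensorProduct.

Section WeightModules.
Context {R : realType}.
Local Notation C := R[i].

Definition cexp (z : C) : C :=
  (expR (complex.Re z))%:C%C
    * Complex (cos (complex.Im z)) (sin (complex.Im z)).

Section WithQ.
Variables (r r0 : nat) (s : int).

Definition qpow (z : C) : C := cexp ((2 * pi)%:C%C * 'i%C * z / r%:R).

Local Notation q := (qpow 1).

Definition qbr (n : nat) : C := (q ^- n - (- q) ^+ n) / (q + q^-1).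

Definition qfact (n : nat) : C := \prod_(1 <= i < n.+1) qbr i.

Definition least_zero_qbr : Prop :=
  [/\ (0 < r0)%N, qbr r0 = 0 & forall n, (0 < n < r0)%N -> qbr n != 0].

(** A finite dimensional space with operators for the two homogeneous
    projections ([gr false] onto the even part, [gr true] onto the odd part)
    and for the generators [H], [K], [K^-1], [E], [F]. *)
Record opspace := OpSpace {
  car :> vectType C;
  gr : bool -> 'End(car);
  opH : 'End(car);
  opK : 'End(car);
  opKi : 'End(car);
  opE : 'End(car);
  opF : 'End(car)
}.

Definition lfun_exp (V : vectType C) (f : 'End(V)) (n : nat) : 'End(V) :=
  iter n (fun g => (f \o g)%VF) \1%VF.

Record weight_module (V : opspace) : Prop := {
  gr_sum : (gr V false + gr V true = \1)%VF;
  gr_proj : forall i j, (gr V i \o gr V j = if i == j then gr V i else 0)%VF;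
  H_even : forall i, (gr V i \o opH V = opH V \o gr V i)%VF;
  K_even : forall i, (gr V i \o opK V = opK V \o gr V i)%VF;
  Ki_even : forall i, (gr V i \o opKi V = opKi V \o gr V i)%VF;
  E_odd : forall i, (gr V (~~ i) \o opE V = opE V \o gr V i)%VF;
  F_odd : forall i, (gr V (~~ i) \o opF V = opF V \o gr V i)%VF;
  rel_KKi : (opK V \o opKi V = \1)%VF;
  rel_KiK : (opKi V \o opK V = \1)%VF;
  rel_HK : (opH V \o opK V = opK V \o opH V)%VF;
  rel_HE : (opH V \o opE V)%VF - (opE V \o opH V)%VF = 2 *: opE V;
  rel_HF : (opH V \o opF V)%VF - (opF V \o opH V)%VF = - (2 *: opF V);
  rel_KE : (opK V \o opE V = q ^+ 2 *: (opE V \o opK V))%VF;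
  rel_KF : (opK V \o opF V = q ^- 2 *: (opF V \o opK V))%VF;
  rel_EF : (opE V \o opF V)%VF + (opF V \o opE V)%VF
           = (q - q^-1)^-1 *: (opK V - opKi V);
  rel_E0 : lfun_exp (opE V) r0 = 0;
  rel_F0 : lfun_exp (opF V) r0 = 0;
  H_semisimple : exists b : seq V, basis_of {:V} b /\
    (forall v, v \in b -> exists l : C, opH V v = l *: v);
  K_weight : forall (l : C) (v : V),
    opH V v = l *: v -> opK V v = qpow l *: v
}.

Record weight_mor (V W : opspace) (f : 'Hom(V, W)) : Prop := {
  mor_gr : forall i, (f \o gr V i = gr W i \o f)%VF;
  mor_H : (f \o opH V = opH W \o f)%VF;
  mor_K : (f \o opK V = opK W \o f)%VF;
  mor_E : (f \o opE V = opE W \o f)%VF;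
  mor_F : (f \o opF V = opF W \o f)%VF
}.

(** The counit sends [K] to 1 and [H], [E], [F] to 0. *)
Definition wunit : opspace :=
  @OpSpace C^o (fun i => if i then 0 else \1%VF) 0 \1%VF \1%VF 0 0.

(** [a (x) b] with Koszul sign, for [b] homogeneous of parity [y]:
    [v (x) w |-> (-1)^(y |v|) a v (x) b w]. *)
Definition super_tmap (V W : opspace) (y : bool) (a : 'End(V)) (b : 'End(W)) :
    'End(tens V W) :=
  tlift (fun v w => \sum_(i : bool) (-1) ^+ (y && i) *: pure (a (gr V i v)) (b w)).

Definition wtens (V W : opspace) : opspace :=
  @OpSpace (tens V W)
    (fun i => \sum_(j : bool) tmap (gr V j) (gr W (i (+) j)))
    (super_tmap false (opH V) \1%VF + super_tmap false \1%VF (opH W))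
    (super_tmap false (opK V) (opK W))
    (super_tmap false (opKi V) (opKi W))
    (super_tmap true \1%VF (opE W) + super_tmap false (opE V) (opK W))
    (super_tmap true (opKi V) (opF W) + super_tmap false (opF V) \1%VF).

(** [f |-> (v |-> (-1)^(y |f|) f (Sx v))], where [Sx] is the action of the
    antipode of an element of parity [y]; the degree [i] part of [f] is
    [f \o gr i]. *)
Definition dual_act (V : opspace) (y : bool) (Sx : 'End(V)) :
    'End(ldual V) :=
  linfun (fun f : ldual V =>
    (\sum_(i : bool) (-1) ^+ (y && i) *: ((f \o gr V i) \o Sx))%VF : ldual V).

Definition wdual (V : opspace) : opspace :=
  @OpSpace (ldual V)
    (fun i => linfun (fun f : ldual V => (f \o gr V i)%VF : ldual V))
    (dual_act false (- opH V))
    (dual_act false (opKi V))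
    (dual_act false (opK V))
    (dual_act true (- (opE V \o opKi V)%VF))
    (dual_act true (- (opK V \o opF V)%VF)).

(** [(v, w) |-> (-1)^(|v| |w|) b v w] on homogeneous [v], [w], extended
    bilinearly. *)
Definition koszul (V W : opspace) (U : vectType C) (b : V -> W -> U) :
    V -> W -> U :=
  fun v w => \sum_(i : bool) \sum_(j : bool)
    (-1) ^+ (i && j) *: b (gr V i v) (gr W j w).

(** Projection onto the eigenspace of [f] for [l], along the image of [f - l];
    for a semisimple [f] these are complementary. *)
Definition eigen_proj (V : vectType C) (f : 'End(V)) (l : C) : 'End(V) :=
  daddv_pi (leigenspace f l) (limg (f - l *: \1%VF)).

Definition weights (V : opspace) : set C := [set l | leigenvalue (opH V) l]%classic.

(** The sums over weights are sums of finite support. *)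
Definition upsilon (V W : opspace) : 'End(tens V W) :=
  tlift (fun v w => \sum_(l \in weights V) \sum_(m \in weights W)
    qpow (l * m / 2) *: pure (eigen_proj (opH V) l v) (eigen_proj (opH W) m w)).

Definition Rtilde (V W : opspace) : 'End(tens V W) :=
  \sum_(l < r0)
    ((-1) ^+ l * q ^+ ((l * l.-1) %/ 2) * (q - q^-1) ^+ l / qfact l)
      *: super_tmap (odd l) (lfun_exp (opE V) l) (lfun_exp (opF W) l).

Definition super_flip (V W : opspace) : 'Hom(tens V W, tens W V) :=
  tlift (@koszul V W _ (fun v w => pure w v)).

Definition wbraiding (V W : opspace) : 'Hom(wtens V W, wtens W V) :=
  (super_flip V W \o (upsilon V W \o Rtilde V W))%VF.

Definition Kpow (V : opspace) (n : int) : 'End(V) :=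
  match n with
  | Posz m => lfun_exp (opK V) m
  | Negz m => lfun_exp (opKi V) m.+1
  end.

Definition wevl (V : opspace) : 'Hom(wtens (wdual V) V, wunit) :=
  tlift (fun (f : ldual V) (v : V) => f v).

Definition wcoevl (V : opspace) : 'Hom(wunit, wtens V (wdual V)) :=
  linfun (fun a : C^o => (a : C) *:
    \sum_(i < \dim {:V}) pure (vbasis {:V})`_i (dcoord i)).

Definition wevr (V : opspace) : 'Hom(wtens V (wdual V), wunit) :=
  tlift (@koszul V (wdual V) C^o (fun v (f : ldual V) => f (Kpow V (1 - s) v))).

(** The sum does not depend on the basis, so that [vbasis] need not be
    homogeneous. *)
Definition wcoevr (V : opspace) : 'Hom(wunit, wtens (wdual V) V) :=
  linfun (fun a : C^o => (a : C) *:
    \sum_(i < \dim {:V}) \sum_(p : bool) (-1) ^+ p *: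
      pure (dcoord i) (Kpow V (s - 1) (gr V p (vbasis {:V})`_i))).

Definition wasc (V1 V2 V3 : vectType C) :
    'Hom(tens (tens V1 V2) V3, tens V1 (tens V2 V3)) :=
  tlift (fun t v3 => tlift (fun v1 v2 => pure v1 (pure v2 v3)) t).

Definition wasci (V1 V2 V3 : vectType C) :
    'Hom(tens V1 (tens V2 V3), tens (tens V1 V2) V3) :=
  tlift (fun v1 t => tlift (fun v2 v3 => pure (pure v1 v2) v3) t).

Definition wlu (V : vectType C) : 'Hom(tens C^o V, V) :=
  tlift (fun (a : C^o) (v : V) => (a : C) *: v).

Definition wlui (V : vectType C) : 'Hom(V, tens C^o V) :=
  linfun (fun v : V => pure (1 : C^o) v).

Definition wru (V : vectType C) : 'Hom(tens V C^o, V) :=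
  tlift (fun (v : V) (a : C^o) => (a : C) *: v).

Definition wrui (V : vectType C) : 'Hom(V, tens V C^o) :=
  linfun (fun v : V => pure v (1 : C^o)).

Definition weight_category : cat_data C :=
  @CatData C opspace
    (fun V W => 'Hom(car V, car W))
    weight_module
    weight_mor
    (fun V => \1%VF)
    (fun V W U g f => (g \o f)%VF)
    wtens
    (fun V V' W W' f g => tmap f g)
    wunit
    (fun V W U => wasc V W U)
    (fun V W U => wasci V W U)
    (fun V => wlu V)
    (fun V => wlui V)
    (fun V => wru V)
    (fun V => wrui V)
    wbraiding
    wdual
    wevl
    wcoevl
    wevr
    wcoevr.

End WithQ.
End WeightModules.

Arguments least_zero_qbr : clear implicits.
Arguments weight_category : clear implicits.

(* Main.v *)
Require Import Defs.
From mathcomp Require Import all_boot all_order all_algebra.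
From mathcomp Require Import complex.
From mathcomp Require Import boolp classical_sets cardinality fsbigop.
From mathcomp Require Import reals sequences exp trigo.
From mathcomp Require Import ring zify.

Set Implicit Arguments.
Unset Strict Implicit.
Unset Printing Implicit Defensive.

Import Order.TTheory GRing.Theory Num.Theory.
Import passmx.

Local Open Scope ring_scope.

(** On homogeneous weight vectors the braiding is a finite sum of the terms
    [F^n w (x) E^n v] with explicit scalar coefficients.  Its linearity over the
    algebra comes from the commutation relation between [E] and [F^n], and the
    hexagons from the [q]-binomial theorem.  On vectors of weight [l] the twist is
    [tw l] times [sum_n c_n q^(l n) F^n E^n], with
    [tw l = q^(l^2 / 2 + (1 - s) l)]; it is invertible because [E] is nilpotent,
    and its compatibility with the tensor product is a partial trace of the
    Yang-Baxter equation.

    Only the compatibility with duals depends on [s].  On the Verma module of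
    highest weight [nu], of dimension [r0], the twist is [tw nu], and on its dual,
    of highest weight [2 (r0 - 1) - nu], it is [tw (2 (r0 - 1) - nu)].  These agree
    for all [nu] only if [s = r0].  Conversely, for [s = r0] the compatibility on a
    vector of weight [l] compares a combination of the [F^n E^n] with one of the
    [E^n F^n], for [n < r0].  With [Y = q^l], their difference is a polynomial of
    degree less than [r0] in [Y F E], with coefficients in [C[Y^2]].  It vanishes on
    Verma modules, which provide [r0] distinct eigenvalues of [Y F E] for a given
    [Y]; it is therefore zero, and acts by zero on every weight module. *)

(** * Tensor products *)

(** Up to a nonzero factor [[[n]]] is [1 - om^n] with [om = - q^2], so [r0] is the order of [om].
    Hence the middle Gaussian binomials of order [r0] vanish and nilpotency passes to tensor
    products; [E] commutes with [F^r0] up to sign, so that a Verma module can be cut off at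
    dimension [r0].

    Since [q^(2 s) = 1], the operator [K^s] commutes with [E] and [F]. So [K^(1-s)] always
    implements the square of the antipode, and [s] is visible in the twist only through the factor
    [q^(- s l)] on weight [l].

    The obstacle to the converse is that weight modules are not semisimple in general: scalars
    computed on Verma modules do not by themselves say how the twist acts elsewhere. What transfers
    to every module is an identity of polynomials. The operator [Y F E] preserves weight and parity,
    complex weights let [Y] take every positive real value, and the truncation of the sums at
    [n < r0] keeps the degree below the number of available eigenvalues. *)

Section TensorCalculus.
Context {k : fieldType}.
Implicit Types U V W : vectType k.

Lemma homD V W (f : 'Hom(V, W)) x y : f (x + y) = f x + f y.
Proof. exact: linearD. Qed.

Lemma homB V W (f : 'Hom(V, W)) x y : f (x - y) = f x - f y.
Proof. exact: linearB. Qed.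

Lemma homN V W (f : 'Hom(V, W)) x : f (- x) = - f x.
Proof. exact: linearN. Qed.

Lemma hom0 V W (f : 'Hom(V, W)) : f 0 = 0.
Proof. exact: linear0. Qed.

Lemma homZ V W (f : 'Hom(V, W)) a x : f (a *: x) = a *: f x.
Proof. exact: linearZ. Qed.

Lemma hom_sum V W (f : 'Hom(V, W)) I (s : seq I) (P : pred I) (F : I -> V) :
  f (\sum_(i <- s | P i) F i) = \sum_(i <- s | P i) f (F i).
Proof. exact: linear_sum. Qed.

Lemma pureDl V W (v v' : V) (w : W) : pure (v + v') w = pure v w + pure v' w.
Proof.
by apply/lfunP => f; rewrite add_lfunE !pureE linearD /= scalerDl.
Qed.

Lemma pureZl V W a (v : V) (w : W) : pure (a *: v) w = a *: pure v w.
Proof. by apply/lfunP => f; rewrite scale_lfunE !pureE linearZ /= scalerA. Qed.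

Lemma pureDr V W (v : V) (w w' : W) : pure v (w + w') = pure v w + pure v w'.
Proof. by apply/lfunP => f; rewrite add_lfunE !pureE scalerDr. Qed.

Lemma pureZr V W a (v : V) (w : W) : pure v (a *: w) = a *: pure v w.
Proof. by apply/lfunP => f; rewrite scale_lfunE !pureE scalerA mulrC -scalerA. Qed.

Lemma pure_linl V W (w : W) : linear (fun v : V => pure v w).
Proof. by move=> a v v'; rewrite pureDl pureZl. Qed.

Lemma pure_linr V W (v : V) : linear (fun w : W => pure v w).
Proof. by move=> a w w'; rewrite pureDr pureZr. Qed.

Lemma pure0l V W (w : W) : pure (0 : V) w = 0.
Proof. by rewrite -(scale0r (0 : V)) pureZl scale0r. Qed.

Lemma pure0r V W (v : V) : pure v (0 : W) = 0.
Proof. by rewrite -(scale0r (0 : W)) pureZr scale0r. Qed.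

Lemma pureNl V W (v : V) (w : W) : pure (- v) w = - pure v w.
Proof. by rewrite -!scaleN1r pureZl. Qed.

Lemma pureNr V W (v : V) (w : W) : pure v (- w) = - pure v w.
Proof. by rewrite -!scaleN1r pureZr. Qed.

Lemma pure_suml V W I (r : seq I) (P : pred I) (F : I -> V) (w : W) :
  pure (\sum_(i <- r | P i) F i) w = \sum_(i <- r | P i) pure (F i) w.
Proof. by elim/big_rec2: _ => [|i x y _ <-]; rewrite ?pure0l ?pureDl. Qed.

Lemma pure_sumr V W I (r : seq I) (P : pred I) (v : V) (F : I -> W) :
  pure v (\sum_(i <- r | P i) F i) = \sum_(i <- r | P i) pure v (F i).
Proof. by elim/big_rec2: _ => [|i x y _ <-]; rewrite ?pure0r ?pureDr. Qed.

Lemma tens_ext V W U (f g : 'Hom(tens V W, U)) :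
  (forall v w, f (pure v w) = g (pure v w)) -> f = g.
Proof.
move=> fg; apply/lfunP => t; rewrite [t]tens_pureE !linear_sum.
by apply: eq_bigr => i _; rewrite /= fg.
Qed.

Lemma tmap_pure V V' W W' (f : 'Hom(V, V')) (g : 'Hom(W, W')) v w :
  tmap f g (pure v w) = pure (f v) (g w).
Proof.
rewrite tlift_pure // => x a y z; first by rewrite linearP pureDl pureZl.
by rewrite linearP pureDr pureZr.
Qed.

Lemma tmapDl V V' W W' a (f f' : 'Hom(V, V')) (g : 'Hom(W, W')) :
  tmap (a *: f + f') g = a *: tmap f g + tmap f' g.
Proof.
apply: tens_ext => v w.
by rewrite !lfunE /= !lfunE /= !tmap_pure !lfunE /= !lfunE /= pure_linl.
Qed.

Lemma tmapDr V V' W W' a (f : 'Hom(V, V')) (g g' : 'Hom(W, W')) :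
  tmap f (a *: g + g') = a *: tmap f g + tmap f g'.
Proof.
apply: tens_ext => v w.
by rewrite !lfunE /= !lfunE /= !tmap_pure !lfunE /= !lfunE /= pure_linr.
Qed.

Lemma tmap_comp V V' V'' W W' W'' (f' : 'Hom(V', V'')) (f : 'Hom(V, V'))
    (g' : 'Hom(W', W'')) (g : 'Hom(W, W')) :
  (tmap (f' \o f) (g' \o g) = tmap f' g' \o tmap f g)%VF.
Proof. by apply: tens_ext => v w; rewrite lfunE /= !tmap_pure !lfunE. Qed.

Lemma tmap_id V W : tmap \1%VF \1%VF = \1%VF :> 'End(tens V W).
Proof. by apply: tens_ext => v w; rewrite tmap_pure !lfunE. Qed.

Lemma vbasis_dcoord V (v : V) :
  v = \sum_(i < \dim {:V}) (dcoord i v : k) *: (vbasis {:V})`_i.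
Proof.
rewrite {1}(coord_vbasis (memvf v)).
by apply: eq_bigr => i _; rewrite dcoordE.
Qed.

Lemma functional_dcoord V (f : ldual V) :
  f = \sum_(i < \dim {:V}) (f (vbasis {:V})`_i : k) *: dcoord i.
Proof.
apply/lfunP => v; rewrite sum_lfunE {1}[v]vbasis_dcoord linear_sum.
by apply: eq_bigr => i _; rewrite linearZ scale_lfunE /= [LHS]mulrC.
Qed.

Lemma eq_functional V (x y : V) : (forall f : ldual V, f x = f y) -> x = y.
Proof.
move=> xy; rewrite [x]vbasis_dcoord [y]vbasis_dcoord.
by apply: eq_bigr => i _; rewrite xy.
Qed.

(* Both sides are contractions of the identity of [V], respectively of [A]
   followed by [B], against a bilinear map. *)
Lemma dcoord_transpose V W U (b : V -> ldual W -> U)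
    (bl : forall f, linear (b^~ f)) (br : forall v, linear (b v)) (A : 'Hom(W, V)) :
  \sum_(i < \dim {:V}) b (vbasis {:V})`_i (dcoord i \o A)%VF
  = \sum_(j < \dim {:W}) b (A (vbasis {:W})`_j) (dcoord j).
Proof.
pose bb : 'Hom(tens V (ldual W), U) := tlift b.
have bE v f : b v f = bb (pure v f) by rewrite /bb tlift_pure.
under eq_bigr => i _ do rewrite bE [(_ \o _)%VF]functional_dcoord pure_sumr linear_sum.
rewrite exchange_big /=; apply: eq_bigr => j _.
rewrite bE [A _]vbasis_dcoord pure_suml linear_sum; apply: eq_bigr => i _.
by rewrite pureZl pureZr !linearZ /= lfunE.
Qed.

Lemma free_subseq_span V (X : seq V) :
  exists2 b : seq V, free b & (<<b>> = <<X>>)%VS /\ {subset b <= X}.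
Proof.
elim: X => [|x X [b fb [sb bX]]]; first by exists [::]; rewrite ?nil_free.
case: (boolP (x \in <<X>>%VS)) => xX.
  exists b => //; split; last by move=> y /bX; rewrite inE orbC => ->.
  by rewrite span_cons sb; apply/esym/addv_idPr; rewrite -memvE.
exists (x :: b); first by rewrite free_cons sb xX.
split; first by rewrite !span_cons sb.
by move=> y; rewrite !inE => /orP[->//|/bX ->]; rewrite orbT.
Qed.

End TensorCalculus.

(** * Scalars *)

Section QPowers.
Context {R : realType}.
Local Notation C := R[i].

Lemma cexpD (x y : C) : cexp (x + y) = cexp x * cexp y.
Proof.
case: x y => [a b] [c d]; rewrite /cexp /= expRD cosD sinD.
apply/eqP; rewrite eq_complex /=; apply/andP; split; apply/eqP; ring.
Qed.

Lemma cexp_real (x : R) : cexp (x%:C)%C = (expR x)%:C%C.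
Proof.
rewrite /cexp /= cos0 sin0; apply/eqP; rewrite eq_complex /=.
by apply/andP; split; apply/eqP; ring.
Qed.

Variable r : nat.

(* [locked] keeps unification from unfolding [qpow] as a product. *)
Definition qexp (z : C) : C := locked (qpow r z).

Local Notation qp := qexp.

Lemma qexpE z : qp z = qpow r z.
Proof. by rewrite /qexp -lock. Qed.

Lemma qexpD x y : qp (x + y) = qp x * qp y.
Proof. by rewrite !qexpE /qpow mulrDr mulrDl cexpD. Qed.

Lemma qexp0 : qp 0 = 1.
Proof. by rewrite qexpE /qpow mulr0 mul0r (cexp_real 0) expR0. Qed.

Lemma qexp_neq0 x : qp x != 0.
Proof.
apply/eqP => x0; have: qp (x - x) = 0 by rewrite qexpD x0 mul0r.
by rewrite subrr qexp0 => /eqP; rewrite oner_eq0.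
Qed.

Lemma qexpN x : qp (- x) = (qp x)^-1.
Proof.
by apply: (mulfI (qexp_neq0 x)); rewrite -qexpD subrr qexp0 divff // qexp_neq0.
Qed.

Lemma qexpMn x n : qp (x *+ n) = qp x ^+ n.
Proof. by elim: n => [|n IH]; rewrite ?qexp0 // mulrS qexpD IH exprS. Qed.

Lemma qexp_nat n : qp n%:R = qp 1 ^+ n.
Proof. exact: qexpMn. Qed.

Hypothesis r3 : (3 <= r)%N.

(** Complex weights allow [x = t r / (2 pi i)]. This supplies weights on which a polynomial in [q^l]
    can be tested, and at the end a highest weight that separates two twists. *)
Lemma qexp_expR (t : R) : exists x, qp x = (expR t)%:C%C.
Proof.
have r0 : r%:R != 0 :> C by rewrite pnatr_eq0; case: r r3.
have pi0 : (2 * pi)%:C%C != 0 :> C.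
  by rewrite eq_complex /= eqxx andbT mulf_neq0 // ?pnatr_eq0 // gt_eqF // pi_gt0.
have i0 : 'i%C != 0 :> C by rewrite eq_complex /= oner_eq0 andbF.
exists (t%:C%C * r%:R / ((2 * pi)%:C%C * 'i%C)); rewrite -cexp_real qexpE /qpow; congr cexp.
move: (_ * pi)%:C%C 'i%C (r%:R : C) t%:C%C pi0 i0 r0 => p i n x p0 i0 n0.
by field; rewrite p0 i0 n0.
Qed.

Lemma q_cos_sin : qp 1 = Complex (cos (2 * pi / r%:R)) (sin (2 * pi / r%:R)).
Proof.
rewrite qexpE /qpow /cexp.
have -> : (2 * pi)%:C%C * 'i%C * 1 / r%:R = Complex 0 (2 * pi / r%:R) :> C.
  rewrite mulr1 -[r%:R]/(r%:R) -(rmorph_nat (real_complex R)) -fmorphV.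
  by apply/eqP; rewrite eq_complex /=; apply/andP; split; apply/eqP; ring.
by rewrite /= expR0 mul1r.
Qed.

Lemma sin_arg_gt0 : 0 < sin (2 * pi / r%:R : R).
Proof.
have r0 : 0 < r%:R :> R by rewrite ltr0n; case: r r3.
apply: sin_gt0_pi; rewrite divr_gt0 ?mulr_gt0 ?pi_gt0 //=.
by rewrite ltr_pdivrMr // mulrC ltr_pM2l ?pi_gt0 // ltr_nat.
Qed.

(** As [0 < 2 pi / r < pi], the imaginary part of [q] is positive, whereas the square roots of [1]
    are real. *)
Lemma q2_neq1 : qp 1 ^+ 2 != 1.
Proof.
rewrite q_cos_sin; set c := cos _; set d := sin _.
have d0 : d != 0 by rewrite gt_eqF // sin_arg_gt0.
rewrite expr2 eq_complex /=; apply/negP => /andP[/eqP h /eqP h'].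
have c0 : c = 0.
  have : d * (c *+ 2) = 0 by rewrite -h' mulr2n; ring.
  by move/eqP; rewrite mulf_eq0 (negPf d0) /= -mulr_natr mulf_eq0 pnatr_eq0 orbF => /eqP.
move: h; rewrite c0 mul0r sub0r => h.
have : 0 <= d * d by rewrite -expr2 sqr_ge0.
by rewrite -oppr_le0 h ler10.
Qed.

(** The square roots of [-1] have zero real part, and on [[0, pi]] the cosine vanishes only at
    [pi / 2], which is [2 pi / r] only for [r = 4]. *)
Lemma q2_neqN1 : r != 4%N -> qp 1 ^+ 2 != -1.
Proof.
move=> r4; rewrite q_cos_sin.
have c0 : cos (2 * pi / r%:R : R) != 0.
  have r0 : 0 < r%:R :> R by rewrite ltr0n; case: r r3.
  have e : (2 * pi / r%:R : R) \in `[0, pi].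
    rewrite in_itv /= divr_ge0 ?mulr_ge0 ?pi_ge0 ?(ltW r0) //=.
    by rewrite ler_pdivrMr // mulrC ler_pM2l ?pi_gt0 // ler_nat ltnW.
  have e2 : (pi / 2 : R) \in `[0, pi].
    rewrite in_itv /= divr_ge0 ?pi_ge0 //= ler_pdivrMr // ler_peMr ?pi_ge0 //.
    by rewrite ler1n.
  rewrite -(cos_pihalf R); apply: contraNneq r4 => /(cos_inj e e2).
  move=> /(congr1 (fun x => x * r%:R / pi * 2)) /=.
  have p0 : pi != 0 :> R by rewrite gt_eqF // pi_gt0.
  rewrite divfK ?(gt_eqF r0) // mulfK //.
  have -> : pi / 2 * r%:R / pi * 2 = r%:R :> R.
    by move: (pi : R) p0 => p p0; field; rewrite p0 ?pnatr_eq0.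
  by rewrite -natrM => /eqP; rewrite eqr_nat => /eqP <-.
move: c0; set c := cos _; set d := sin _ => c0.
have d0 : d != 0 by rewrite gt_eqF // sin_arg_gt0.
rewrite expr2 eq_complex /=; apply/negP => /andP[/eqP _ /eqP h'].
have : d * (c *+ 2) = 0 by transitivity (c * d + d * c); [ring | rewrite h' oppr0].
by move/eqP; rewrite mulf_eq0 (negPf d0) /= -mulr_natr mulf_eq0 (negPf c0) pnatr_eq0.
Qed.

End QPowers.

(** * Gaussian binomials *)

Section GaussBinomials.
Context {k : fieldType} (om : k).

Definition qpoch (n : nat) : k := \prod_(1 <= i < n.+1) (1 - om ^+ i).

(** Gaussian binomials through Pascal's rule: without division they keep a meaning at a root of
    unity, where [qpoch], the symbol [(om; om)_n], may vanish. *)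
Fixpoint gauss (n m : nat) : k :=
  match n, m with
  | n'.+1, m'.+1 => gauss n' m'.+1 * om ^+ m'.+1 + gauss n' m'
  | _, 0 => 1
  | 0, _.+1 => 0
  end.

Lemma qpoch0 : qpoch 0 = 1.
Proof. by rewrite /qpoch big_geq. Qed.

Lemma qpochS n : qpoch n.+1 = qpoch n * (1 - om ^+ n.+1).
Proof. by rewrite /qpoch big_nat_recr. Qed.

Lemma gauss0 n : gauss n 0 = 1.
Proof. by case: n. Qed.

Lemma gaussS n m : gauss n.+1 m.+1 = gauss n m.+1 * om ^+ m.+1 + gauss n m.
Proof. by []. Qed.

Lemma gauss_small n m : (n < m)%N -> gauss n m = 0.
Proof.
elim: n m => [|n IH] [|m] //; rewrite ltnS => nm.
by rewrite gaussS !IH ?mul0r ?addr0 // ltnW.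
Qed.

Lemma gaussn n : gauss n n = 1.
Proof. by elim: n => // n IH; rewrite gaussS IH gauss_small ?mul0r ?add0r. Qed.

(** The quotient formula with denominators cleared, valid at roots of unity. The induction rests on
    [1 - om^(m+n+2) = (1 - om^(n+1)) om^(m+1) + (1 - om^(m+1))]. *)
Lemma gauss_qpoch m n : gauss (m + n) m * (qpoch m * qpoch n) = qpoch (m + n).
Proof.
move: {2}(m + n)%N (erefl (m + n)%N) => N; elim: N m n => [|N IH] [|m] [|n] //.
- by move=> _; rewrite qpoch0 gauss0 !mul1r.
- by move=> _; rewrite qpoch0 gauss0 !mul1r.
- by move=> _; rewrite addn0 gaussn qpoch0 mul1r mulr1.
move=> /eqP; rewrite addSn eqSS => /eqP e; rewrite gaussS mulrDl.
have e1 : (m.+1 + n = N)%N by rewrite addSnnS.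
have := IH m.+1 n e1; have := IH m n.+1 e; rewrite addSnnS => i1 i2.
transitivity (qpoch (m + n.+1) * ((1 - om ^+ n.+1) * om ^+ m.+1 + (1 - om ^+ m.+1))).
  by rewrite mulrDr -{1}i2 -i1 (qpochS n) (qpochS m); ring.
rewrite qpochS -addSn exprD; congr (_ * _); ring.
Qed.

End GaussBinomials.

Arguments lfun_exp : simpl never.

Section Powers.
Context {R : realType}.
Local Notation C := R[i].

Lemma lfun_exp0 (V : vectType C) (f : 'End(V)) v : lfun_exp f 0 v = v.
Proof. by rewrite /lfun_exp /= lfunE. Qed.

Lemma lfun_expS (V : vectType C) (f : 'End(V)) n v :
  lfun_exp f n.+1 v = f (lfun_exp f n v).
Proof. by rewrite /lfun_exp /= lfunE. Qed.

Lemma lfun_expD (V : vectType C) (f : 'End(V)) m n v :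
  lfun_exp f (m + n) v = lfun_exp f m (lfun_exp f n v).
Proof.
by elim: m => [|m IH]; rewrite ?lfun_exp0 // addSn !lfun_expS IH.
Qed.

Lemma lfun_expSr (V : vectType C) (f : 'End(V)) n v :
  lfun_exp f n.+1 v = lfun_exp f n (f v).
Proof. by rewrite -addn1 lfun_expD lfun_expS lfun_exp0. Qed.

Lemma lfun_exp_ge0 (V : vectType C) (f : 'End(V)) m n v :
  lfun_exp f m = 0 -> (m <= n)%N -> lfun_exp f n v = 0.
Proof. by move=> f0 mn; rewrite -(subnK mn) lfun_expD f0 lfunE linear0. Qed.

(* The binomial theorem for [X + Y] with [Y X = om X Y], where the
   monomial [X^j Y^i] is represented by the vector [t i j]. *)
Lemma qbinomial (T : vectType C) (f : 'End(T)) (om ka : C) (t : nat -> nat -> T) :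
    (forall i j, f (t i j) = (ka * om ^+ i) *: t i j.+1 + t i.+1 j) ->
  forall n, lfun_exp f n (t 0 0)%N
    = \sum_(m < n.+1) (gauss om n m * ka ^+ (n - m)) *: t m (n - m)%N.
Proof.
move=> ft; elim=> [|n IH].
  by rewrite lfun_exp0 big_ord1 gauss0 expr0 mulr1 scale1r.
rewrite lfun_expS IH linear_sum /=.
under eq_bigr => i _ do rewrite linearZ /= ft scalerDr scalerA.
rewrite big_split /= [in RHS]big_ord_recl /=.
under [in RHS]eq_bigr => i _.
  rewrite /bump /= add1n subSS mulrDl scalerDl.
  over.
rewrite big_split /= addrA; congr (_ + _).
rewrite [in LHS]big_ord_recl [X in _ = _ + X]big_ord_recr /=.
rewrite subn0 gauss0 expr0 mulr1 !mul1r.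
rewrite (gauss_small om (ltnSn n)) !mul0r scale0r addr0.
rewrite -exprSr; congr (_ + _).
apply: eq_bigr => i _; rewrite /bump /= add1n.
rewrite -(subnSK (ltn_ord i)) [ka ^+ _.+1]exprS; congr (_ *: _); ring.
Qed.

End Powers.

Section Scalars.
Context {R : realType}.
Local Notation C := R[i].
Variables (r : nat).
Local Notation qp := (@qexp R r).
Local Notation q := (qp 1).

(** The two summands in the coproduct of [E], and of [F], commute up to this scalar: [q^2] comes
    from [K], the sign from the odd generators. The factor [rho] is [(q - q^-1) (q + q^-1)], see
    [rhoE]. *)
Definition om : C := locked (- q ^+ 2).
Definition rho : C := locked (q ^+ 2 - q ^- 2).

Lemma omE : om = - q ^+ 2. Proof. by rewrite /om -lock. Qed.

Lemma rhoDef : rho = q ^+ 2 - q ^- 2. Proof. by rewrite /rho -lock. Qed.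

(* [E F^l w - (-1)^l F^l E w = kap l (q^mu) F^(l-1) w] for [w] of weight [mu]. *)
Definition kap (l : nat) (Y : C) : C :=
  locked ((q * (q ^- (2 * l) - (-1) ^+ l) * Y - q^-1 * (q ^+ (2 * l) - (-1) ^+ l) / Y) / rho).

(** The coefficient of [E^l (x) F^l] in [Rtilde] is this with the factor [(-1)^l q^(2 l^2)]. That
    power of [q] cancels against [upsilon], which sees the weights already shifted by [E^l] and
    [F^l]. *)
Definition gcoef (l : nat) : C := locked (qp (- (l * l)%:R) * rho ^+ l / qpoch om l).

Variable r0 : nat.
Hypotheses (r3 : (3 <= r)%N) (r8 : (r %% 8 != 4)%N) (hr0 : least_zero_qbr R r r0).

Lemma q_neq0 : q != 0. Proof. exact: qexp_neq0. Qed.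

Lemma q2N1 : q ^+ 2 != -1.
Proof. by apply: (q2_neqN1 r3); apply: contraNneq r8 => ->. Qed.

Lemma qplus_neq0 : q + q^-1 != 0.
Proof.
apply: contraNneq q2N1 => /(congr1 (fun z => q * z)).
by rewrite mulr0 mulrDr divff ?q_neq0 // -expr2 => /eqP; rewrite addr_eq0.
Qed.

Lemma qminus_neq0 : q - q^-1 != 0.
Proof.
apply: contraNneq (@q2_neq1 R _ r3) => /(congr1 (fun z => q * z)).
by rewrite mulr0 mulrBr divff ?q_neq0 // -expr2 => /eqP; rewrite subr_eq0.
Qed.

Lemma rhoE : rho = (q - q^-1) * (q + q^-1).
Proof. by rewrite rhoDef; move: q_neq0; move: q => x x0; field. Qed.

Lemma rho_neq0 : rho != 0.
Proof. by rewrite rhoE mulf_neq0 ?qminus_neq0 ?qplus_neq0. Qed.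

Lemma omX n : om ^+ n = (-1) ^+ n * q ^+ (2 * n).
Proof. by rewrite omE exprM -exprNn. Qed.

Lemma om_neq0 : om != 0.
Proof. by rewrite omE oppr_eq0 expf_neq0 // q_neq0. Qed.

(** Identifies [r0] with the multiplicative order of [om]. *)
Lemma qbrE n : @qbr R r n = q ^- n * (1 - om ^+ n) / (q + q^-1).
Proof.
rewrite /qbr -qexpE omX; congr (_ / _); rewrite [(- q) ^+ n]exprNn mulrBr mulr1; congr (_ - _).
have e : q ^+ n != 0 by rewrite expf_neq0 // q_neq0.
by rewrite mulrCA mul2n -addnn exprD mulKf.
Qed.

Lemma r0_gt0 : (0 < r0)%N. Proof. by case: hr0. Qed.

Lemma om_r0 : om ^+ r0 = 1.
Proof.
case: hr0 => _ /eqP; rewrite qbrE mulf_eq0 invr_eq0 (negPf qplus_neq0) orbF.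
by rewrite mulf_eq0 invr_eq0 expf_eq0 (negPf q_neq0) andbF subr_eq0 => /eqP.
Qed.

Lemma om_n n : (0 < n < r0)%N -> om ^+ n != 1.
Proof.
case: hr0 => _ _ h /h; apply: contraNneq => e.
by rewrite qbrE e subrr mulr0 mul0r.
Qed.

Lemma qpoch_neq0 n : (n < r0)%N -> qpoch om n != 0.
Proof.
elim: n => [|n IH] h; first by rewrite qpoch0 oner_neq0.
by rewrite qpochS mulf_neq0 ?IH ?(ltnW h) // subr_eq0 eq_sym om_n // ltn0Sn.
Qed.

(** In the cleared quotient formula the right side contains [1 - om^r0 = 0], while the Pochhammer
    symbols on the left are nonzero. This is what makes [E^r0] and [F^r0] vanish on tensor
    products. *)
Lemma gauss_r0 m : (0 < m < r0)%N -> gauss om r0 m = 0.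
Proof.
case/andP=> m0 mr.
have e : (m + (r0 - m) = r0)%N by rewrite subnKC // ltnW.
have := gauss_qpoch om m (r0 - m); rewrite e.
have -> : qpoch om r0 = 0.
  by rewrite -(prednK r0_gt0) qpochS prednK ?r0_gt0 // om_r0 subrr mulr0.
move/eqP; rewrite mulf_eq0 mulf_eq0 !(negPf (qpoch_neq0 _)) ?orbF //; first by move/eqP.
by rewrite ltn_subrL m0 r0_gt0.
Qed.

Lemma kap0 Y : kap 0 Y = 0.
Proof. by rewrite /kap -!lock muln0 expr0 invr1 subrr !mulr0 !mul0r subrr mul0r. Qed.

(** The recursion for moving [E] past one more [F]: the right side is the value of
    [(K - K^-1) / (q - q^-1)] on weight [mu - 2 l], for [Y = q^mu]. So [kap] is an alternating sum
    of such values. *)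
Lemma kapS l Y : kap l.+1 Y + kap l Y
  = (Y * q ^- (2 * l) - Y^-1 * q ^+ (2 * l)) / (q - q^-1).
Proof.
have a1 : q ^+ 2 + 1 != 0 by rewrite addr_eq0 q2N1.
have b1 : q ^+ 2 - 1 != 0 by rewrite subr_eq0 (@q2_neq1 R _ r3).
rewrite /kap -!lock rhoE (mulnS 2 l) exprD [(-1) ^+ l.+1]exprS.
move: q_neq0 a1 b1; move: q => x x0 a1 b1.
have u0 : x ^+ (2 * l) != 0 by rewrite expf_neq0.
move: u0; move: (x ^+ (2 * l)) ((-1) ^+ l) Y^-1 => u e Z u0.
by field; rewrite x0 u0 -!expr2 a1 b1.
Qed.

(** [om^r0 = 1] means [q^(2 r0) = (-1)^r0], which kills both numerators. Moving [E] past [F^r0] thus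
    leaves no remainder, as the truncated Verma modules require. *)
Lemma kap_r0 Y : kap r0 Y = 0.
Proof.
have := om_r0; rewrite omX => h.
have e : q ^+ (2 * r0) = (-1) ^+ r0.
  transitivity ((-1) ^+ r0 * ((-1) ^+ r0 * q ^+ (2 * r0))); last by rewrite h mulr1.
  by rewrite mulrA -expr2 sqrr_sign mul1r.
by rewrite /kap -!lock e invr_sign subrr !mulr0 !mul0r subrr mul0r.
Qed.

Lemma gcoefS l : (l.+1 < r0)%N ->
  gcoef l.+1 * (1 - om ^+ l.+1) = gcoef l * (rho * q ^- (2 * l).+1).
Proof.
move=> h; rewrite /gcoef -!lock qpochS.
have a0 : qpoch om l != 0 by rewrite qpoch_neq0 // ltnW.
have b0 : 1 - om ^+ l.+1 != 0 by rewrite subr_eq0 eq_sym om_n // h.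
have -> : qp (- (l.+1 * l.+1)%:R) = qp (- (l * l)%:R) * q ^- (2 * l).+1.
  rewrite -qexp_nat -qexpN -qexpD; congr qexp; rewrite -opprD -natrD; congr (- _%:R).
  by nia.
rewrite [rho ^+ _]exprS.
move: rho (rho ^+ _) (q ^- _) (qp _) (qpoch _ _) (1 - _) a0 b0 => x y z t a b a0 b0.
by field; rewrite a0 b0.
Qed.

(** The multiplicativity behind both hexagons: the Gaussian binomial of the coproduct splits the
    Pochhammer symbol, and the cross term of [(l + m)^2] leaves [q^(-2 l m)]. *)
Lemma gcoefD l m : (l + m < r0)%N ->
  gcoef (l + m) * gauss om (l + m) l = gcoef l * gcoef m * q ^- (2 * (l * m)).
Proof.
move=> h; rewrite /gcoef -!lock.
have al : qpoch om l != 0 by rewrite qpoch_neq0 // (leq_ltn_trans _ h) ?leq_addr.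
have am : qpoch om m != 0 by rewrite qpoch_neq0 // (leq_ltn_trans _ h) ?leq_addl.
have a : qpoch om (l + m) != 0 by rewrite qpoch_neq0.
have -> : gauss om (l + m) l = qpoch om (l + m) / (qpoch om l * qpoch om m).
  by rewrite -(gauss_qpoch om l m) mulfK // mulf_neq0.
have -> : qp (- ((l + m) * (l + m))%:R)
    = qp (- (l * l)%:R) * qp (- (m * m)%:R) * q ^- (2 * (l * m)).
  rewrite -qexp_nat -qexpN -!qexpD; congr qexp; rewrite !natrM !natrD; ring.
rewrite exprD.
move: (qpoch om (l + m)) (qpoch _ l) (qpoch _ m) a al am => a b c a0 b0 c0.
move: (q ^- _) (rho ^+ l) (rho ^+ m) (qp _) (qp _) => x y z t u.
by field; rewrite a0 b0 c0.
Qed.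

Lemma Rcoef_gcoef (l : nat) :
  (-1) ^+ l * qpow r 1 ^+ ((l * l.-1) %/ 2) * (qpow r 1 - (qpow r 1)^-1) ^+ l / @qfact R r l
  = (-1) ^+ l * (q ^+ (2 * (l * l)) * gcoef l).
Proof.
rewrite -!qexpE; have q0 := q_neq0.
have -> : ((l * l.-1) %/ 2)%N = 'C(l, 2) by rewrite bin2 divn2.
have -> : @qfact R r l = q ^- 'C(l.+1, 2) * qpoch om l / (q + q^-1) ^+ l.
  elim: l => [|l IH]; first by rewrite /qfact big_geq // qpoch0 !expr0 invr1 !mul1r.
  rewrite /qfact big_nat_recr //= -/(@qfact R r l) IH qbrE qpochS (binS l.+1 1) bin1 exprD !exprS.
  by rewrite !invfM; ring.
rewrite /gcoef -!lock qexpN qexp_nat rhoE.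
(* [C(l, 2)] comes from [Rtilde], [C(l+1, 2)] from [[[l]]!] and [l^2] from [gcoef]. *)
have e : (2 * (l * l) = 'C(l, 2) + 'C(l.+1, 2) + l * l)%N.
  elim: l => // l; rewrite (binS l.+1 1) (binS l 1) !bin1.
  move: 'C(l, 2) => a; nia.
rewrite e; move: (qpoch _ _) q0; move: q => x p x0.
have y0 n : x ^+ n != 0 by rewrite expf_neq0.
rewrite !exprD [(_ * (x + _)) ^+ _]exprMn.
have inv3 (a b c : C) : (a^-1 * b / c)^-1 = a * c * b^-1.
  by rewrite !invfM !invrK mulrAC.
rewrite inv3.
move: (y0 (l * l)%N); move: (x ^+ (l * l)) => z z0.
move: (x ^+ _) (x ^+ _) (_ ^+ l) (_ ^+ l) (_ ^+ l) p^-1 => t u v w y s.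
by field.
Qed.

End Scalars.

(** * Weight modules *)

Section WeightVectors.
Context {R : realType}.
Local Notation C := R[i].
Variables (r r0 : nat).
Local Notation qp := (@qexp R r).
Local Notation q := (qp 1).
Local Notation wmod := (@weight_module R r r0).

(** Zero counts as a vector of every weight and parity, so [E] and [F] shift weights without case
    distinctions. *)
Definition hwt (V : opspace) (l : C) (p : bool) (v : V) : Prop :=
  gr V p v = v /\ opH V v = l *: v.

Section OneModule.
Context {V : @opspace R} (mV : wmod V).

Lemma lfun_eq (U W : vectType C) (f g : 'Hom(U, W)) : f = g -> f =1 g.
Proof. by move->. Qed.

Lemma gr_sumE v : gr V false v + gr V true v = v.
Proof. by have /lfun_eq/(_ v) := gr_sum mV; rewrite !lfunE. Qed.

Lemma grgr i j v : gr V i (gr V j v) = if i == j then gr V i v else 0.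
Proof.
by have /lfun_eq/(_ v) := gr_proj mV i j; rewrite lfunE /= => ->; case: ifP; rewrite ?lfunE.
Qed.

Lemma grH i v : gr V i (opH V v) = opH V (gr V i v).
Proof. by have /lfun_eq/(_ v) := H_even mV i; rewrite !lfunE. Qed.

Lemma grE i v : gr V (~~ i) (opE V v) = opE V (gr V i v).
Proof. by have /lfun_eq/(_ v) := E_odd mV i; rewrite !lfunE. Qed.

Lemma grF i v : gr V (~~ i) (opF V v) = opF V (gr V i v).
Proof. by have /lfun_eq/(_ v) := F_odd mV i; rewrite !lfunE. Qed.

Lemma KiKE v : opKi V (opK V v) = v.
Proof. by have /lfun_eq/(_ v) := rel_KiK mV; rewrite !lfunE. Qed.

Lemma HE v : opH V (opE V v) = opE V (opH V v) + 2 *: opE V v.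
Proof.
have /lfun_eq/(_ v) := rel_HE mV; rewrite !lfun_simp.
by move=> <-; rewrite addrC subrK.
Qed.

Lemma HF v : opH V (opF V v) = opF V (opH V v) - 2 *: opF V v.
Proof.
have /lfun_eq/(_ v) := rel_HF mV; rewrite !lfun_simp.
by move=> <-; rewrite addrC subrK.
Qed.

Lemma hwt_gr i l p v : hwt l p v -> gr V i v = if i == p then v else 0.
Proof. by case=> gv _; rewrite -gv grgr; case: eqP => // ->. Qed.

Lemma hwt0 l p : @hwt V l p 0.
Proof. by split; rewrite linear0 ?scaler0. Qed.

Lemma hwtZ a l p (v : V) : hwt l p v -> hwt l p (a *: v).
Proof. by case=> gv hv; split; rewrite linearZ /= ?gv // hv scalerA mulrC -scalerA. Qed.

Lemma hwtD l p (v w : V) : hwt l p v -> hwt l p w -> hwt l p (v + w).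
Proof. by case=> gv hv [gw hw]; split; rewrite linearD /= ?gv ?gw // hv hw scalerDr. Qed.

Lemma hwt_K l p v : hwt l p v -> opK V v = qp l *: v.
Proof. by case=> _ /(K_weight mV); rewrite qexpE. Qed.

Lemma hwt_Ki l p v : hwt l p v -> opKi V v = (qp l)^-1 *: v.
Proof.
move=> hv; rewrite -[in LHS](scale1r v) -(mulVf (qexp_neq0 r l)) -scalerA.
by rewrite linearZ /= -(hwt_K hv) KiKE.
Qed.

Lemma hwt_E l p (v : V) : hwt l p v -> hwt (l + 2) (~~ p) (opE V v).
Proof.
case=> gv hv; split; first by rewrite grE gv.
by rewrite HE hv linearZ /= -scalerDl.
Qed.

Lemma hwt_F l p (v : V) : hwt l p v -> hwt (l - 2) (~~ p) (opF V v).
Proof.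
case=> gv hv; split; first by rewrite grF gv.
by rewrite HF hv linearZ /= -scalerBl.
Qed.

Lemma hwt_En l p n (v : V) : hwt l p v ->
  hwt (l + 2 * n%:R) (p (+) odd n) (lfun_exp (opE V) n v).
Proof.
move=> hv; elim: n => [|n IH]; first by rewrite lfun_exp0 mulr0 addr0 addbF.
rewrite lfun_expS /= addbN.
have -> : l + 2 * n.+1%:R = l + 2 * n%:R + 2 by rewrite -[n.+1]addn1 natrD mulrDr mulr1 addrA.
exact: hwt_E.
Qed.

Lemma hwt_Fn l p n (v : V) : hwt l p v ->
  hwt (l - 2 * n%:R) (p (+) odd n) (lfun_exp (opF V) n v).
Proof.
move=> hv; elim: n => [|n IH]; first by rewrite lfun_exp0 mulr0 subr0 addbF.
rewrite lfun_expS /= addbN.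
have -> : l - 2 * n.+1%:R = l - 2 * n%:R - 2.
  by rewrite -[n.+1]addn1 natrD mulrDr mulr1 opprD addrA.
exact: hwt_F.
Qed.

Lemma EF_hwt l p v : hwt l p v ->
  opE V (opF V v) = - opF V (opE V v) + ((qp l - (qp l)^-1) / (q - q^-1)) *: v.
Proof.
move=> hv; have /lfun_eq/(_ v) := rel_EF mV.
rewrite -!qexpE !lfun_simp (hwt_K hv) (hwt_Ki hv).
by rewrite -scalerBl scalerA [_^-1 * _]mulrC => <-; rewrite addrC addrK.
Qed.

Lemma FE_hwt l p v : hwt l p v ->
  opF V (opE V v) = - opE V (opF V v) + ((qp l - (qp l)^-1) / (q - q^-1)) *: v.
Proof. by move=> hv; rewrite (EF_hwt hv) opprD opprK addrNK. Qed.

Lemma weight_basis : exists (n : nat) (b : n.-tuple V) (ls : 'I_n -> C),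
  basis_of {:V} b /\ forall i : 'I_n, opH V b`_i = ls i *: b`_i.
Proof.
have [b [bb be]] := H_semisimple mV.
have ex (i : 'I_(size b)) : exists l, opH V b`_i = l *: b`_i.
  by apply: be; rewrite mem_nth.
have [ls lsP] := choice ex.
by exists (size b), (in_tuple b), ls.
Qed.

(** The parity projections commute with [H], so the even and odd parts of an eigenbasis of [H] are
    homogeneous weight vectors and span. *)
Lemma lfun_hwt (U : vectType C) (f g : 'Hom(V, U)) :
  (forall l p v, hwt l p v -> f v = g v) -> f = g.
Proof.
have [n [b [ls [bb be]]]] := weight_basis.
move=> fg; apply/lfunP => v; rewrite [v](coord_basis bb (memvf v)) !linear_sum.
apply: eq_bigr => i _; rewrite !linearZ; congr (_ *: _).
rewrite -(gr_sumE b`_i) !linearD /=.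
have h p : hwt (ls i) p (gr V p b`_i).
  by split; [rewrite grgr eqxx | rewrite -grH be linearZ].
by congr (_ + _); apply: fg (h _).
Qed.

Lemma coord_eigen n (b : n.-tuple V) (ls : 'I_n -> C) :
    basis_of {:V} b -> (forall i : 'I_n, opH V b`_i = ls i *: b`_i) ->
  forall i v, coord b i (opH V v) = ls i * coord b i v.
Proof.
move=> bb be i v; rewrite {1}[v](coord_basis bb (memvf v)) linear_sum.
under eq_bigr => j _ do rewrite linearZ /= be scalerA.
by rewrite coord_sum_free ?(basis_free bb) // mulrC.
Qed.

(** Turns coefficients that depend on weight and parity into endomorphisms; needed to write the
    braiding as a sum of tensor products of operators. *)
Lemma diagonal_op (h : C -> bool -> C) :
  exists D : 'End(V), forall l p v, hwt l p v -> D v = h l p *: v.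
Proof.
have [n [b [ls [bb be]]]] := weight_basis.
pose D v := \sum_(i < n) coord b i v *: (\sum_(p : bool) h (ls i) p *: gr V p b`_i).
have Dl : linear D.
  move=> a x y; rewrite /D scaler_sumr -big_split; apply: eq_bigr => i _ /=.
  by rewrite linearP scalerDl scalerA.
exists (linfun D) => l p v hv; rewrite linfunE // /D.
(* The coordinate of [v] along a basis vector of another weight vanishes, so [ls i] may be replaced
   by [l]. *)
transitivity (\sum_(i < n) coord b i v *: (\sum_(p' : bool) h l p' *: gr V p' b`_i)).
  apply: eq_bigr => i _; have [_ Hv] := hv.
  have := coord_eigen bb be i v; rewrite Hv linearZ /= => /eqP.
  rewrite -subr_eq0 -mulrBl mulf_eq0 => /orP[|/eqP ->]; last by rewrite !scale0r.
  by rewrite subr_eq0 => /eqP ->.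
transitivity (\sum_(p' : bool) h l p' *: gr V p' v); last first.
  by rewrite big_bool !(hwt_gr _ hv); case: p hv => hv /=; rewrite scaler0 ?addr0 ?add0r.
under eq_bigr => i _ do rewrite scaler_sumr.
rewrite exchange_big /=; apply: eq_bigr => p' _.
rewrite [in RHS](coord_basis bb (memvf v)) linear_sum scaler_sumr.
by apply: eq_bigr => i _; rewrite [X in _ = _ *: X]linearZ /= !scalerA mulrC.
Qed.

Lemma weights_finite : finite_set (weights V).
Proof.
have [n [b [ls [bb be]]]] := weight_basis.
apply: (@sub_finite_set _ _ [set` [seq ls i | i : 'I_n]]); last exact: finite_seq.
move=> l; rewrite /weights /= /leigenvalue => l0.
have : vpick (leigenspace (opH V) l) != 0 by rewrite vpick0.
have := memv_pick (leigenspace (opH V) l); move: (vpick _) => v.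
rewrite memv_ker !lfun_simp subr_eq0 => /eqP Hv v0.
have [i ci] : exists i, coord b i v != 0.
  apply/existsP; apply: contraNT v0; rewrite negb_exists => /forallP h.
  rewrite [v](coord_basis bb (memvf v)) big1 // => i _.
  by move: (h i); rewrite negbK => /eqP ->; rewrite scale0r.
have := coord_eigen bb be i v; rewrite Hv linearZ /= => /(mulIf ci) ->.
by apply/mapP; exists i; rewrite ?mem_enum.
Qed.

Lemma eigen_projE l l' v : opH V v = l *: v ->
  eigen_proj (opH V) l' v = if l' == l then v else 0.
Proof.
have [n [b [ls [bb be]]]] := weight_basis.
(* Semisimplicity of [H] enters here: an eigenvector for [l'] has no coordinates where [ls i]
   differs from [l'], and a vector [(H - l') u] has none where [ls i = l']. *)
have cap0 : (leigenspace (opH V) l' :&: limg (opH V - l' *: \1%VF) = 0)%VS.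
  apply/eqP; rewrite -subv0; apply/subvP => x; rewrite memv_cap memv0.
  rewrite memv_ker !lfun_simp subr_eq0 => /andP[/eqP Hx /memv_imgP[u _]].
  rewrite !lfun_simp => ex; apply/eqP.
  rewrite [x](coord_basis bb (memvf x)) big1 // => i _.
  have : (ls i - l') * coord b i x = 0.
    by rewrite mulrBl -(coord_eigen bb be) Hx linearZ /= subrr.
  move/eqP; rewrite mulf_eq0 => /orP[|/eqP ->]; last by rewrite scale0r.
  rewrite ex linearB linearZ /= (coord_eigen bb be) -mulrBl => /eqP ->.
  by rewrite mul0r scale0r.
move=> Hv; rewrite /eigen_proj; case: eqP => [e|/eqP ne].
  by apply: daddv_pi_id => //; rewrite memv_ker !lfun_simp Hv e subrr.
have vimg : v \in limg (opH V - l' *: \1%VF).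
  apply/memv_imgP; exists ((l - l')^-1 *: v); first exact: memvf.
  rewrite !lfun_simp linearZ /= Hv !scalerA -scalerBl mulrC -mulrBl divff ?scale1r //.
  by rewrite subr_eq0 eq_sym.
have vs : v \in (leigenspace (opH V) l' + limg (opH V - l' *: \1%VF))%VS.
  by rewrite -[v]add0r memv_add // mem0v.
have := daddv_pi_add cap0 vs.
rewrite [X in _ + X]daddv_pi_id 1?capvC // => /eqP; rewrite -subr_eq0 addrK.
by move/eqP.
Qed.

End OneModule.

Lemma fsbig_only (T : choiceType) (U : nmodType) (A : set T) (F : T -> U) x :
    finite_set A -> A x -> (forall y, y != x -> F y = 0) ->
  \sum_(y \in A) F y = F x.
Proof.
move=> fA Ax F0; rewrite (fsbigD1 x) //.
by rewrite fsbig1 /= ?addr0 // => y [_ /= /eqP]; exact: F0.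
Qed.

(** [upsilon] with an arbitrary function of the two weights, so that its inverse is an instance of
    the same construction. *)
Definition weight_scaling (h : C -> C -> C) (V W : opspace) : 'End(tens V W) :=
  tlift (fun v w => \sum_(l \in weights V) \sum_(m \in weights W)
    h l m *: pure (eigen_proj (opH V) l v) (eigen_proj (opH W) m w)).

Lemma weight_scalingE (h : C -> C -> C) (V W : opspace) (mV : wmod V) (mW : wmod W)
    l m v w : opH V v = l *: v -> opH W w = m *: w ->
  weight_scaling h V W (pure v w) = h l m *: pure v w.
Proof.
move=> Hv Hw; rewrite tlift_pure; first last.
- move=> x a y z; rewrite !(fsbig_finite _ _ (weights_finite mV)) /= scaler_sumr -big_split.
  apply: eq_bigr => i _ /=.
  rewrite !(fsbig_finite _ _ (weights_finite mW)) /= scaler_sumr -big_split.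
  by apply: eq_bigr => j _ /=; rewrite linearP pure_linr scalerDr !scalerA mulrC.
- move=> x a y z; rewrite !(fsbig_finite _ _ (weights_finite mV)) /= scaler_sumr -big_split.
  apply: eq_bigr => i _ /=.
  rewrite !(fsbig_finite _ _ (weights_finite mW)) /= scaler_sumr -big_split.
  by apply: eq_bigr => j _ /=; rewrite linearP pure_linl scalerDr !scalerA mulrC.
have wt (U : @opspace R) (x : U) n : opH U x = n *: x -> x != 0 -> weights U n.
  move=> Hx x0; rewrite /weights /= /leigenvalue; apply: contraNneq x0 => e.
  by rewrite -memv0 -e memv_ker !lfun_simp Hx subrr.
have [->|v0] := eqVneq v 0.
  rewrite pure0l scaler0 fsbig1 // => i _; rewrite fsbig1 // => j _.
  by rewrite linear0 pure0l scaler0.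
have [->|w0] := eqVneq w 0.
  rewrite pure0r scaler0 fsbig1 // => i _; rewrite fsbig1 // => j _.
  by rewrite linear0 pure0r scaler0.
rewrite (fsbig_only (weights_finite mV) (wt V v l Hv v0)); last first.
  move=> i il; rewrite fsbig1 // => j _.
  by rewrite (eigen_projE mV _ Hv) (negPf il) pure0l scaler0.
rewrite (fsbig_only (weights_finite mW) (wt W w m Hw w0)); last first.
  by move=> j jm; rewrite (eigen_projE mW _ Hw) (negPf jm) pure0r scaler0.
by rewrite (eigen_projE mV _ Hv) (eigen_projE mW _ Hw) !eqxx.
Qed.

Lemma hwt_tens_ext (V W : opspace) (mV : wmod V) (mW : wmod W) (U : vectType C)
    (f g : 'Hom(tens V W, U)) :
  (forall l p v m p' w, hwt l p v -> hwt m p' w -> f (pure v w) = g (pure v w)) ->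
  f = g.
Proof.
move=> fg; apply: tens_ext => v w.
pose pl (w' : W) := linfun (fun v' : V => pure v' w').
pose pr (v' : V) := linfun (fun w' : W => pure v' w').
have plE w' v' : pl w' v' = pure v' w' by rewrite linfunE //; exact: pure_linl.
have prE v' w' : pr v' w' = pure v' w' by rewrite linfunE //; exact: pure_linr.
have fgr l p x : hwt l p x -> (f \o pr x = g \o pr x)%VF.
  move=> hx; apply: (lfun_hwt mW) => m p' y hy.
  by rewrite !comp_lfunE prE; exact: fg hx hy.
have fgl : (f \o pl w = g \o pl w)%VF.
  apply: (lfun_hwt mV) => l p x hx; rewrite !comp_lfunE plE -prE.
  by have := lfun_eq (fgr l p x hx) w; rewrite !comp_lfunE.
by have := lfun_eq fgl v; rewrite !comp_lfunE plE.
Qed.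

(** The axiom on [K] concerns all eigenvectors of [H], but such a vector only involves basis vectors
    with its own eigenvalue, so a spanning set is enough. *)
Lemma weight_axioms_span (V : vectType C) (H K : 'End(V)) (X : seq V) :
    <<X>>%VS = {:V}%VS ->
    (forall v, v \in X -> exists l : C, H v = l *: v /\ K v = qp l *: v) ->
  (exists b : seq V, basis_of {:V} b /\
     (forall v, v \in b -> exists l : C, H v = l *: v)) /\
  (forall (l : C) (v : V), H v = l *: v -> K v = qp l *: v).
Proof.
move=> sX eX; have [b fb [sb bX]] := free_subseq_span X.
have bb : basis_of {:V} b.
  by rewrite basisEfree fb sb sX subvv (size_basis (X := in_tuple b)) //= /basis_of sb sX eqxx.
split; first by exists b; split=> // v /bX /eX [l []]; exists l.
move=> l v Hv; have cb := coord_basis (X := in_tuple b) bb (memvf _).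
have ex (i : 'I_(size b)) : exists l, H b`_i = l *: b`_i /\ K b`_i = qp l *: b`_i.
  by apply/eX/bX; rewrite mem_nth.
have [ls lsP] := choice ex.
rewrite [v in LHS]cb [v in RHS]cb linear_sum scaler_sumr; apply: eq_bigr => i _.
have [hi ki] := lsP i.
have : coord (in_tuple b) i (H v) = l * coord (in_tuple b) i v by rewrite Hv linearZ.
rewrite {1}[v]cb linear_sum.
under eq_bigr => j _ do rewrite linearZ /= (lsP j).1 scalerA.
rewrite coord_sum_free ?(basis_free bb) //= linearZ /= ki !scalerA => h.
have [c0|c0] := eqVneq (coord (in_tuple b) i v) 0; first by rewrite c0 mul0r mulr0.
have -> : ls i = l by apply: (mulfI c0); rewrite h mulrC.
by rewrite mulrC.
Qed.

End WeightVectors.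

Lemma eq_scalar_forms (k : fieldType) (V : vectType k) (x y : V) :
  (forall f : V -> k,
     [/\ forall u v, f (u + v) = f u + f v, forall a u, f (a *: u) = a * f u,
         forall u, f (- u) = - f u & f 0 = 0] -> f x = f y) ->
  x = y.
Proof.
move=> xy; apply: eq_functional => f; apply: (xy (fun v => f v : k)).
by split=> [u v|a u|u|]; rewrite ?linearD ?linearZ ?linearN ?linear0.
Qed.

(* Turns an identity between linear combinations into one between scalars. *)
Ltac scalar_forms :=
  let f := fresh "f" in let fD := fresh in let fZ := fresh in let fN := fresh in
  let f0 := fresh in
  apply: eq_scalar_forms => f [fD fZ fN f0]; rewrite ?(fD, fZ, fN, f0); clear fD fZ fN f0.

Section Modules.
Context {R : realType}.
Local Notation C := R[i].
Variables (r r0 : nat).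
Local Notation qp := (@qexp R r).
Local Notation q := (qp 1).
Local Notation wmod := (@weight_module R r r0).
Hypotheses (r3 : (3 <= r)%N) (r8 : (r %% 8 != 4)%N) (hr0 : least_zero_qbr R r r0).

Lemma qexp2 : qp 2 = q ^+ 2. Proof. exact: (qexp_nat r 2). Qed.

Lemma qexpB x y : qp (x - y) = qp x / qp y.
Proof. by rewrite qexpD qexpN. Qed.

Lemma qexp2n n : qp (2 * n%:R) = q ^+ (2 * n).
Proof. by rewrite -natrM qexp_nat. Qed.

Section OneModule.
Context {V : @opspace R} (mV : wmod V).

Lemma EFn_hwt l p n (v : V) : hwt l p v ->
  opE V (lfun_exp (opF V) n.+1 v)
  = (-1) ^+ n.+1 *: lfun_exp (opF V) n.+1 (opE V v)
    + kap r n.+1 (qp l) *: lfun_exp (opF V) n v.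
Proof.
move=> hv; elim: n => [|n IH].
  rewrite !lfun_expS !lfun_exp0 (EF_hwt mV hv) expr1 scaleN1r; congr (_ + _ *: _).
  have := kapS r3 r8 0 (qp l); rewrite kap0 addr0 => ->.
  by rewrite muln0 expr0 invr1 !mulr1.
rewrite lfun_expS (EF_hwt mV (hwt_Fn mV n.+1 hv)) IH homD !homZ /= -!lfun_expS.
rewrite qexpB qexp2n opprD -addrA -!scaleNr -scalerDl.
congr (_ *: _ + _ *: _); first by rewrite [RHS]exprS mulN1r.
have := kapS r3 r8 n.+1 (qp l) => /eqP; rewrite eq_sym -subr_eq => /eqP <-.
by rewrite [LHS]addrC invf_div [_ / qp l]mulrC.
Qed.

(** The mirror image of [EFn_hwt]. The expression [E F + F E] is symmetric, while in terms of
    [q^(-l)] the value of [K - K^-1] changes sign: hence the inverse argument and the minus. *)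
Lemma FEn_hwt l p n (v : V) : hwt l p v ->
  opF V (lfun_exp (opE V) n.+1 v)
  = (-1) ^+ n.+1 *: lfun_exp (opE V) n.+1 (opF V v)
    - kap r n.+1 (qp l)^-1 *: lfun_exp (opE V) n v.
Proof.
move=> hv; elim: n => [|n IH].
  rewrite !lfun_expS !lfun_exp0 (FE_hwt mV hv) expr1 scaleN1r -scaleNr; congr (_ + _ *: _).
  have := kapS r3 r8 0 (qp l)^-1; rewrite kap0 addr0 => ->.
  by rewrite muln0 expr0 invr1 !mulr1 invrK -mulNr opprB.
rewrite lfun_expS (FE_hwt mV (hwt_En mV n.+1 hv)) IH homB !homZ /= -!lfun_expS.
rewrite qexpD qexp2n opprD opprK -addrA -!scaleNr -scalerDl.
congr (_ *: _ + _ *: _); first by rewrite [RHS]exprS mulN1r.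
have := kapS r3 r8 n.+1 (qp l)^-1 => /eqP; rewrite eq_sym -subr_eq => /eqP <-.
by rewrite opprB invfM invrK; congr (_ + _); rewrite -[RHS]mulNr opprB.
Qed.

Lemma homogeneous_span : exists X : seq V,
  <<X>>%VS = {:V}%VS /\ forall v, v \in X -> exists l p, hwt l p v.
Proof.
have [n [b [ls [bb be]]]] := weight_basis mV.
exists ([seq gr V false x | x <- b] ++ [seq gr V true x | x <- b]); split.
  apply/eqP; rewrite eqEsubv subvf /=; apply/subvP => v _.
  rewrite [v](coord_basis bb (memvf v)) memv_suml // => i _; rewrite memvZ //.
  rewrite -(gr_sumE mV b`_i) memvD // memv_span // mem_cat map_f ?mem_nth ?size_tuple ?orbT //.
have h p x : x \in [seq gr V p y | y <- b] -> exists l p, hwt l p x.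
  case/mapP => y /(nthP 0)[j jn <-] ->; rewrite size_tuple in jn.
  exists (ls (Ordinal jn)), p; split; first by rewrite (grgr mV) eqxx.
  by rewrite -(grH mV) (be (Ordinal jn)) homZ.
by move=> v; rewrite mem_cat => /orP[]; exact: h.
Qed.

End OneModule.

(** [hwt] together with the consequences that the module axioms would give, for use before these
    axioms are known to hold. *)
Definition homog (V : opspace) (l : C) (p : bool) (v : V) : Prop :=
  [/\ gr V p v = v, gr V (~~ p) v = 0, opH V v = l *: v, opK V v = qp l *: v
    & opKi V v = (qp l)^-1 *: v].

Lemma homogD (V : opspace) l p (v w : V) :
  homog l p v -> homog l p w -> homog l p (v + w).
Proof.
by case=> a b c d e [a' b' c' d' e']; split;
  rewrite homD ?a ?a' ?b ?b' ?addr0 // ?c ?c' ?d ?d' ?e ?e' scalerDr.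
Qed.

Lemma homogZ (V : opspace) l p a (v : V) : homog l p v -> homog l p (a *: v).
Proof.
by case=> a' b c d e; split;
  rewrite homZ ?a' ?b ?scaler0 // ?c ?d ?e !scalerA mulrC.
Qed.

Lemma lfun_span (U W : vectType C) (X : seq U) (f g : 'Hom(U, W)) :
  <<X>>%VS = {:U}%VS -> {in X, f =1 g} -> f = g.
Proof.
move=> sX fg; apply/lfunP => v.
rewrite (@coord_span _ _ _ (in_tuple X) v) ?sX ?memvf // !hom_sum.
by apply: eq_bigr => i _; rewrite !homZ fg // mem_nth.
Qed.

(** Apart from semisimplicity and the axiom on [K], the axioms are equations between operators and
    can be tested on a spanning set. Tensor products, duals, the unit and Verma modules are all
    treated in this way. *)
Lemma weight_moduleI (V : opspace) (X : seq V) :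
    <<X>>%VS = {:V}%VS ->
    (forall v, v \in X -> exists (l : C) (p : bool),
       [/\ homog l p v, homog (l + 2) (~~ p) (opE V v), homog (l - 2) (~~ p) (opF V v)
         & [/\ opE V (opF V v) + opF V (opE V v) = ((qp l - (qp l)^-1) / (q - q^-1)) *: v,
               lfun_exp (opE V) r0 v = 0 & lfun_exp (opF V) r0 v = 0]]) ->
  wmod V.
Proof.
move=> sX hX.
have [ss kw] : (exists b : seq V, basis_of {:V} b /\
     (forall v, v \in b -> exists l : C, opH V v = l *: v)) /\
  (forall (l : C) (v : V), opH V v = l *: v -> opK V v = qpow r l *: v).
  under [X in _ /\ X]eq_forall => l do under eq_forall => v do rewrite -qexpE.
  apply: weight_axioms_span sX _ => v /hX[l [p [[_ _ h k _] _ _ _]]]; by exists l.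
split=> //; try by [apply: (lfun_span sX) => v /hX[l [p [_ _ _ [_ e f]]]]; rewrite ?e ?f lfunE].
- apply: (lfun_span sX) => v /hX[l [p [[a b _ _ _] _ _ _]]].
  by rewrite !lfun_simp; case: p a b => /= -> ->; rewrite ?add0r ?addr0.
- move=> i j; apply: (lfun_span sX) => v /hX[l [p [[a b _ _ _] _ _ _]]].
  rewrite comp_lfunE; case: p i j a b => -[] [] /= a b;
    by rewrite ?lfunE /= ?a ?b ?hom0 ?a ?b.
- move=> i; apply: (lfun_span sX) => v /hX[l [p [[a b c _ _] _ _ _]]].
  rewrite !comp_lfunE c homZ.
  by case: p i a b => -[] /= a b; rewrite ?a ?b ?hom0 ?scaler0.
- move=> i; apply: (lfun_span sX) => v /hX[l [p [[a b _ c _] _ _ _]]].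
  rewrite !comp_lfunE c homZ.
  by case: p i a b => -[] /= a b; rewrite ?a ?b ?hom0 ?scaler0.
- move=> i; apply: (lfun_span sX) => v /hX[l [p [[a b _ _ c] _ _ _]]].
  rewrite !comp_lfunE c homZ.
  by case: p i a b => -[] /= a b; rewrite ?a ?b ?hom0 ?scaler0.
- move=> i; apply: (lfun_span sX) => v /hX[l [p [[a b _ _ _] [c d _ _ _] _ _]]].
  rewrite !comp_lfunE.
  by case: p i a b c d => -[] /= a b c d; rewrite ?a ?b ?hom0 ?c ?d.
- move=> i; apply: (lfun_span sX) => v /hX[l [p [[a b _ _ _] _ [c d _ _ _] _]]].
  rewrite !comp_lfunE.
  by case: p i a b c d => -[] /= a b c d; rewrite ?a ?b ?hom0 ?c ?d.
- apply: (lfun_span sX) => v /hX[l [p [[_ _ _ c d] _ _ _]]].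
  rewrite comp_lfunE d homZ c scalerA mulVf ?qexp_neq0 ?scale1r //.
  by rewrite lfunE.
- apply: (lfun_span sX) => v /hX[l [p [[_ _ _ c d] _ _ _]]].
  rewrite comp_lfunE c homZ d scalerA mulfV ?qexp_neq0 ?scale1r //.
  by rewrite lfunE.
- apply: (lfun_span sX) => v /hX[l [p [[_ _ c d _] _ _ _]]].
  by rewrite !comp_lfunE d c !homZ c d !scalerA mulrC.
- apply: (lfun_span sX) => v /hX[l [p [[_ _ c _ _] [_ _ e _ _] _ _]]].
  by rewrite !lfun_simp e c homZ -scalerBl addrAC subrr add0r.
- apply: (lfun_span sX) => v /hX[l [p [[_ _ c _ _] _ [_ _ e _ _] _]]].
  by rewrite !lfun_simp e c homZ -scalerBl addrAC subrr add0r scaleNr.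
- apply: (lfun_span sX) => v /hX[l [p [[_ _ _ c _] [_ _ _ e _] _ _]]].
  by rewrite -!qexpE !lfun_simp e c homZ scalerA qexpD qexp2 mulrC.
- apply: (lfun_span sX) => v /hX[l [p [[_ _ _ c _] _ [_ _ _ e _] _]]].
  by rewrite -!qexpE !lfun_simp e c homZ scalerA qexpB qexp2 mulrC.
- apply: (lfun_span sX) => v /hX[l [p [[_ _ _ c d] _ _ [e _ _]]]].
  by rewrite -!qexpE !lfun_simp e c d -scalerBl scalerA mulrC.
Qed.

End Modules.

(** * Tensor products of weight modules *)

Section TensorModules.
Context {R : realType}.
Local Notation C := R[i].
Variables (r r0 : nat).
Local Notation qp := (@qexp R r).
Local Notation q := (qp 1).
Local Notation wmod := (@weight_module R r r0).
Hypotheses (r3 : (3 <= r)%N) (r8 : (r %% 8 != 4)%N) (hr0 : least_zero_qbr R r r0).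

Lemma super_tmapE (V W : @opspace R) y (a : 'End(V)) (b : 'End(W)) v w :
  super_tmap y a b (pure v w)
  = \sum_(i : bool) (-1) ^+ (y && i) *: pure (a (gr V i v)) (b w).
Proof.
rewrite tlift_pure // => x c z t; rewrite scaler_sumr -big_split.
  by apply: eq_bigr => i _; rewrite /= !homD !homZ pure_linl scalerDr !scalerA mulrC.
by apply: eq_bigr => i _; rewrite /= !homD !homZ pure_linr scalerDr !scalerA mulrC.
Qed.

Lemma super_tmap_even (V W : @opspace R) (mV : wmod V) (a : 'End(V)) (b : 'End(W)) v w :
  super_tmap false a b (pure v w) = pure (a v) (b w).
Proof.
rewrite super_tmapE big_bool /= !expr0 !scale1r -pureDl -homD addrC.
by rewrite (gr_sumE mV).
Qed.

Lemma super_tmap_hwt (V W : @opspace R) (mV : wmod V) y (a : 'End(V)) (b : 'End(W))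
    l p v w : hwt l p v ->
  super_tmap y a b (pure v w) = (-1) ^+ (y && p) *: pure (a v) (b w).
Proof.
move=> hv; rewrite super_tmapE big_bool !(hwt_gr mV _ hv).
by case: p hv => _ /=; rewrite hom0 pure0l scaler0 ?addr0 ?add0r.
Qed.

Lemma sign_cases (F : fieldType) (p : bool) : (-1) ^+ p = 1 :> F \/ (-1) ^+ p = -1 :> F.
Proof. by case: p; [right | left]. Qed.

Section TwoModules.
Context {V W : @opspace R} (mV : wmod V) (mW : wmod W).
Local Notation T := (wtens V W).

Lemma tensH v w : opH T (pure v w) = pure (opH V v) w + pure v (opH W w).
Proof. by rewrite add_lfunE !(super_tmap_even mV) !id_lfunE. Qed.

Lemma tensK v w : opK T (pure v w) = pure (opK V v) (opK W w).
Proof. exact: super_tmap_even. Qed.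

Lemma tensKi v w : opKi T (pure v w) = pure (opKi V v) (opKi W w).
Proof. exact: super_tmap_even. Qed.

Lemma tensE l p v w : hwt l p v ->
  opE T (pure v w) = (-1) ^+ p *: pure v (opE W w) + pure (opE V v) (opK W w).
Proof.
move=> hv; rewrite add_lfunE (super_tmap_even mV) (super_tmap_hwt mV _ _ _ _ hv).
by rewrite id_lfunE.
Qed.

Lemma tensF l p v w : hwt l p v ->
  opF T (pure v w) = ((-1) ^+ p / qp l) *: pure v (opF W w) + pure (opF V v) w.
Proof.
move=> hv; rewrite add_lfunE (super_tmap_even mV) (super_tmap_hwt mV _ _ _ _ hv).
by rewrite id_lfunE (hwt_Ki mV hv) pureZl scalerA.
Qed.

Lemma tens_gr i l p v m p' w : hwt l p v -> hwt m p' w ->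
  gr T i (pure v w) = if i == p (+) p' then pure v w else 0.
Proof.
move=> hv hw; rewrite sum_lfunE big_bool !tmap_pure !(hwt_gr mV _ hv) !(hwt_gr mW _ hw).
by case: p p' i hv hw => -[] [] _ _ /=; rewrite ?pure0l ?pure0r ?addr0 ?add0r.
Qed.

Lemma hwt_tens l p v m p' w : hwt l p v -> hwt m p' w ->
  @hwt R T (l + m) (p (+) p') (pure v w).
Proof.
move=> hv hw; split; first by rewrite (tens_gr _ hv hw) eqxx.
by case: hv hw => _ hv [_ hw]; rewrite tensH hv hw pureZl pureZr -scalerDl.
Qed.

Lemma homog_tens l p v m p' w : hwt l p v -> hwt m p' w ->
  @homog R r T (l + m) (p (+) p') (pure v w).
Proof.
move=> hv hw; have [a b] := hwt_tens hv hw; split=> //.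
- by rewrite (tens_gr _ hv hw); case: (_ (+) _).
- by rewrite tensK (hwt_K mV hv) (hwt_K mW hw) pureZl pureZr scalerA qexpD.
- by rewrite tensKi (hwt_Ki mV hv) (hwt_Ki mW hw) pureZl pureZr scalerA qexpD invfM.
Qed.

Lemma tensFn l p v w n : hwt l p v ->
  lfun_exp (opF T) n (pure v w)
  = \sum_(m < n.+1) (gauss (om r) n m * ((-1) ^+ p / qp l) ^+ (n - m))
      *: pure (lfun_exp (opF V) m v) (lfun_exp (opF W) (n - m) w).
Proof.
move=> hv.
pose t i j : car T := pure (lfun_exp (opF V) i v) (lfun_exp (opF W) j w).
have -> : pure v w = t 0%N 0%N by rewrite /t !lfun_exp0.
apply: (qbinomial (t := t)) => i j; rewrite /t (tensF _ (hwt_Fn mV i hv)).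
rewrite -!lfun_expS; congr (_ *: _ + _).
by rewrite signr_addb signr_odd qexpB qexp2n omX invf_div; ring.
Qed.

Lemma tensEn l p v m p' w n : hwt l p v -> hwt m p' w ->
  lfun_exp (opE T) n (pure v w)
  = \sum_(j < n.+1) (gauss (om r) n j * qp m ^+ (n - j) * (-1) ^+ ((p + (n - j)) * j)%N)
      *: pure (lfun_exp (opE V) (n - j) v) (lfun_exp (opE W) j w).
Proof.
move=> hv hw.
(* The sign is that of moving [E^j] past a vector of parity [p + i]; it brings the coefficients into
   the shape required by [qbinomial]. *)
pose t j i : car T := (-1) ^+ ((p + i) * j)%N *:
  pure (lfun_exp (opE V) i v) (lfun_exp (opE W) j w).
have -> : pure v w = t 0%N 0%N by rewrite /t !lfun_exp0 muln0 scale1r.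
rewrite (qbinomial (om := om r) (ka := qp m) (t := t)).
  by apply: eq_bigr => j _; rewrite /t scalerA.
move=> j i; rewrite /t homZ (tensE _ (hwt_En mV i hv)) -!lfun_expS.
rewrite (hwt_K mW (hwt_En mW j hw)).
rewrite pureZr scalerDr !scalerA addrC; congr (_ *: _ + _ *: _).
  rewrite qexpD qexp2n omX addnS (mulSn (p + i)) exprD.
  have ee : (-1) ^+ j * (-1) ^+ j = 1 :> C by rewrite -expr2 sqrr_sign.
  by rewrite -[LHS]mul1r -[X in X * _ = _]ee; ring.
by rewrite signr_addb signr_odd mulnS [in RHS]exprD exprD; ring.
Qed.

End TwoModules.

Lemma weight_module_tens (V W : @opspace R) : wmod V -> wmod W -> wmod (wtens V W).
Proof.
move=> mV mW; have [X [sX hX]] := homogeneous_span mV.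
have [Y [sY hY]] := homogeneous_span mW.
apply: (weight_moduleI (V := wtens V W) (X := [seq pure x y | x <- X, y <- Y])).
  apply/eqP; rewrite eqEsubv subvf /=; apply/subvP => t _.
  have pXY v w : pure v w \in <<[seq pure x y | x <- X, y <- Y]>>%VS.
    rewrite (@coord_span _ _ _ (in_tuple X) v) ?sX ?memvf // pure_suml memv_suml // => i _.
    rewrite pureZl memvZ //.
    rewrite (@coord_span _ _ _ (in_tuple Y) w) ?sY ?memvf // pure_sumr memv_suml // => j _.
    by rewrite pureZr memvZ // memv_span //; apply: allpairs_f; rewrite mem_nth.
  by rewrite [t]tens_pureE memv_suml.
move=> _ /allpairsP[[v w] /= [/hX[l [p hv]] /hY[m [p' hw]] ->]].
exists (l + m), (p (+) p').
have hE := hwt_E mV hv; have hE' := hwt_E mW hw.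
have hF := hwt_F mV hv; have hF' := hwt_F mW hw.
split; first exact: homog_tens.
- rewrite (tensE mV _ hv) (hwt_K mW hw) pureZr; apply: homogD; apply: homogZ.
    by rewrite -addbN -addrA; exact: homog_tens.
  by rewrite -addNb addrAC; exact: homog_tens.
- rewrite (tensF mV _ hv); apply: homogD.
    by apply: homogZ; rewrite -addbN -addrA; exact: homog_tens.
  by rewrite -addNb addrAC; exact: homog_tens.
split.
- rewrite (tensE mV _ hv) (tensF mV _ hv) !homD !homZ.
  rewrite !(tensE mV _ hv) !(tensF mV _ hv) !(tensE mV _ hF) !(tensF mV _ hE).
  rewrite (EF_hwt mV hv) (EF_hwt mW hw) (hwt_K mW hw) (hwt_K mW hF').
  rewrite !(pureDl, pureDr, pureZl, pureZr, pureNl, pureNr, homZ).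
  rewrite !qexpD qexpN !qexp2 !signrN.
  scalar_forms.
  have := qexp_neq0 r l; have := qexp_neq0 r m; have := q_neq0 (R := R) r.
  have : q * q - 1 != 0 by rewrite -expr2 subr_eq0 q2_neq1.
  move: (f _) (f _) (f _) (f _) (f _) => f1 f2 f3 f4 f5.
  move: (qp l) (qp m) q => x y z z1 z0 y0 x0.
  by have [->|->] := sign_cases C p; field; rewrite z0 z1 y0 x0.
(* The two extreme terms vanish because [E^r0] is zero on each factor, the others because their
   Gaussian binomial is zero. *)
- have e := r0_gt0 hr0; rewrite (tensEn mV mW _ hv hw) big1 // => -[j jr] _ /=.
  case: (posnP j) => [->|j0].
    by rewrite subn0 (rel_E0 mV) zero_lfunE pure0l scaler0.
  move: jr; rewrite ltnS leq_eqVlt => /orP[/eqP ->|jr].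
    by rewrite (rel_E0 mW) zero_lfunE pure0r scaler0.
  by rewrite (gauss_r0 r3 r8 hr0) ?j0 // !mul0r scale0r.
- rewrite (tensFn mV _ _ hv) big1 // => -[j jr] _ /=.
  case: (posnP j) => [->|j0].
    by rewrite subn0 (rel_F0 mW) zero_lfunE pure0r scaler0.
  move: jr; rewrite ltnS leq_eqVlt => /orP[/eqP ->|jr].
    by rewrite (rel_F0 mV) zero_lfunE pure0l scaler0.
  by rewrite (gauss_r0 r3 r8 hr0) ?j0 // !mul0r scale0r.
Qed.

End TensorModules.

(** * Dual weight modules *)

Section DualModules.
Context {R : realType}.
Local Notation C := R[i].
Variables (r r0 : nat).
Local Notation qp := (@qexp R r).
Local Notation q := (qp 1).
Local Notation wmod := (@weight_module R r r0).

Lemma weight_module_unit : (0 < r0)%N -> wmod wunit.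
Proof.
move=> r0p; apply: (weight_moduleI (V := @wunit R) (X := [:: 1 : C^o])).
  apply/eqP; rewrite eqEsubv subvf /=; apply/subvP => v _.
  by rewrite span_seq1; apply/vlineP; exists v; rewrite /GRing.scale /= mulr1.
move=> v; rewrite inE => /eqP ->; exists 0, false.
have z (n : nat) : (0 < n)%N -> lfun_exp (0 : 'End(C^o)) n 1 = 0.
  by case: n => // n _; rewrite lfun_expS zero_lfunE.
have h (l : C) p : l = 0 -> homog r l p (0 : @wunit R).
  by move=> ->; split; rewrite ?hom0 ?scaler0.
split.
- by split; rewrite /= ?zero_lfunE ?id_lfunE ?scale0r ?qexp0 ?invr1 ?scale1r.
- by rewrite /= zero_lfunE; split; rewrite ?hom0 ?scaler0.
- by rewrite /= zero_lfunE; split; rewrite ?hom0 ?scaler0.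
by split; rewrite ?z //= !zero_lfunE qexp0 invr1 subrr mul0r scale0r addr0.
Qed.

Lemma dual_actE (V : @opspace R) y (Sx : 'End(V)) (f : ldual V) v :
  (dual_act y Sx f : ldual V) v
  = \sum_(i : bool) (-1) ^+ (y && i) * (f (gr V i (Sx v)) : C) :> C.
Proof.
rewrite /dual_act linfunE.
  by rewrite sum_lfunE; apply: eq_bigr => i _; rewrite scale_lfunE !comp_lfunE.
move=> a x z; apply/lfunP => u; rewrite add_lfunE scale_lfunE !sum_lfunE.
rewrite scaler_sumr -big_split; apply: eq_bigr => i _ /=.
rewrite !scale_lfunE !comp_lfunE add_lfunE scale_lfunE scalerDr.
by rewrite /GRing.scale /= mulrCA.
Qed.

Lemma ldualD (V : vectType C) (f : ldual V) u v : f (u + v) = (f u : C) + f v :> C.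
Proof. by rewrite homD. Qed.

Lemma ldualZ (V : vectType C) (f : ldual V) a v : f (a *: v) = a * (f v : C) :> C.
Proof. by rewrite homZ. Qed.

Lemma ldualN (V : vectType C) (f : ldual V) v : f (- v) = - (f v : C) :> C.
Proof. by rewrite homN. Qed.

Section OneModule.
Context {V : @opspace R} (mV : wmod V).
Local Notation D := (wdual V).
Implicit Types f : ldual V.

Lemma dual_even (Sx : 'End(V)) f v : (dual_act false Sx f : ldual V) v = f (Sx v).
Proof.
by rewrite dual_actE big_bool /= !expr0 !mul1r -ldualD addrC (gr_sumE mV).
Qed.

Lemma dual_odd (Sx : 'End(V)) f v l p : hwt l p (Sx v) ->
  (dual_act true Sx f : ldual V) v = (-1) ^+ p * (f (Sx v) : C) :> C.
Proof.
move=> h; rewrite dual_actE big_bool /= !(hwt_gr mV _ h).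
by case: p h => h /=; rewrite hom0 mulr0 ?addr0 ?add0r.
Qed.

Lemma dual_gr i f v : (gr D i f : ldual V) v = f (gr V i v).
Proof.
by rewrite linfunE ?comp_lfunE // => a x y; rewrite comp_lfunDl comp_lfunZl.
Qed.

Lemma dualH f v : (opH D f : ldual V) v = - f (opH V v).
Proof. by rewrite dual_even opp_lfunE homN. Qed.

Lemma dualK f v : (opK D f : ldual V) v = f (opKi V v).
Proof. exact: dual_even. Qed.

Lemma dualKi f v : (opKi D f : ldual V) v = f (opK V v).
Proof. exact: dual_even. Qed.

Lemma dualE f l p v : hwt l p v ->
  (opE D f : ldual V) v = (-1) ^+ p / qp l * (f (opE V v) : C) :> C.
Proof.
move=> hv.
have e : (- (opE V \o opKi V))%VF v = (- (qp l)^-1) *: opE V v.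
  by rewrite opp_lfunE comp_lfunE (hwt_Ki mV hv) homZ scaleNr.
have h : hwt (l + 2) (~~ p) ((- (opE V \o opKi V))%VF v).
  by rewrite e; apply: hwtZ; exact: (hwt_E mV hv).
rewrite (dual_odd _ h) e ldualZ signrN mulrA; congr (_ * _).
by rewrite mulrNN.
Qed.

Lemma dualF f l p v : hwt l p v ->
  (opF D f : ldual V) v = (-1) ^+ p * qp (l - 2) * (f (opF V v) : C) :> C.
Proof.
move=> hv.
have e : (- (opK V \o opF V))%VF v = (- qp (l - 2)) *: opF V v.
  by rewrite opp_lfunE comp_lfunE (hwt_K mV (hwt_F mV hv)) scaleNr.
have h : hwt (l - 2) (~~ p) ((- (opK V \o opF V))%VF v).
  by rewrite e; apply: hwtZ; exact: (hwt_F mV hv).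
rewrite (dual_odd _ h) e ldualZ signrN mulrA; congr (_ * _).
by rewrite mulrNN.
Qed.

Lemma dualEn n f l p v : hwt l p v ->
  exists c : C, (lfun_exp (opE D) n f : ldual V) v = c * (f (lfun_exp (opE V) n v) : C) :> C.
Proof.
elim: n f => [|n IH] f hv; first by exists 1; rewrite !lfun_exp0 mul1r.
rewrite lfun_expSr; have [c ->] := IH (opE D f) hv.
by rewrite (dualE _ (hwt_En mV n hv)) mulrA -lfun_expS; eexists.
Qed.

Lemma dualFn n f l p v : hwt l p v ->
  exists c : C, (lfun_exp (opF D) n f : ldual V) v = c * (f (lfun_exp (opF V) n v) : C) :> C.
Proof.
elim: n f => [|n IH] f hv; first by exists 1; rewrite !lfun_exp0 mul1r.
rewrite lfun_expSr; have [c ->] := IH (opF D f) hv.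
by rewrite (dualF _ (hwt_Fn mV n hv)) mulrA -lfun_expS; eexists.
Qed.

(** Dualizing reverses the order of the operators, so the twist of a dual involves [E^n F^n]. In
    each matching pair of steps the powers of [q] cancel and the parities leave one sign. *)
Lemma dual_FnEn n f l p v : hwt l p v ->
  (lfun_exp (opF D) n (lfun_exp (opE D) n f) : ldual V) v
  = (-1) ^+ n * (f (lfun_exp (opE V) n (lfun_exp (opF V) n v)) : C) :> C.
Proof.
elim: n f l p v => [|n IH] f l p v hv; first by rewrite !lfun_exp0 mul1r.
rewrite lfun_expS lfun_expSr (dualF _ hv) (IH _ _ _ _ (hwt_F mV hv)).
have h := hwt_En mV n (hwt_Fn mV n (hwt_F mV hv)).
rewrite (dualE _ h) -lfun_expS -lfun_expSr !mulrA; congr (_ * _).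
rewrite addrNK -!addbA addbb addbF signrN exprS.
have e : (-1) ^+ p * (-1) ^+ p = 1 :> C by rewrite -expr2 sqrr_sign.
have := qexp_neq0 r (l - 2); move: (qp _) => x x0.
transitivity (- ((-1) ^+ p * (-1) ^+ p) * (-1) ^+ n * (x / x) : C); first by ring.
by rewrite e divff // mulr1 mulN1r.
Qed.

(* The nonzero functionals satisfying [cohwt l p] have weight [- l]. *)
Definition cohwt l p (f : ldual V) : Prop :=
  forall m p' v, hwt m p' v -> (m != l) || (p' != p) -> f v = 0.

Lemma cohwt_homog l p f : cohwt l p f -> @homog R r D (- l) p f.
Proof.
move=> hf; split; apply: (lfun_hwt mV) => m p' v hv.
- rewrite dual_gr (hwt_gr mV _ hv); case: eqP => // /eqP pp.
  by rewrite hom0 (hf _ _ _ hv) // (eq_sym p' p) pp orbT.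
- rewrite dual_gr (hwt_gr mV _ hv) zero_lfunE; case: eqP => [pp|_]; last exact: hom0.
  by apply: (hf _ _ _ hv); rewrite -pp; case: (p); rewrite orbT.
- rewrite dualH scale_lfunE (proj2 hv) homZ -scaleNr.
  have [->//|ne] := eqVneq m l.
  by rewrite (hf _ _ _ hv) ?ne // !scaler0.
- rewrite dualK scale_lfunE (hwt_Ki mV hv) homZ qexpN.
  have [->//|ne] := eqVneq m l.
  by rewrite (hf _ _ _ hv) ?ne // !scaler0.
- rewrite dualKi scale_lfunE (hwt_K mV hv) homZ qexpN invrK.
  have [->//|ne] := eqVneq m l.
  by rewrite (hf _ _ _ hv) ?ne // !scaler0.
Qed.

Lemma cohwt_E l p f : cohwt l p f -> cohwt (l - 2) (~~ p) (opE D f).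
Proof.
move=> hf m p' v hv ne; rewrite (dualE _ hv).
rewrite (hf _ _ _ (hwt_E mV hv)) ?mulr0 //.
by apply: contraTT ne; rewrite !negb_or !negbK => /andP[/eqP <- /eqP <-]; rewrite addrK negbK !eqxx.
Qed.

Lemma cohwt_F l p f : cohwt l p f -> cohwt (l + 2) (~~ p) (opF D f).
Proof.
move=> hf m p' v hv ne; rewrite (dualF _ hv).
rewrite (hf _ _ _ (hwt_F mV hv)) ?mulr0 //.
by apply: contraTT ne; rewrite !negb_or !negbK => /andP[/eqP <- /eqP <-]; rewrite subrK negbK !eqxx.
Qed.

Lemma cohwt_span : exists X : seq (ldual V),
  <<X>>%VS = {: ldual V}%VS /\ forall f, f \in X -> exists l p, cohwt l p f.
Proof.
have [n [b [ls [bb be]]]] := weight_basis mV.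
have cl (i : 'I_n) : linear (coord b i : V -> C^o) by move=> a x y; rewrite linearP.
pose g (i : 'I_n) : ldual V := linfun (coord b i : V -> C^o).
have gE (i : 'I_n) v : g i v = coord b i v by rewrite /g linfunE //; exact: cl.
(* Coordinates along an eigenbasis of [H], restricted to one parity: the basis itself need not be
   homogeneous. *)
pose gg i p : ldual V := (g i \o gr V p)%VF.
exists [seq gg i p | i <- enum 'I_n, p <- [:: true; false]]; split.
  apply/eqP; rewrite eqEsubv subvf /=; apply/subvP => f _.
  have -> : f = \sum_(i < n) (f b`_i : C) *: (gg i true + gg i false).
    apply/lfunP => v; rewrite sum_lfunE {1}[v](coord_basis bb (memvf v)) hom_sum.
    apply: eq_bigr => i _; rewrite scale_lfunE add_lfunE !comp_lfunE -homD addrC (gr_sumE mV).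
    by rewrite homZ gE /GRing.scale /= mulrC.
  rewrite memv_suml // => i _; rewrite memvZ //.
  have m p : gg i p \in <<[seq gg i p | i <- enum 'I_n, p <- [:: true; false]]>>%VS.
    apply: memv_span; apply/allpairsP; exists (i, p).
    by split=> //=; [rewrite mem_enum | case: (p)].
  by rewrite memvD.
move=> _ /allpairsP[[i p] /= [_ _ ->]]; exists (ls i), p => m p' v hv ne.
rewrite comp_lfunE (hwt_gr mV _ hv); case: (eqVneq p p') ne => [_|_ _]; last by rewrite hom0.
rewrite orbF => ne; rewrite gE.
have := coord_eigen bb be i v; rewrite (proj2 hv) linearZ /= => /eqP.
by rewrite -subr_eq0 -mulrBl mulf_eq0 subr_eq0 (negPf ne) => /eqP.
Qed.

Lemma weight_module_dual : wmod D.
Proof.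
have [X [sX hX]] := cohwt_span.
apply: (weight_moduleI (V := D) sX) => f /hX[l [p hf]]; exists (- l), p; split.
- exact: cohwt_homog.
- have -> : - l + 2 = - (l - 2) by ring.
  exact/cohwt_homog/cohwt_E.
- have -> : - l - 2 = - (l + 2) by ring.
  exact/cohwt_homog/cohwt_F.
split.
- apply: (lfun_hwt mV) => m p' v hv.
  rewrite add_lfunE (dualE _ hv) (dualF _ hv) (dualF _ (hwt_E mV hv)) (dualE _ (hwt_F mV hv)).
  rewrite scale_lfunE addrK !signrN (EF_hwt mV hv) ldualD ldualN ldualZ qexpN invrK.
  rewrite /GRing.scale /=.
  have m0 := qexp_neq0 r m; have m20 := qexp_neq0 r (m - 2).
  have [ne|] := boolP ((m != l) || (p' != p)).
    rewrite (hf _ _ _ hv ne) !mulr0; move: (qp m) (qp (m - 2)) m0 m20 (f _ : C) => x y x0 y0 z.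
    by move: (q - q^-1)^-1 => d; have [->|->] := sign_cases C p'; field; rewrite x0 y0.
  rewrite negb_or !negbK => /andP[/eqP <- _].
  move: (qp m) (qp (m - 2)) m0 m20 (f v : C) (f _ : C) => x y x0 y0 z t.
  by move: (q - q^-1)^-1 => d; have [->|->] := sign_cases C p'; field; rewrite x0 y0.
- apply: (lfun_hwt mV) => m p' v hv; have [c ->] := dualEn r0 f hv.
  by rewrite (rel_E0 mV) !zero_lfunE hom0 mulr0.
- apply: (lfun_hwt mV) => m p' v hv; have [c ->] := dualFn r0 f hv.
  by rewrite (rel_F0 mV) !zero_lfunE hom0 mulr0.
Qed.

End OneModule.
End DualModules.

(** * The rigid monoidal category *)

Section Morphisms.
Context {R : realType}.
Local Notation C := R[i].
Variables (r r0 : nat).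
Local Notation qp := (@qexp R r).
Local Notation q := (qp 1).
Local Notation wmod := (@weight_module R r r0).

(** Spanning, expressed by its effect on linear maps; in this form it applies to infinite sets of
    vectors and passes to tensor products. *)
Definition generating (V : vectType C) (P : V -> Prop) : Prop :=
  forall (U : vectType C) (f g : 'Hom(V, U)), (forall v, P v -> f v = g v) -> f = g.

Definition some_hwt (V : opspace) (v : V) : Prop := exists (l : C) (p : bool), hwt l p v.

Definition some_pure (V W : vectType C) (P : V -> Prop) (Q : W -> Prop) (t : tens V W) : Prop :=
  exists v w, [/\ P v, Q w & t = pure v w].

Lemma generating_hwt (V : opspace) : wmod V -> generating (@some_hwt V).
Proof.
by move=> mV U f g fg; apply: (lfun_hwt mV) => l p v hv; apply: fg; exists l, p.
Qed.

Lemma generating_pure (V W : vectType C) (P : V -> Prop) (Q : W -> Prop) :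
  generating P -> generating Q -> generating (some_pure P Q).
Proof.
move=> gP gQ U f g fg; apply: tens_ext => v w.
pose pl (w' : W) := linfun (fun v' : V => pure v' w').
pose pr (v' : V) := linfun (fun w' : W => pure v' w').
have plE w' v' : pl w' v' = pure v' w' by rewrite linfunE //; exact: pure_linl.
have prE v' w' : pr v' w' = pure v' w' by rewrite linfunE //; exact: pure_linr.
have fgr x : P x -> (f \o pr x = g \o pr x)%VF.
  move=> hx; apply: gQ => y hy.
  by rewrite !comp_lfunE prE; apply: fg; exists x, y.
have fgl : (f \o pl w = g \o pl w)%VF.
  apply: gP => x hx; rewrite !comp_lfunE plE -prE.
  by have := lfun_eq (fgr x hx) w; rewrite !comp_lfunE.
by have := lfun_eq fgl v; rewrite !comp_lfunE plE.
Qed.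

Lemma weight_morI (V W : @opspace R) (mV : wmod V) (mW : wmod W) (P : V -> Prop)
    (f : 'Hom(V, W)) :
    generating P ->
    (forall v, P v -> exists (l : C) (p : bool),
       [/\ hwt l p v, hwt l p (f v), f (opE V v) = opE W (f v)
         & f (opF V v) = opF W (f v)]) ->
  weight_mor f.
Proof.
move=> gP hP; split=> [i||||]; apply: gP => v /hP[l [p [hv hw hE hF]]];
  rewrite !comp_lfunE //.
- by rewrite (hwt_gr mV _ hv) (hwt_gr mW _ hw); case: eqP => // _; rewrite hom0.
- by rewrite (proj2 hv) (proj2 hw) homZ.
- by rewrite (hwt_K mV hv) (hwt_K mW hw) homZ.
Qed.

Section OneMorphism.
Context {V W : @opspace R} {f : 'Hom(V, W)} (mf : weight_mor f).

Lemma mor_hwt l p v : hwt l p v -> hwt l p (f v).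
Proof.
case=> gv Hv; have := lfun_eq (mor_gr mf p) v; have := lfun_eq (mor_H mf) v.
by rewrite !comp_lfunE gv Hv homZ => hH hg; split.
Qed.

Lemma morE v : f (opE V v) = opE W (f v).
Proof. by have := lfun_eq (mor_E mf) v; rewrite !comp_lfunE. Qed.

Lemma morF v : f (opF V v) = opF W (f v).
Proof. by have := lfun_eq (mor_F mf) v; rewrite !comp_lfunE. Qed.

Lemma morEn n v : f (lfun_exp (opE V) n v) = lfun_exp (opE W) n (f v).
Proof. by elim: n => [|n IH]; rewrite ?lfun_exp0 // !lfun_expS morE IH. Qed.

Lemma morFn n v : f (lfun_exp (opF V) n v) = lfun_exp (opF W) n (f v).
Proof. by elim: n => [|n IH]; rewrite ?lfun_exp0 // !lfun_expS morF IH. Qed.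

End OneMorphism.

Lemma weight_mor_id (V : @opspace R) : weight_mor (\1%VF : 'End(V)).
Proof. by split=> [i||||]; rewrite comp_lfun1l comp_lfun1r. Qed.

Lemma weight_mor_comp (U V W : @opspace R) (g : 'Hom(V, W)) (f : 'Hom(U, V)) :
  weight_mor g -> weight_mor f -> weight_mor (g \o f)%VF.
Proof.
move=> [a b c d e] [a' b' c' d' e']; split=> [i||||].
- by rewrite -comp_lfunA a' comp_lfunA a comp_lfunA.
- by rewrite -comp_lfunA b' comp_lfunA b comp_lfunA.
- by rewrite -comp_lfunA c' comp_lfunA c comp_lfunA.
- by rewrite -comp_lfunA d' comp_lfunA d comp_lfunA.
- by rewrite -comp_lfunA e' comp_lfunA e comp_lfunA.
Qed.

Lemma weight_mor_lin (V W : @opspace R) a (f g : 'Hom(V, W)) :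
  weight_mor f -> weight_mor g -> weight_mor (a *: f + g).
Proof.
move=> mf mg; split=> [i||||]; rewrite comp_lfunDl comp_lfunDr -comp_lfunZl -comp_lfunZr.
- by rewrite (mor_gr mf) (mor_gr mg).
- by rewrite (mor_H mf) (mor_H mg).
- by rewrite (mor_K mf) (mor_K mg).
- by rewrite (mor_E mf) (mor_E mg).
- by rewrite (mor_F mf) (mor_F mg).
Qed.

Lemma weight_mor0 (V W : @opspace R) : weight_mor (0 : 'Hom(V, W)).
Proof. by split=> [i||||]; rewrite comp_lfun0l comp_lfun0r. Qed.

Lemma weight_mor_inv (V W : @opspace R) (f : 'Hom(V, W)) (g : 'Hom(W, V)) :
  (g \o f = \1)%VF -> (f \o g = \1)%VF -> weight_mor f -> weight_mor g.
Proof.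
move=> gf fg mf.
have inv (a : 'End(V)) (b : 'End(W)) : (f \o a = b \o f)%VF -> (g \o b = a \o g)%VF.
  move=> h; rewrite -[RHS]comp_lfun1l -gf -[(_ \o f \o _)%VF]comp_lfunA.
  by rewrite (comp_lfunA f) h -comp_lfunA fg comp_lfun1r.
by split=> [i||||]; apply: inv; case: mf.
Qed.

Lemma tliftE (U V W : vectType C) (b : U -> V -> W) t :
  (forall v, linear (b v)) ->
  tlift b t = \sum_(i < \dim {:U}) b (vbasis {:U})`_i (t (dcoord i)).
Proof.
move=> br; rewrite /tlift linfunE // => a x y.
rewrite scaler_sumr -big_split; apply: eq_bigr => i _.
by rewrite add_lfunE scale_lfunE br.
Qed.

Lemma wasc_pure (U V W : vectType C) u v w :
  wasc U V W (pure (pure u v) w) = pure u (pure v w).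
Proof.
have b1 (w' : W) (u' : U) : linear (fun v' : V => pure u' (pure v' w')).
  by move=> a x y; rewrite pure_linl pure_linr.
have b2 (w' : W) (v' : V) : linear (fun u' : U => pure u' (pure v' w')).
  by move=> a x y; rewrite pure_linl.
rewrite /wasc tlift_pure.
- by rewrite tlift_pure.
- by move=> w'; move=> a x y; rewrite homD homZ.
move=> t a x y; rewrite !tliftE // scaler_sumr -big_split; apply: eq_bigr => i _.
by rewrite /= !pure_linr.
Qed.

Lemma wasci_pure (U V W : vectType C) u v w :
  wasci U V W (pure u (pure v w)) = pure (pure u v) w.
Proof.
have b1 (u' : U) (v' : V) : linear (fun w' : W => pure (pure u' v') w').
  by move=> a x y; rewrite pure_linr.
have b2 (u' : U) (w' : W) : linear (fun v' : V => pure (pure u' v') w').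
  by move=> a x y; rewrite pure_linr pure_linl.
rewrite /wasci tlift_pure.
- by rewrite tlift_pure.
- move=> t a x y; rewrite !tliftE // scaler_sumr -big_split; apply: eq_bigr => i _.
  by rewrite /= !pure_linl.
by move=> u'; move=> a x y; rewrite homD homZ.
Qed.

Lemma wlu_pure (V : vectType C) (a : C^o) v : wlu V (pure a v) = (a : C) *: v.
Proof.
rewrite /wlu tlift_pure // => [w b x y|x b w y].
  by rewrite scalerDl scalerA.
by rewrite scalerDr !scalerA mulrC.
Qed.

Lemma wru_pure (V : vectType C) (a : C^o) v : wru V (pure v a) = (a : C) *: v.
Proof.
rewrite /wru tlift_pure // => [w b x y|x b w y].
  by rewrite scalerDr !scalerA mulrC.
by rewrite scalerDl scalerA.
Qed.

Lemma wluiE (V : vectType C) v : wlui V v = pure (1 : C^o) v.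
Proof. by rewrite /wlui linfunE //; exact: pure_linr. Qed.

Lemma wruiE (V : vectType C) v : wrui V v = pure v (1 : C^o).
Proof. by rewrite /wrui linfunE //; exact: pure_linl. Qed.

Lemma tens3_ext (U V W X : vectType C) (f g : 'Hom(tens (tens U V) W, X)) :
  (forall u v w, f (pure (pure u v) w) = g (pure (pure u v) w)) -> f = g.
Proof.
move=> fg; apply: (generating_pure (P := some_pure (fun _ => True) (fun _ => True))
   (Q := fun _ => True)).
- by apply: generating_pure => ? f' g' h; apply/lfunP => v; exact: h.
- by move=> ? f' g' h; apply/lfunP => v; exact: h.
by move=> _ [_ [w [[u [v [_ _ ->]]] _ ->]]].
Qed.

Lemma tens3_extr (U V W X : vectType C) (f g : 'Hom(tens U (tens V W), X)) :
  (forall u v w, f (pure u (pure v w)) = g (pure u (pure v w))) -> f = g.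
Proof.
move=> fg; apply: (generating_pure (Q := some_pure (fun _ => True) (fun _ => True))
   (P := fun _ => True)).
- by move=> ? f' g' h; apply/lfunP => v; exact: h.
- by apply: generating_pure => ? f' g' h; apply/lfunP => v; exact: h.
by move=> _ [u [_ [_ [v [w [_ _ ->]]] ->]]].
Qed.

Lemma wascK (U V W : vectType C) : (wasci U V W \o wasc U V W = \1)%VF.
Proof.
by apply: tens3_ext => u v w; rewrite comp_lfunE id_lfunE wasc_pure wasci_pure.
Qed.

Lemma wasciK (U V W : vectType C) : (wasc U V W \o wasci U V W = \1)%VF.
Proof.
by apply: tens3_extr => u v w; rewrite comp_lfunE id_lfunE wasci_pure wasc_pure.
Qed.

Lemma wluK (V : vectType C) : (wlui V \o wlu V = \1)%VF.
Proof.
apply: tens_ext => a v; rewrite comp_lfunE id_lfunE wlu_pure wluiE pureZr -pureZl.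
by congr pure; rewrite /GRing.scale /= mulr1.
Qed.

Lemma wluiK (V : vectType C) : (wlu V \o wlui V = \1)%VF.
Proof. by apply/lfunP => v; rewrite comp_lfunE id_lfunE wluiE wlu_pure scale1r. Qed.

Lemma wruK (V : vectType C) : (wrui V \o wru V = \1)%VF.
Proof.
apply: tens_ext => v a; rewrite comp_lfunE id_lfunE wru_pure wruiE pureZl -pureZr.
by congr pure; rewrite /GRing.scale /= mulr1.
Qed.

Lemma wruiK (V : vectType C) : (wru V \o wrui V = \1)%VF.
Proof. by apply/lfunP => v; rewrite comp_lfunE id_lfunE wruiE wru_pure scale1r. Qed.

Hypotheses (r3 : (3 <= r)%N) (r8 : (r %% 8 != 4)%N) (hr0 : least_zero_qbr R r r0).

Local Notation mtens := (weight_module_tens r3 r8 hr0).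

Lemma weight_mor_tmap (A A' B B' : @opspace R) (f : 'Hom(A, A')) (g : 'Hom(B, B')) :
    wmod A -> wmod A' -> wmod B -> wmod B' -> weight_mor f -> weight_mor g ->
  @weight_mor R (wtens A B) (wtens A' B') (tmap f g).
Proof.
move=> mA mA' mB mB' mf mg.
have gen := generating_pure (generating_hwt mA) (generating_hwt mB).
apply: (weight_morI (mtens mA mB) (mtens mA' mB') gen).
move=> _ [v [w [[l [p hv]] [m [p' hw]] ->]]]; exists (l + m), (p (+) p').
have hfv := mor_hwt mf hv; have hgw := mor_hwt mg hw.
split; first exact: (hwt_tens mA mB).
- by rewrite tmap_pure; exact: (hwt_tens mA' mB').
- rewrite (tensE mA _ hv) homD homZ !tmap_pure (tensE mA' _ hfv) (morE mf) (morE mg).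
  by rewrite (hwt_K mB hw) (hwt_K mB' hgw) homZ.
by rewrite (tensF mA _ hv) homD homZ !tmap_pure (tensF mA' _ hfv) (morF mf) (morF mg).
Qed.

Lemma weight_mor_asc (A B D : @opspace R) : wmod A -> wmod B -> wmod D ->
  @weight_mor R (wtens (wtens A B) D) (wtens A (wtens B D)) (wasc A B D).
Proof.
move=> mA mB mD.
apply: (weight_morI (mtens (mtens mA mB) mD) (mtens mA (mtens mB mD)) (generating_pure
  (generating_pure (generating_hwt mA) (generating_hwt mB)) (generating_hwt mD))).
move=> _ [_ [w [[u [v [[l [p hu]] [m [p' hv]] ->]]] [n [p'' hw]] ->]]].
exists (l + m + n), (p (+) p' (+) p'').
have huv := hwt_tens mA mB hu hv; have hvw := hwt_tens mB mD hv hw.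
split; first exact: (hwt_tens (mtens mA mB) mD huv hw).
- rewrite wasc_pure -addrA -addbA; exact: (hwt_tens mA (mtens mB mD) hu hvw).
- rewrite (tensE (mtens mA mB) _ huv) wasc_pure (tensE mA _ hu) (tensE mA _ hu) (tensE mB _ hv).
  rewrite (tensK mB) !(homD, homZ, pureDl, pureDr, pureZl, pureZr) !wasc_pure scalerDr scalerA.
  by rewrite signr_addb addrA.
rewrite (tensF (mtens mA mB) _ huv) wasc_pure (tensF mA _ hu) (tensF mA _ hu) (tensF mB _ hv).
rewrite !(homD, homZ, pureDl, pureDr, pureZl, pureZr) !wasc_pure scalerDr scalerA addrA.
by rewrite signr_addb qexpD invfM mulrACA.
Qed.

Lemma weight_mor_lu (V : @opspace R) : wmod V -> @weight_mor R (wtens wunit V) V (wlu V).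
Proof.
move=> mV; have mI : wmod wunit := weight_module_unit r (r0_gt0 hr0).
have gI : @generating (car (@wunit R)) (fun _ => True).
  by move=> U f g h; apply/lfunP => a; exact: h.
refine (weight_morI (V := wtens wunit V) (f := wlu V) (mtens mI mV) mV
  (generating_pure gI (generating_hwt mV)) _).
move=> _ [a [w [_ [m [p' hw]] ->]]]; exists (0 + m), (false (+) p').
have ha : @hwt R wunit 0 false a by split; rewrite ?id_lfunE // zero_lfunE scale0r.
split; first exact: (hwt_tens mI mV).
- by rewrite wlu_pure add0r addFb; exact: hwtZ.
- rewrite (tensE mI _ ha) expr0 scale1r zero_lfunE pure0l addr0.
  by rewrite !wlu_pure homZ.
rewrite (tensF mI _ ha) expr0 qexp0 invr1 mulr1 scale1r zero_lfunE pure0l addr0.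
by rewrite !wlu_pure homZ.
Qed.

Lemma weight_mor_ru (V : @opspace R) : wmod V -> @weight_mor R (wtens V wunit) V (wru V).
Proof.
move=> mV; have mI : wmod wunit := weight_module_unit r (r0_gt0 hr0).
have gI : @generating (car (@wunit R)) (fun _ => True).
  by move=> U f g h; apply/lfunP => a; exact: h.
refine (weight_morI (V := wtens V wunit) (f := wru V) (mtens mV mI) mV
  (generating_pure (generating_hwt mV) gI) _).
move=> _ [w [a [[m [p' hw]] _ ->]]]; exists (m + 0), (p' (+) false).
have ha : @hwt R wunit 0 false a by split; rewrite ?id_lfunE // zero_lfunE scale0r.
split; first exact: (hwt_tens mV mI).
- by rewrite wru_pure addr0 addbF; exact: hwtZ.
- rewrite (tensE mV _ hw) zero_lfunE pure0r scaler0 add0r.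
  by rewrite id_lfunE !wru_pure homZ.
rewrite (tensF mV _ hw) zero_lfunE pure0r scaler0 add0r.
by rewrite !wru_pure homZ.
Qed.

Variable s : int.
Local Notation cat := (weight_category R r r0 s).

Lemma weight_linear_category : linear_category cat.
Proof.
split.
- by move=> A _; exact: weight_mor_id.
- by move=> A B D g f _ _ _; exact: weight_mor_comp.
- by move=> A B f _ _ _; exact: comp_lfun1l.
- by move=> A B f _ _ _; exact: comp_lfun1r.
- by move=> A B D D' h g f *; exact: comp_lfunA.
- by move=> A B _ _; exact: weight_mor0.
- by move=> A B a f g _ _; exact: weight_mor_lin.
- by move=> A B D a g g' f *; rewrite /= comp_lfunDl -comp_lfunZl.
- by move=> A B D a g f f' *; rewrite /= comp_lfunDr -comp_lfunZr.
Qed.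

Lemma weight_monoidal_category : linear_monoidal_category cat.
Proof.
split.
- exact: weight_linear_category.
- exact: weight_module_unit (r0_gt0 hr0).
- by move=> A B; exact: mtens.
- by move=> A A' B B' f g *; exact: weight_mor_tmap.
- by move=> A B *; exact: tmap_id.
- by move=> A A' A'' B B' B'' f' f g' g *; exact: tmap_comp.
- by move=> A A' B B' a f f' g *; exact: tmapDl.
- by move=> A A' B B' a f g g' *; exact: tmapDr.
- move=> A B D mA mB mD; have m := weight_mor_asc mA mB mD.
  split=> //; [|exact: wascK|exact: wasciK].
  exact: (weight_mor_inv (V := wtens (wtens A B) D) (W := wtens A (wtens B D))
    (wascK _ _ _) (wasciK _ _ _) m).
- move=> A mA; have m := weight_mor_lu mA.
  split=> //; [|exact: wluK|exact: wluiK].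
  exact: (weight_mor_inv (V := wtens wunit A) (wluK _) (wluiK _) m).
- move=> A mA; have m := weight_mor_ru mA.
  split=> //; [|exact: wruK|exact: wruiK].
  exact: (weight_mor_inv (V := wtens A wunit) (wruK _) (wruiK _) m).
- move=> A A' B B' D D' f g h *; apply: tens3_ext => u v w.
  by rewrite /= !comp_lfunE wasc_pure !tmap_pure wasc_pure.
- move=> A A' f *; apply: tens_ext => u v.
  by rewrite /= !comp_lfunE tmap_pure !wlu_pure id_lfunE homZ.
- move=> A A' f *; apply: tens_ext => u v.
  by rewrite /= !comp_lfunE tmap_pure !wru_pure id_lfunE homZ.
- move=> A B *; apply: tens3_ext => u v w.
  by rewrite /= !comp_lfunE wasc_pure !tmap_pure !id_lfunE wlu_pure wru_pure pureZl pureZr.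
- move=> A B D D' *; apply: (generating_pure (P := some_pure (some_pure (fun _ => True)
    (fun _ => True)) (fun _ => True)) (Q := fun _ => True)).
  + apply: generating_pure; last by move=> ? f' g' h; apply/lfunP => v; exact: h.
    by apply: generating_pure => ? f' g' h; apply/lfunP => v; exact: h.
  + by move=> ? f' g' h; apply/lfunP => v; exact: h.
  move=> _ [_ [d [[_ [w [[u [v [_ _ ->]]] _ ->]]] _ ->]]].
  by rewrite /= !comp_lfunE !(wasc_pure, tmap_pure, id_lfunE).
Qed.

End Morphisms.

Lemma sub_lfunE (k : fieldType) (V W : vectType k) (f g : 'Hom(V, W)) x :
  (f - g)%VF x = f x - g x.
Proof. by rewrite add_lfunE opp_lfunE. Qed.

(** * Evaluations, coevaluations and the pivot *)

Section Rigidity.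
Context {R : realType}.
Local Notation C := R[i].
Variables (r r0 : nat).
Local Notation qp := (@qexp R r).
Local Notation q := (qp 1).
Local Notation wmod := (@weight_module R r r0).

(** Expresses Koszul signs as an operator, which is needed in sums over [vbasis], whose members need
    not be homogeneous. *)
Definition parity_op (V : @opspace R) : 'End(V) := locked (gr V false - gr V true).

Lemma parityE (V : @opspace R) v : parity_op V v = gr V false v - gr V true v.
Proof. by rewrite /parity_op -lock sub_lfunE. Qed.

Section OneModule.
Context {V : @opspace R} (mV : wmod V).

Lemma parity_hwt l p v : hwt l p v -> parity_op V v = (-1) ^+ p *: v.
Proof.
move=> hv; rewrite parityE !(hwt_gr mV _ hv).
by case: p hv => _ /=; rewrite ?sub0r ?subr0 ?expr1 ?expr0 ?scaleN1r ?scale1r.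
Qed.

Lemma parityK v : parity_op V (parity_op V v) = v.
Proof.
rewrite -comp_lfunE -[RHS](id_lfunE v); apply: lfun_eq; apply: (lfun_hwt mV) => l p x hx.
rewrite comp_lfunE id_lfunE (parity_hwt hx) homZ (parity_hwt hx) scalerA.
by rewrite -expr2 sqrr_sign scale1r.
Qed.

Lemma Kpow_hwt n l p v : hwt l p v -> Kpow V n v = qp (n%:~R * l) *: v.
Proof.
move=> hv; have pw (f : 'End(V)) c m : f v = c *: v -> lfun_exp f m v = c ^+ m *: v.
  move=> fv; elim: m => [|m IH]; first by rewrite lfun_exp0 scale1r.
  by rewrite lfun_expS IH homZ fv scalerA exprSr.
case: n => n; first by rewrite (pw _ _ n (hwt_K mV hv)) mulr_natl qexpMn.
rewrite (pw _ _ n.+1 (hwt_Ki mV hv)) NegzE mulrNz mulNr qexpN -pmulrn mulr_natl qexpMn.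
by rewrite exprVn.
Qed.

(** In a nonzero pairing [f v] the parities of [f] and [v] agree, so the sign [(-1)^(|f| |v|)] is
    [(-1)^|v|] and can be absorbed into the operator applied to [v]. *)
Definition pivot n : 'End(V) := locked (Kpow V n \o parity_op V)%VF.

Lemma pivotE n v : pivot n v = Kpow V n (parity_op V v).
Proof. by rewrite /pivot -lock comp_lfunE. Qed.

Lemma pivot_hwt n l p v : hwt l p v -> pivot n v = ((-1) ^+ p * qp (n%:~R * l)) *: v.
Proof. by move=> hv; rewrite pivotE (parity_hwt hv) homZ (Kpow_hwt n hv) scalerA. Qed.

Lemma pivotK m n : m + n = 0 -> (pivot m \o pivot n = \1)%VF.
Proof.
move=> mn; apply: (lfun_hwt mV) => l p v hv.
rewrite comp_lfunE id_lfunE (pivot_hwt _ hv) homZ (pivot_hwt _ hv) scalerA.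
rewrite mulrACA -expr2 sqrr_sign mul1r -qexpD -mulrDl -intrD addrC mn mul0r qexp0.
exact: scale1r.
Qed.

Lemma gr_Kpow n i v : gr V i (Kpow V n v) = Kpow V n (gr V i v).
Proof.
rewrite -!comp_lfunE; apply: lfun_eq; apply: (lfun_hwt mV) => l p x hx.
rewrite !comp_lfunE (Kpow_hwt n hx) homZ !(hwt_gr mV _ hx).
by case: eqP => _; [rewrite (Kpow_hwt n hx) | rewrite hom0 scaler0].
Qed.

Lemma tensE_op (W : @opspace R) v w :
  opE (wtens V W) (pure v w) = pure (parity_op V v) (opE W w) + pure (opE V v) (opK W w).
Proof.
rewrite add_lfunE (super_tmap_even mV) super_tmapE big_bool /= !id_lfunE; congr (_ + _).
by rewrite parityE pureDl pureNl expr0 expr1 scale1r scaleN1r addrC.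
Qed.

Lemma tensF_op (W : @opspace R) v w :
  opF (wtens V W) (pure v w) = pure (opKi V (parity_op V v)) (opF W w) + pure (opF V v) w.
Proof.
rewrite add_lfunE (super_tmap_even mV) super_tmapE big_bool /= !id_lfunE; congr (_ + _).
by rewrite parityE homB pureDl pureNl expr0 expr1 scale1r scaleN1r addrC.
Qed.

Lemma dualE_op (f : ldual V) :
  opE (wdual V) f = - (f \o (parity_op V \o opE V \o opKi V))%VF :> ldual V.
Proof.
apply/lfunP => v; rewrite dual_actE big_bool /=. rewrite !opp_lfunE !comp_lfunE parityE.
by rewrite !homN homB expr0 expr1 mulN1r mul1r opprK opprB.
Qed.

Lemma dualF_op (f : ldual V) :
  opF (wdual V) f = - (f \o (parity_op V \o opK V \o opF V))%VF :> ldual V.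
Proof.
apply/lfunP => v; rewrite dual_actE big_bool /= !opp_lfunE !comp_lfunE parityE.
by rewrite !homN homB expr0 expr1 mulN1r mul1r opprK opprB.
Qed.

Lemma dual_pairing (f : ldual V) l p v m p' :
    @hwt R (wdual V) l p f -> hwt m p' v ->
  f v = 0 \/ (l = - m /\ p = p').
Proof.
move=> [gf Hf] hv; have [->|fv0] := eqVneq (f v : C) 0; first by left.
right; split.
  have := dualH mV f v; rewrite Hf scale_lfunE (proj2 hv) homZ -scaleNr => /eqP.
  by rewrite -subr_eq0 -scalerBl /GRing.scale /= mulf_eq0 (negPf fv0) orbF subr_eq0 => /eqP.
have := dual_gr p f v; rewrite gf (hwt_gr mV _ hv); case: eqP => // _.
by rewrite hom0 => e; rewrite e eqxx in fv0.
Qed.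

End OneModule.
Arguments pivot : clear implicits.

Lemma koszulE (V W : @opspace R) (U : vectType C) (b : V -> W -> U) v w :
    (forall w, linear (b^~ w)) -> (forall v, linear (b v)) ->
  tlift (koszul b) (pure v w) = koszul b v w.
Proof.
move=> bl br; rewrite tlift_pure // /koszul.
  move=> x a y z; rewrite scaler_sumr -big_split; apply: eq_bigr => i _.
  rewrite scaler_sumr -big_split; apply: eq_bigr => j _ /=.
  by rewrite homD homZ bl scalerDr !scalerA mulrC.
move=> x a y z; rewrite scaler_sumr -big_split; apply: eq_bigr => i _.
rewrite scaler_sumr -big_split; apply: eq_bigr => j _ /=.
by rewrite homD homZ br scalerDr !scalerA mulrC.
Qed.

Variable s : int.
Local Notation piv := (fun V : @opspace R => pivot V (1 - s)).

Lemma wevl_pure (V : @opspace R) (f : ldual V) v : wevl V (pure f v) = f v.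
Proof.
rewrite /wevl tlift_pure // => [w a x y|g a x y]; last by rewrite homD homZ.
by rewrite add_lfunE scale_lfunE.
Qed.

Lemma wevr_pure (V : @opspace R) (f : ldual V) v :
  wmod V -> wevr s V (pure v f) = f (piv V v).
Proof.
move=> mV; rewrite /wevr koszulE /=; first last.
- by move=> x a y z; rewrite add_lfunE scale_lfunE.
- by move=> x a y z; rewrite !homD !homZ.
rewrite /koszul !big_bool /= !(dual_gr, gr_Kpow mV, grgr mV) /= !hom0 !scaler0.
rewrite !addr0 !add0r expr0 expr1 scale1r scaleN1r addrC.
by rewrite pivotE parityE !homB.
Qed.

Lemma wcoevlE (V : @opspace R) (a : C^o) :
  wcoevl V a = (a : C) *: \sum_(i < \dim {:V}) pure (vbasis {:V})`_i (dcoord i).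
Proof. by rewrite /wcoevl linfunE // => b x y; rewrite scalerDl scalerA. Qed.

Lemma wcoevrE (V : @opspace R) (a : C^o) :
  wcoevr s V a = (a : C) *:
    \sum_(i < \dim {:V}) pure (dcoord i) (pivot V (s - 1) (vbasis {:V})`_i).
Proof.
rewrite /wcoevr linfunE; last by move=> b x y; rewrite scalerDl scalerA.
congr (_ *: _); apply: eq_bigr => i _; rewrite big_bool /= pivotE parityE homB.
by rewrite pureDr pureNr expr0 expr1 scale1r scaleN1r addrC.
Qed.

(** Moves an operator from the dual factor of the coevaluation to the other factor, where invariance
    becomes a cancellation of operators. *)
Lemma coev_transpose (V : @opspace R) (A B : 'End(V)) :
  \sum_(i < \dim {:V}) pure (B (vbasis {:V})`_i) (dcoord i \o A : ldual V)%VF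
  = \sum_(i < \dim {:V}) pure (B (A (vbasis {:V})`_i)) (dcoord i).
Proof.
rewrite (dcoord_transpose (b := fun v (f : ldual V) => pure (B v) f)) //.
  by move=> f a x y; rewrite homD homZ pure_linl.
by move=> v a x y; rewrite pure_linr.
Qed.

Lemma coev_transposer (V : @opspace R) (A B : 'End(V)) :
  \sum_(i < \dim {:V}) pure (dcoord i \o A : ldual V)%VF (B (vbasis {:V})`_i)
  = \sum_(i < \dim {:V}) pure (dcoord i) (B (A (vbasis {:V})`_i)).
Proof.
rewrite (dcoord_transpose (b := fun v (f : ldual V) => pure f (B v))) //.
  by move=> f a x y; rewrite homD homZ pure_linr.
by move=> v a x y; rewrite pure_linl.
Qed.

Hypotheses (r3 : (3 <= r)%N) (r8 : (r %% 8 != 4)%N) (hr0 : least_zero_qbr R r r0).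
Hypothesis hs : qp (2 * s)%:~R = 1.
Local Notation mtens := (weight_module_tens r3 r8 hr0).

Lemma mod_unit : @weight_module R r r0 wunit.
Proof. exact: weight_module_unit (r0_gt0 hr0). Qed.

Lemma weight_mor_evl (V : @opspace R) (mV : wmod V) :
  @weight_mor R (wtens (wdual V) V) wunit (wevl V).
Proof.
have mD := weight_module_dual mV.
refine (weight_morI (mtens mD mV) mod_unit
  (generating_pure (generating_hwt mD) (generating_hwt mV)) _).
move=> _ [f [v [[l [p hf]] [m [p' hv]] ->]]]; exists (l + m), (p (+) p').
split; first exact: (hwt_tens mD mV).
- rewrite wevl_pure; have [->|[-> ->]] := dual_pairing mV hf hv; first exact: hwt0.
  by rewrite addNr addbb; split; rewrite /= ?id_lfunE // zero_lfunE scale0r.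
- rewrite (tensE mD _ hf) (hwt_K mV hv) pureZr homD !homZ !wevl_pure (dualE mV _ hv) zero_lfunE.
  have [->|[_ ->]] := dual_pairing mV hf (hwt_E mV hv); first by rewrite mulr0 !scaler0 addr0.
  rewrite /GRing.scale /= signrN mulrA [qp m * _]mulrC divfK ?qexp_neq0 // -mulrDl.
  by rewrite addNr mul0r.
rewrite (tensF mD _ hf) homD homZ !wevl_pure (dualF mV _ hv) zero_lfunE.
have [->|[-> ->]] := dual_pairing mV hf (hwt_F mV hv); first by rewrite mulr0 !scaler0 addr0.
rewrite /GRing.scale /= signrN qexpN invrK -mulrDl.
by rewrite mulNr addNr mul0r.
Qed.

(** Here [q^(2 s) = 1] enters: [K^s] does not see a shift of the weight by 2, so [K^(s-1)] changes
    like [K^-1]. *)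
Lemma qexp_pivN x : qp ((s - 1)%:~R * (x + 2)) = qp ((s - 1)%:~R * x) / q ^+ 2.
Proof.
rewrite mulrDr qexpD; congr (_ * _); rewrite intrB mulrBl mul1r qexpB qexp2.
have -> : s%:~R * 2 = (2 * s)%:~R :> C by rewrite intrM mulrC.
by rewrite hs mul1r.
Qed.

Lemma qexp_piv x : qp ((1 - s)%:~R * (x + 2)) = qp ((1 - s)%:~R * x) * q ^+ 2.
Proof.
rewrite mulrDr qexpD; congr (_ * _); rewrite intrB mulrBl mul1r qexpB.
have -> : s%:~R * 2 = (2 * s)%:~R :> C by rewrite intrM mulrC.
by rewrite hs invr1 mulr1 qexp2.
Qed.

Lemma weight_mor_evr (V : @opspace R) (mV : wmod V) :
  @weight_mor R (wtens V (wdual V)) wunit (wevr s V).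
Proof.
have mD := weight_module_dual mV.
refine (weight_morI (mtens mV mD) mod_unit
  (generating_pure (generating_hwt mV) (generating_hwt mD)) _).
move=> _ [v [f [[m [p' hv]] [l [p hf]] ->]]]; exists (m + l), (p' (+) p).
split; first exact: (hwt_tens mV mD).
- rewrite (wevr_pure _ _ mV) (pivot_hwt mV _ hv) homZ; apply: hwtZ.
  have [->|[-> ->]] := dual_pairing mV hf hv; first exact: hwt0.
  by rewrite addrN addbb; split; rewrite /= ?id_lfunE // zero_lfunE scale0r.
- rewrite (tensE (W := wdual V) mV f hv) (hwt_K mD hf) pureZr homD !homZ.
  rewrite (wevr_pure _ _ mV) [X in _ + _ *: X](wevr_pure _ _ mV).
  rewrite (pivot_hwt mV _ hv) (pivot_hwt mV _ (hwt_E mV hv)) !homZ (dualE mV _ hv) zero_lfunE.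
  have [->|[-> _]] := dual_pairing mV hf (hwt_E mV hv); first by rewrite mulr0 !scaler0 addr0.
  rewrite /GRing.scale /= signrN qexp_piv qexpN qexpD qexp2.
  have := qexp_neq0 r m; have := q_neq0 (R := R) r; move: (f _ : C) (qp m) (qp _) q.
  by move=> x y z t t0 y0; have [->|->] := sign_cases C p'; field; rewrite t0 y0.
rewrite (tensF (W := wdual V) mV f hv) homD homZ (wevr_pure _ _ mV).
rewrite [X in _ + X](wevr_pure _ _ mV) (pivot_hwt mV _ hv).
rewrite (pivot_hwt mV _ (hwt_F mV hv)) !homZ (dualF mV _ hv) zero_lfunE.
rewrite /GRing.scale /= signrN.
have := qexp_piv (m - 2); rewrite subrK => ->; rewrite qexpB qexp2.
have := qexp_neq0 r m; have := q_neq0 (R := R) r; move: (f _ : C) (qp m) (qp _) q.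
by move=> x y z t t0 y0; have [->|->] := sign_cases C p'; field; rewrite t0 y0.
Qed.

Lemma generating_one : generating (fun a : car (@wunit R) => a = (1 : C^o)).
Proof.
move=> U f g h; apply/lfunP => a.
have -> : a = (a : C) *: (1 : C^o) by rewrite /GRing.scale /= mulr1.
by rewrite !homZ h.
Qed.

Lemma weight_mor_from_unit (V : @opspace R) (mV : wmod V) (f : 'Hom(wunit, V)) :
  gr V false (f (1 : C^o)) = f (1 : C^o) -> opH V (f (1 : C^o)) = 0 ->
  opE V (f (1 : C^o)) = 0 -> opF V (f (1 : C^o)) = 0 -> weight_mor f.
Proof.
move=> g h e e'; apply: (weight_morI mod_unit mV generating_one) => _ ->.
exists 0, false; split; rewrite ?zero_lfunE ?hom0 //.
  by split; rewrite /= ?id_lfunE // zero_lfunE scale0r.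
by split; rewrite // scale0r.
Qed.

Lemma weight_mor_coevl (V : @opspace R) (mV : wmod V) :
  @weight_mor R wunit (wtens V (wdual V)) (wcoevl V).
Proof.
have mD := weight_module_dual mV.
apply: (weight_mor_from_unit (mtens mV mD)); rewrite wcoevlE scale1r hom_sum.
- under eq_bigr => i _ do rewrite sum_lfunE big_bool /= !tmap_pure.
  rewrite big_split /=.
  have grD (i : bool) (f : ldual V) : gr (wdual V) i f = (f \o gr V i)%VF.
    by apply/lfunP => v; rewrite dual_gr comp_lfunE.
  under eq_bigr => i _ do rewrite grD.
  under [X in _ + X = _]eq_bigr => i _ do rewrite grD.
  rewrite !coev_transpose -big_split; apply: eq_bigr => i _ /=.
  by rewrite !(grgr mV) /= -pureDl addrC (gr_sumE mV).
- under eq_bigr => i _ do rewrite (tensH mV).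
  rewrite big_split /=.
  have HD (f : ldual V) : opH (wdual V) f = - (f \o opH V)%VF.
    by apply/lfunP => v; rewrite (dualH mV) opp_lfunE comp_lfunE.
  under [X in _ + X = _]eq_bigr => i _ do rewrite HD pureNr -{1}[_`_i]id_lfunE.
  rewrite sumrN coev_transpose -sumrB big1 // => i _.
  by rewrite id_lfunE subrr.
- under eq_bigr => i _ do rewrite (tensE_op mV).
  rewrite big_split /=.
  under eq_bigr => i _ do rewrite dualE_op pureNr.
  have KD (f : ldual V) : opK (wdual V) f = (f \o opKi V)%VF.
    by apply/lfunP => v; rewrite (dualK mV) comp_lfunE.
  under [X in _ + X = _]eq_bigr => i _ do rewrite KD.
  rewrite sumrN !coev_transpose addrC -sumrB big1 // => i _.
  by rewrite !comp_lfunE (parityK mV) subrr.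
under eq_bigr => i _ do rewrite (tensF_op mV).
rewrite big_split /=.
under eq_bigr => i _ do rewrite dualF_op pureNr -comp_lfunE.
rewrite sumrN !coev_transpose addrC -sumrB big1 // => i _.
by rewrite !comp_lfunE (parityK mV) (KiKE mV) subrr.
Qed.

Lemma weight_mor_coevr (V : @opspace R) (mV : wmod V) :
  @weight_mor R wunit (wtens (wdual V) V) (wcoevr s V).
Proof.
have mD := weight_module_dual mV.
have grD (i : bool) (f : ldual V) : gr (wdual V) i f = (f \o gr V i)%VF.
  by apply/lfunP => v; rewrite dual_gr comp_lfunE.
have HD (f : ldual V) : opH (wdual V) f = - (f \o opH V)%VF.
  by apply/lfunP => v; rewrite (dualH mV) opp_lfunE comp_lfunE.
have KiD (f : ldual V) : opKi (wdual V) f = (f \o opK V)%VF.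
  by apply/lfunP => v; rewrite (dualKi mV) comp_lfunE.
have PD (f : ldual V) : parity_op (wdual V) f = (f \o parity_op V)%VF.
  by apply/lfunP => v; rewrite parityE !grD sub_lfunE !comp_lfunE parityE homB.
apply: (weight_mor_from_unit (mtens mD mV)); rewrite wcoevrE scale1r hom_sum.
- under eq_bigr => i _ do rewrite sum_lfunE big_bool /= !tmap_pure !grD -!comp_lfunE.
  rewrite big_split /= !coev_transposer -big_split; apply: eq_bigr => i _ /=.
  have grp (j : bool) x : gr V j (pivot V (s - 1) x) = pivot V (s - 1) (gr V j x).
    rewrite -!comp_lfunE; apply: lfun_eq; apply: (lfun_hwt mV) => l p v hv.
    rewrite !comp_lfunE (pivot_hwt mV _ hv) homZ !(hwt_gr mV _ hv).
    by case: eqP => _; rewrite ?(pivot_hwt mV _ hv) ?hom0 ?scaler0.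
  rewrite -pureDr !comp_lfunE !grp !(grgr mV) /= -homD [_ + gr V false _]addrC (gr_sumE mV) //.
- have Hp x : opH V (pivot V (s - 1) x) = pivot V (s - 1) (opH V x).
    rewrite -!comp_lfunE; apply: lfun_eq; apply: (lfun_hwt mV) => l p v hv.
    by rewrite !comp_lfunE (pivot_hwt mV _ hv) homZ (proj2 hv) homZ (pivot_hwt mV _ hv) !scalerA mulrC.
  under eq_bigr => i _ do rewrite (tensH mD) HD pureNl -comp_lfunE.
  rewrite big_split /= sumrN coev_transposer addrC -sumrB big1 // => i _.
  by rewrite comp_lfunE Hp subrr.
(* After transposition, invariance under [E] is this identity. The two parity operators cancel and
   it reads [K^(1-s) E K^(s-1) = K E K^-1], the square of the antipode. *)
- have Ep x : opE V (pivot V (s - 1) (parity_op V x))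
    = opK V (pivot V (s - 1) (parity_op V (opE V (opKi V x)))).
    rewrite -!comp_lfunE; apply: lfun_eq; apply: (lfun_hwt mV) => l p v hv.
    have hE := hwt_E mV hv.
    rewrite !comp_lfunE (hwt_Ki mV hv) !homZ (parity_hwt mV hv) (parity_hwt mV hE).
    rewrite !homZ (pivot_hwt mV _ hv) (pivot_hwt mV _ hE) !homZ (hwt_K mV hE) !scalerA.
    congr (_ *: _); rewrite signrN qexp_pivN qexpD qexp2.
    have := qexp_neq0 r l; have := q_neq0 (R := R) r; move: (qp l) (qp _) q.
    by move=> x1 y z z0 x0; have [->|->] := sign_cases C p; field; rewrite x0 z0.
  under eq_bigr => i _ do rewrite (tensE_op mD) dualE_op pureNl PD -!comp_lfunE.
  rewrite big_split /= sumrN !coev_transposer -sumrB big1 // => i _.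
  by rewrite !comp_lfunE Ep subrr.
have Fp x : opF V (pivot V (s - 1) (parity_op V (opK V x)))
    = pivot V (s - 1) (parity_op V (opK V (opF V x))).
  rewrite -!comp_lfunE; apply: lfun_eq; apply: (lfun_hwt mV) => l p v hv.
  have hF := hwt_F mV hv.
  rewrite !comp_lfunE (hwt_K mV hv) (hwt_K mV hF) !homZ (parity_hwt mV hv) (parity_hwt mV hF).
  rewrite !homZ (pivot_hwt mV _ hv) (pivot_hwt mV _ hF) !homZ !scalerA.
  congr (_ *: _); rewrite signrN.
  have := qexp_pivN (l - 2); rewrite subrK => ->; rewrite qexpB qexp2.
  have := qexp_neq0 r l; have := q_neq0 (R := R) r; move: (qp l) (qp _) q.
  by move=> x1 y z z0 x0; have [->|->] := sign_cases C p; field; rewrite z0.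
under eq_bigr => i _.
  rewrite (tensF_op mD) dualF_op KiD pureNl PD -!comp_lfunE -(comp_lfunA (dcoord i)).
  over.
rewrite big_split /= sumrN !coev_transposer -sumrB big1 // => i _.
by rewrite !comp_lfunE Fp subrr.
Qed.

Lemma weight_rigid : rigid (weight_category R r r0 s).
Proof.
split.
- by move=> A mA; exact: (weight_module_dual mA).
- by move=> A mA; exact: weight_mor_evl.
- by move=> A mA; exact: weight_mor_coevl.
- by move=> A mA; exact: weight_mor_evr.
- by move=> A mA; exact: weight_mor_coevr.
- move=> A mA; apply/lfunP => v; rewrite /= !comp_lfunE id_lfunE wluiE tmap_pure wcoevlE.
  rewrite scale1r id_lfunE pure_suml !hom_sum [RHS]vbasis_dcoord; apply: eq_bigr => i _.
  by rewrite wasc_pure tmap_pure wru_pure id_lfunE wevl_pure.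
- move=> A mA; apply/lfunP => f; rewrite /= !comp_lfunE id_lfunE wruiE tmap_pure wcoevlE.
  rewrite scale1r id_lfunE pure_sumr !hom_sum [RHS]functional_dcoord; apply: eq_bigr => i _.
  by rewrite wasci_pure tmap_pure wlu_pure id_lfunE wevl_pure.
- move=> A mA; apply/lfunP => v; rewrite /= !comp_lfunE id_lfunE wruiE tmap_pure wcoevrE.
  rewrite scale1r id_lfunE pure_sumr !hom_sum.
  have e : pivot A (s - 1) (pivot A (1 - s) v) = v.
    by rewrite -comp_lfunE (pivotK mA) ?id_lfunE // addrA subrK subrr.
  rewrite -[RHS]e [pivot A (1 - s) v]vbasis_dcoord hom_sum; apply: eq_bigr => i _.
  by rewrite wasci_pure tmap_pure wlu_pure id_lfunE (wevr_pure _ _ mA) homZ.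
move=> A mA; apply/lfunP => f; rewrite /= !comp_lfunE id_lfunE wluiE tmap_pure wcoevrE.
rewrite scale1r id_lfunE pure_suml !hom_sum [RHS]functional_dcoord; apply: eq_bigr => i _.
rewrite wasc_pure tmap_pure wru_pure id_lfunE (wevr_pure _ _ mA).
by rewrite -(comp_lfunE (pivot A (1 - s))) (pivotK mA) ?id_lfunE // addrA subrK subrr.
Qed.

End Rigidity.

Arguments pivot {R} V n.

(** * The braiding *)

Section Braiding.
Context {R : realType}.
Local Notation C := R[i].
Variables (r r0 : nat).
Local Notation qp := (@qexp R r).
Local Notation q := (qp 1).
Local Notation wmod := (@weight_module R r r0).
Hypotheses (r3 : (3 <= r)%N) (r8 : (r %% 8 != 4)%N) (hr0 : least_zero_qbr R r r0).
Local Notation mtens := (weight_module_tens r3 r8 hr0).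

(** The coefficient of [F^n w (x) E^n v] in the braiding of [v (x) w], for weights [l], [m] and
    parities [p], [p']. The shifted weights [l + 2 n] and [m - 2 n] give [q^(l m / 2 + n (m - l))]
    and a power absorbed by [gcoef]; the signs of [Rtilde], of the Koszul rule and of the flip
    combine to [(-1)^(p p' + n p')]. *)
Definition brc (l : C) (p : bool) (m : C) (p' : bool) (n : nat) : C :=
  locked ((-1) ^+ (p && p') * qp (l * m / 2) * (gcoef r n * ((-1) ^+ p' * qp (m - l)) ^+ n)).

Lemma brcE l p m p' n : brc l p m p' n =
  (-1) ^+ (p && p') * qp (l * m / 2) * (gcoef r n * ((-1) ^+ p' * qp (m - l)) ^+ n).
Proof. by rewrite /brc -lock. Qed.

Lemma halfD (x y : C) : (x + 2 * y) / 2 = x / 2 + y.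
Proof. by rewrite mulrDl [2 * y]mulrC mulfK // pnatr_eq0. Qed.

Lemma super_flip_hwt (V W : @opspace R) (mV : wmod V) (mW : wmod W) l p v m p' w :
    hwt l p v -> hwt m p' w ->
  super_flip V W (pure v w) = (-1) ^+ (p && p') *: pure w v.
Proof.
move=> hv hw; rewrite /super_flip koszulE; first last.
- by move=> x a y z; rewrite pure_linl.
- by move=> x a y z; rewrite pure_linr.
rewrite /koszul !big_bool /= !(hwt_gr mV _ hv) !(hwt_gr mW _ hw).
by case: p p' hv hw => -[] /= _ _; rewrite !(pure0l, pure0r, scaler0, addr0, add0r).
Qed.

Lemma Rtilde_hwt (V W : @opspace R) (mV : wmod V) l p v w : hwt l p v ->
  Rtilde r r0 V W (pure v w) = \sum_(n < r0)
    ((-1) ^+ n * (q ^+ (2 * (n * n)) * gcoef r n) * (-1) ^+ (odd n && p))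
      *: pure (lfun_exp (opE V) n v) (lfun_exp (opF W) n w).
Proof.
move=> hv; rewrite /Rtilde sum_lfunE; apply: eq_bigr => n _.
by rewrite scale_lfunE (super_tmap_hwt mV _ _ _ _ hv) scalerA (Rcoef_gcoef r3 r8).
Qed.

Lemma upsilonE (V W : @opspace R) : upsilon r V W = weight_scaling (fun l m => qpow r (l * m / 2)) V W.
Proof. by []. Qed.

Lemma braiding_hwt (V W : @opspace R) (mV : wmod V) (mW : wmod W) l p v m p' w :
    hwt l p v -> hwt m p' w ->
  wbraiding r r0 V W (pure v w)
  = \sum_(n < r0) brc l p m p' n *: pure (lfun_exp (opF W) n w) (lfun_exp (opE V) n v).
Proof.
move=> hv hw; rewrite /wbraiding !comp_lfunE (Rtilde_hwt mV _ hv) !hom_sum.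
apply: eq_bigr => n _; rewrite !homZ upsilonE.
have hE := hwt_En mV n hv; have hF := hwt_Fn mW n hw.
rewrite (weight_scalingE _ mV mW hE.2 hF.2) homZ (super_flip_hwt mV mW hE hF) !scalerA.
congr (_ *: _); rewrite brcE -qexpE.
have -> : (l + 2 * n%:R) * (m - 2 * n%:R) / 2 = l * m / 2 + (m - l) *+ n - (2 * (n * n))%:R :> C.
  have t0 : 2 != 0 :> C by rewrite pnatr_eq0.
  by rewrite -mulr_natl !natrM; field.
have -> : qp (l * m / 2 + (m - l) *+ n - (2 * (n * n))%:R)
    = qp (l * m / 2) * qp (m - l) ^+ n / q ^+ (2 * (n * n)).
  by rewrite qexpB qexp_nat; congr (_ / _); rewrite (qexpD _ (l * m / 2)) qexpMn.
rewrite exprMn.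
have q0 : q ^+ (2 * (n * n)) != 0 by rewrite expf_neq0 // q_neq0.
move: (q ^+ _) q0 (qp (l * m / 2)) (qp (m - l) ^+ n) (gcoef _ _) => x x0 y z t.
rewrite -[(-1) ^+ n]signr_odd -[((-1) ^+ p') ^+ n]exprM -[(-1) ^+ (_ * _)%N]signr_odd oddM.
by case: p p' (odd n) {hv hw hE hF} => -[] [] /=; rewrite ?expr0 ?expr1; field.
Qed.

Lemma hwt_sum (V : @opspace R) l p I (S : seq I) (P : pred I) (F : I -> V) :
  (forall i, P i -> hwt l p (F i)) -> hwt l p (\sum_(i <- S | P i) F i).
Proof.
move=> hF; elim/big_rec: _ => [|i x Pi hx]; first exact: hwt0.
by apply: hwtD => //; exact: hF.
Qed.

Lemma EFn (V : @opspace R) (mV : wmod V) l p n (v : V) : hwt l p v ->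
  opE V (lfun_exp (opF V) n v)
  = (-1) ^+ n *: lfun_exp (opF V) n (opE V v)
    + kap r n (qp l) *: lfun_exp (opF V) n.-1 v.
Proof.
case: n => [|n] hv; last exact: (EFn_hwt r3 r8 mV n hv).
by rewrite !lfun_exp0 kap0 scale0r addr0 scale1r.
Qed.

Lemma FEn (V : @opspace R) (mV : wmod V) l p n (v : V) : hwt l p v ->
  opF V (lfun_exp (opE V) n v)
  = (-1) ^+ n *: lfun_exp (opE V) n (opF V v)
    - kap r n (qp l)^-1 *: lfun_exp (opE V) n.-1 v.
Proof.
case: n => [|n] hv; last exact: (FEn_hwt r3 r8 mV n hv).
by rewrite !lfun_exp0 kap0 scale0r subr0 scale1r.
Qed.

(** The factor [1 - om^(n+1)] in [kap] cancels the last one in the denominator of [gcoef]. So the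
    remainder of a commutation at index [n + 1] can be compared with terms of index [n]. *)
Lemma gcoef_kap n Y : (n.+1 < r0)%N ->
  gcoef r n.+1 * kap r n.+1 Y
  = gcoef r n * q ^- (2 * n).+1 * (q ^- (2 * n).+1 * Y - (-1) ^+ n * q^-1 / Y).
Proof.
move=> nr; have b0 : 1 - om r ^+ n.+1 != 0 :> C by rewrite subr_eq0 eq_sym (om_n hr0).
apply: (mulIf b0); rewrite mulrAC (gcoefS r3 r8 hr0 nr).
suff -> : kap r n.+1 Y
    = (q ^- (2 * n).+1 * Y - (-1) ^+ n * q^-1 / Y) * (1 - om r ^+ n.+1) / rho r.
  have := rho_neq0 r3 r8 (R := R); move: (rho r) (q ^- _) (1 - _) (q^-1) Y^-1 => x y z t Z x0.
  by field.
rewrite /kap -lock omX; congr (_ / _).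
have q0 := q_neq0 (R := R) r; rewrite mulnS [(-1) ^+ n.+1]exprS !exprS.
move: q q0 => x x0; have : x ^+ (2 * n) != 0 by rewrite expf_neq0.
rewrite -signr_odd.
by move: (x ^+ _) (odd n) Y^-1 => y [] Z y0; rewrite ?expr0 ?expr1; field; rewrite x0 y0.
Qed.

Lemma signr_andN p p' : (-1) ^+ (p && ~~ p') = (-1) ^+ p * (-1) ^+ (p && p') :> C.
Proof. by case: p p' => -[] /=; ring. Qed.

Lemma signr_Nand p p' : (-1) ^+ (~~ p && p') = (-1) ^+ p' * (-1) ^+ (p && p') :> C.
Proof. by case: p p' => -[] /=; ring. Qed.

Lemma brc_shift_r l p m p' n :
  brc l p (m + 2) (~~ p') n = (-1) ^+ p * (-1) ^+ n * q ^+ (2 * n) * qp l * brc l p m p' n.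
Proof.
rewrite !brcE signr_andN signrN.
have -> : l * (m + 2) / 2 = l * m / 2 + l :> C.
  by rewrite -(halfD (l * m) l); congr (_ / _); ring.
have -> : - (-1) ^+ p' * qp (m + 2 - l) = -1 * q ^+ 2 * ((-1) ^+ p' * qp (m - l)).
  rewrite addrAC (qexpD _ (m - l)) qexp2; ring.
rewrite (qexpD _ (l * m / 2)) ![(_ * q ^+ 2 * _) ^+ n]exprMn [q ^+ (2 * n)]exprM.
by rewrite [(_ * q ^+ 2) ^+ n]exprMn; ring.
Qed.

Lemma brc_shift_l l p m p' n :
  brc (l + 2) (~~ p) m p' n = (-1) ^+ p' * qp m * q ^- (2 * n) * brc l p m p' n.
Proof.
rewrite !brcE signr_Nand.
have -> : (l + 2) * m / 2 = l * m / 2 + m :> C.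
  by rewrite -(halfD (l * m) m); congr (_ / _); ring.
have -> : (-1) ^+ p' * qp (m - (l + 2)) = q ^- 2 * ((-1) ^+ p' * qp (m - l)).
  rewrite opprD addrA (qexpB _ (m - l)) qexp2; ring.
rewrite (qexpD _ (l * m / 2)) [(q ^- 2 * _) ^+ n]exprMn exprVn -exprM.
ring.
Qed.

Lemma brcS l p m p' n Y : (n.+1 < r0)%N ->
  brc l p m p' n.+1 * kap r n.+1 Y
  = brc l p m p' n * ((-1) ^+ p' * qp m / qp l)
    * (q ^- (2 * n).+1 * (q ^- (2 * n).+1 * Y - (-1) ^+ n * q^-1 / Y)).
Proof.
move=> nr; rewrite !brcE [in LHS]exprS.
transitivity ((-1) ^+ (p && p') * qp (l * m / 2) * ((-1) ^+ p' * qp (m - l)) *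
  ((-1) ^+ p' * qp (m - l)) ^+ n * (gcoef r n.+1 * kap r n.+1 Y)).
  by ring.
rewrite (gcoef_kap _ nr) {1}qexpB.
by ring.
Qed.

Lemma weight_mor_braiding (V W : @opspace R) (mV : wmod V) (mW : wmod W) :
  @weight_mor R (wtens V W) (wtens W V) (wbraiding r r0 V W).
Proof.
apply: (weight_morI (mtens mV mW) (mtens mW mV)
  (generating_pure (generating_hwt mV) (generating_hwt mW))).
move=> _ [v [w [[l [p hv]] [m [p' hw]] ->]]]; exists (l + m), (p (+) p').
have rP := r0_gt0 hr0.
have E0 x : lfun_exp (opE V) r0 x = 0 by rewrite (rel_E0 mV) zero_lfunE.
have F0 x : lfun_exp (opF W) r0 x = 0 by rewrite (rel_F0 mW) zero_lfunE.
have q0 := q_neq0 (R := R) r.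
split; first exact: (hwt_tens mV mW).
- rewrite (braiding_hwt mV mW hv hw); apply: hwt_sum => n _; apply: hwtZ.
  have := hwt_tens mW mV (hwt_Fn mW n hw) (hwt_En mV n hv).
  have -> : m - 2 * n%:R + (l + 2 * n%:R) = l + m by ring.
  by case: p p' (odd n) {hv hw} => -[] [].
- rewrite (tensE mV _ hv) (hwt_K mW hw) pureZr homD !homZ.
  rewrite (braiding_hwt mV mW hv (hwt_E mW hw)) (braiding_hwt mV mW (hwt_E mV hv) hw).
  rewrite (braiding_hwt mV mW hv hw) hom_sum.
  under [in RHS]eq_bigr => n _.
    rewrite homZ (tensE mW _ (hwt_Fn mW n hw)) (EFn mW n hw) (hwt_K mV (hwt_En mV n hv)).
    rewrite pureDl !pureZl !pureZr -!lfun_expS !scalerDr !scalerA addrCA.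
    over.
  (* The terms in [F^n E w (x) E^n v] match one by one. The others are compared at
     [F^n w (x) E^(n+1) v], after shifting the index of the [kap] terms. *)
  rewrite !big_split /= !scaler_sumr; congr (_ + _).
    apply: eq_bigr => n _; rewrite scalerA; congr (_ *: _).
    rewrite brc_shift_r qexpD qexp2n.
    have e : (-1) ^+ p * (-1) ^+ p = 1 :> C by rewrite -expr2 sqrr_sign.
    by rewrite !mulrA e mul1r; ring.
  have [N eN] : exists N, r0 = N.+1 by exists r0.-1; rewrite prednK.
  move: E0 F0; rewrite eN => E0 F0.
  (* The truncation leaves no boundary terms: the last terms contain [E^r0] and the first [kap] term
     is zero. *)
  rewrite big_ord_recr [X in _ = X + _]big_ord_recr [X in _ = _ + X]big_ord_recl /=.
  rewrite -lfun_expSr E0 pure0r !scaler0 !addr0 kap0 mul0r mulr0 scale0r add0r -big_split /=.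
  apply: eq_bigr => n _; rewrite /bump /= add1n -scalerDl scalerA -lfun_expSr.
  congr (_ *: _).
  have nr : (n.+1 < r0)%N by rewrite eN ltnS ltn_ord.
  rewrite brc_shift_l qexpD qexp2n.
  transitivity (brc l p m p' n * ((-1) ^+ p' * (-1) ^+ n) +
    brc l p m p' n.+1 * kap r n.+1 (qp m) * (qp l * q ^+ (2 * n.+1))); last first.
    by rewrite signr_addb signr_odd; ring.
  rewrite (brcS _ _ _ _ _ nr) (mulnS 2 n) exprD (exprS _ (2 * n)).
  have := qexp_neq0 r l; have := qexp_neq0 r m; have := q0.
  have : q ^+ (2 * n) != 0 by rewrite expf_neq0.
  move: (brc _ _ _ _ _) ((-1) ^+ p') ((-1) ^+ n) (qp l) (qp m) (q ^+ (2 * n)) q.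
  by move=> b x y a a' z t z0 t0 a'0 a0; field; rewrite a0 a'0 z0 t0.
rewrite (tensF mV _ hv) homD !homZ.
rewrite (braiding_hwt mV mW hv (hwt_F mW hw)) (braiding_hwt mV mW (hwt_F mV hv) hw).
rewrite (braiding_hwt mV mW hv hw) hom_sum.
under [in RHS]eq_bigr => n _.
  rewrite homZ (tensF mW _ (hwt_Fn mW n hw)) (FEn mV n hv).
  rewrite pureDr pureNr !pureZr -!lfun_expS !scalerDr !scalerN !scalerA -addrA.
  over.
rewrite !big_split /= !scaler_sumr [LHS]addrC; congr (_ + _).
  apply: eq_bigr => n _; congr (_ *: _).
  have := brc_shift_l (l - 2) (~~ p) m p' n; rewrite negbK subrK => ->.
  rewrite signr_addb signr_odd qexpB qexp2n.
  have := qexp_neq0 r m; have : q ^+ (2 * n) != 0 by rewrite expf_neq0.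
  move: (brc _ _ _ _ _) (qp m) (q ^+ (2 * n)) => b x y y0 x0.
  rewrite -[(-1) ^+ n]signr_odd.
  by case: p' (odd n) {hw} => -[] /=; rewrite ?expr0 ?expr1; field; rewrite x0 y0.
have [N eN] : exists N, r0 = N.+1 by exists r0.-1; rewrite prednK.
move: E0 F0; rewrite eN => E0 F0.
rewrite big_ord_recr [X in _ = X + _]big_ord_recl [X in _ = _ + X]big_ord_recr /=.
rewrite -lfun_expSr !F0 !pure0l !scaler0 !addr0 kap0 mulr0 scale0r oppr0 add0r -big_split /=.
apply: eq_bigr => n _; rewrite /bump /= add1n -scaleNr -scalerDl scalerA -lfun_expSr.
congr (_ *: _).
have nr : (n.+1 < r0)%N by rewrite eN ltnS ltn_ord.
have := brc_shift_r l p (m - 2) (~~ p') n; rewrite negbK subrK => sh.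
transitivity (brc l p m p' n -
  brc l p m p' n.+1 * kap r n.+1 (qp l)^-1
    * (- ((-1) ^+ p' * (-1) ^+ n) * q ^+ (2 * n.+1) / qp m)); last first.
  rewrite add0n signr_addb signrN signr_odd qexpB qexp2n invf_div; ring.
rewrite (brcS _ _ _ _ _ nr) sh (mulnS 2 n) exprD (exprS _ (2 * n)).
have := qexp_neq0 r l; have := qexp_neq0 r m; have := q0.
have : q ^+ (2 * n) != 0 by rewrite expf_neq0.
move: (brc _ _ _ _ _) (qp l) (qp m) (q ^+ (2 * n)) q.
rewrite -[(-1) ^+ n]signr_odd.
move=> b a a' z t z0 t0 a'0 a0.
by case: p p' (odd n) {hv hw sh} => -[] [] /=; rewrite ?expr0 ?expr1; field; rewrite a0 a'0 z0 t0.
Qed.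

End Braiding.

(** Collects a double sum by total degree. In the hexagons the terms outside the triangle vanish by
    nilpotency. *)
Lemma triangular_sum (U : nmodType) (N : nat) (f : nat -> nat -> U) :
    (forall i j, (N <= i + j)%N -> f i j = 0) ->
  \sum_(i < N) \sum_(j < N) f i j = \sum_(k < N) \sum_(i < k.+1) f i (k - i)%N.
Proof.
move=> f0.
transitivity (\sum_(i < N) \sum_(k < N | (i <= k)%N) f i (k - i)%N).
  apply: eq_bigr => i _; have iN := ltnW (ltn_ord i).
  rewrite -(big_mkord predT (f i)) (big_cat_nat _ (n := (N - i)%N)) ?leq_subr //=.
  rewrite [X in _ + X]big_nat_cond [X in _ + X]big1 ?addr0; last first.
    by move=> j /andP[/andP[h _] _]; apply: f0; rewrite -leq_subLR.
  rewrite -(big_mkord (leq i) (fun k => f i (k - i)%N)).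
  rewrite [RHS](big_cat_nat _ (n := i)) //= [X in _ = X + _]big_nat_cond.
  rewrite [X in _ = X + _]big1 ?add0r; last first.
    by move=> j /andP[/andP[_ h]]; rewrite leqNgt h.
  have := @big_addn _ 0 +%R 0 N i (leq i) (fun k => f i (k - i)%N); rewrite add0n => ->.
  by apply: eq_big => [j|j _]; rewrite ?addnK // leq_addl.
rewrite (exchange_big_dep predT) //=; apply: eq_bigr => k _.
by rewrite (big_ord_widen N (fun i => f i (k - i)%N)) ?ltn_ord.
Qed.

(** * Naturality, invertibility and the hexagons *)

Section BraidedCategory.
Context {R : realType}.
Local Notation C := R[i].
Variables (r r0 : nat).
Local Notation qp := (@qexp R r).
Local Notation q := (qp 1).
Local Notation wmod := (@weight_module R r r0).
Hypotheses (r3 : (3 <= r)%N) (r8 : (r %% 8 != 4)%N) (hr0 : least_zero_qbr R r r0).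
Local Notation mtens := (weight_module_tens r3 r8 hr0).
Local Notation braiding := (wbraiding r r0).

Lemma braiding_nat (V V' W W' : @opspace R) (f : 'Hom(V, V')) (g : 'Hom(W, W')) :
    wmod V -> wmod V' -> wmod W -> wmod W' -> weight_mor f -> weight_mor g ->
  (braiding V' W' \o tmap f g = tmap g f \o braiding V W)%VF.
Proof.
move=> mV mV' mW mW' mf mg; apply: (hwt_tens_ext mV mW) => l p v m p' w hv hw.
rewrite [LHS]comp_lfunE [RHS]comp_lfunE tmap_pure (braiding_hwt r3 r8 mV mW hv hw).
rewrite (braiding_hwt r3 r8 mV' mW' (mor_hwt mf hv) (mor_hwt mg hw)) hom_sum.
by apply: eq_bigr => n _; rewrite homZ tmap_pure (morEn mf) (morFn mg).
Qed.

Lemma super_flipK (V W : @opspace R) : wmod V -> wmod W ->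
  (super_flip W V \o super_flip V W = \1)%VF.
Proof.
move=> mV mW; apply: (hwt_tens_ext mV mW) => l p v m p' w hv hw.
rewrite comp_lfunE id_lfunE (super_flip_hwt mV mW hv hw) homZ (super_flip_hwt mW mV hw hv).
by rewrite scalerA [p' && p]andbC -expr2 sqrr_sign scale1r.
Qed.

Lemma weight_scalingK (h : C -> C -> C) (V W : @opspace R) : wmod V -> wmod W ->
  (forall l m, h l m != 0) ->
  (weight_scaling (fun l m => (h l m)^-1%R) V W \o weight_scaling h V W = \1)%VF.
Proof.
move=> mV mW h0; apply: (hwt_tens_ext mV mW) => l p v m p' w [_ hv] [_ hw].
rewrite comp_lfunE id_lfunE (weight_scalingE _ mV mW hv hw) homZ.
by rewrite (weight_scalingE _ mV mW hv hw) scalerA mulfV ?scale1r.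
Qed.

(* Multiplying [Rtilde] by [E^k (x) 1] kills the summands that are not divisible
   by [E^(k+1) (x) 1], except for the leading one; since [E] is nilpotent, this
   gives [(E^k (x) 1) x = 0] for all [k] in the kernel, by descending induction. *)
Lemma Rtilde_inj (V W : @opspace R) : wmod V -> wmod W -> lker (Rtilde r r0 V W) == 0%VS.
Proof.
(* The powers of the parity operator carry the sign [(-1)^(n p)], so that each summand factors
   through [y (k + n)]. *)
move=> mV mW; pose P n : 'End(V) := lfun_exp (parity_op V) n.
pose y k : 'End(tens V W) := tmap (lfun_exp (opE V) k) \1%VF.
pose S k n : 'End(tens V W) :=
  ((-1) ^+ n * (q ^+ (2 * (n * n)) * gcoef r n) * (-1) ^+ (n * (k + n))) *:
    tmap (P n) (lfun_exp (opF W) n).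
have step k : (y k \o Rtilde r r0 V W = \sum_(n < r0) (S k n \o y (k + n)%N))%VF.
  apply: (hwt_tens_ext mV mW) => l p v m p' w hv hw.
  rewrite comp_lfunE (Rtilde_hwt r3 r8 mV w hv) hom_sum sum_lfunE; apply: eq_bigr => n _.
  rewrite homZ comp_lfunE scale_lfunE !tmap_pure !id_lfunE -lfun_expD.
  have Pn j u c : @hwt R V c j u -> P n u = (-1) ^+ (n * j) *: u.
    move=> hu; rewrite /P; elim: (nat_of_ord n) => [|N IH].
      by rewrite lfun_exp0 mul0n scale1r.
    by rewrite lfun_expS IH homZ (parity_hwt mV hu) scalerA mulSn exprD mulrC.
  rewrite (Pn _ _ _ (hwt_En mV _ hv)) pureZl scalerA; congr (_ *: _).
  rewrite -[RHS]mulrA; congr (_ * _); rewrite -exprD -mulnDr.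
  rewrite -[RHS]signr_odd oddM oddD oddb.
  rewrite [odd (k + n)]oddD.
  by case: (odd n) (odd k) p {hv} => -[] [].
apply/lker0P => x1 x2 e12; apply/eqP; rewrite -subr_eq0; set x := x1 - x2.
have Rx : Rtilde r r0 V W x = 0 by rewrite /x homB e12 subrr.
have yx d : forall k, (r0 <= k + d)%N -> y k x = 0.
  elim: d => [|d IH] k kd.
    suff -> : y k = 0 by rewrite zero_lfunE.
    apply: tens_ext => v w; rewrite tmap_pure zero_lfunE.
    by rewrite (lfun_exp_ge0 v (rel_E0 mV)) ?pure0l // -[k]addn0.
  have := lfun_eq (step k) x; rewrite comp_lfunE Rx hom0 sum_lfunE.
  have rP := r0_gt0 hr0; have [N eN] : exists N, r0 = N.+1 by exists r0.-1; rewrite prednK.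
  rewrite eN big_ord_recl big1 ?addr0.
    rewrite comp_lfunE addn0 => /esym.
    have S0 : S k 0%N = \1%VF :> 'End(tens V W).
      apply: tens_ext => v w; rewrite scale_lfunE tmap_pure /P.
      rewrite (lfun_exp0 (parity_op V)) (lfun_exp0 (opF W)) id_lfunE.
      by rewrite /gcoef -lock !muln0 oppr0 qexp0 qpoch0 !expr0 divr1 !mulr1 scale1r.
    by rewrite S0 id_lfunE.
  move=> n _; rewrite comp_lfunE IH ?hom0 //.
  by apply: leq_trans kd _; rewrite lift0 !addnS !addSn ltnS addnAC leq_addr.
have y0 : y 0%N x = 0 by apply: (yx r0); rewrite add0n.
apply/eqP; rewrite -y0 -[LHS](id_lfunE x) -(tmap_id V W).
by congr (tmap _ _ _); apply/lfunP => v; rewrite lfun_exp0 id_lfunE.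
Qed.

Lemma braiding_iso (V W : @opspace R) : wmod V -> wmod W ->
  exists g : 'Hom(tens W V, tens V W),
    (g \o braiding V W = \1)%VF /\ (braiding V W \o g = \1)%VF.
Proof.
move=> mV mW; have R0 := Rtilde_inj mV mW.
have h0 (l m : C) : qpow r (l * m / 2) != 0 by rewrite -qexpE qexp_neq0.
have U1 := weight_scalingK mV mW h0.
have U0 : lker (upsilon r V W) == 0%VS.
  apply/lker0P => x y xy; rewrite -[x]id_lfunE -[y]id_lfunE -U1 !comp_lfunE.
  by rewrite -!upsilonE xy.
have inv (f : 'End(tens V W)) : lker f == 0%VS ->
    exists f', (f' \o f = \1)%VF /\ (f \o f' = \1)%VF.
  by move=> f0; exists f^-1%VF; rewrite lker0_compVf ?lker0_compfV.
have [R' [R'K RK]] := inv _ R0; have [U' [U'K UK]] := inv _ U0.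
rewrite /wbraiding; move: (super_flipK mV mW) (super_flipK mW mV) R'K RK U'K UK.
move: (super_flip V W) (super_flip W V) (Rtilde r r0 V W) (upsilon r V W).
move=> f g R1 U1' fK gK R'K RK U'K UK; exists (R' \o U' \o g)%VF; split; rewrite -!comp_lfunA.
  by rewrite (comp_lfunA g) fK comp_lfun1l (comp_lfunA U') U'K comp_lfun1l.
by rewrite (comp_lfunA R1) RK comp_lfun1l (comp_lfunA U1') UK comp_lfun1l.
Qed.

Lemma signr_addb_and (p p1 p2 : bool) :
  (-1) ^+ (p && (p1 (+) p2)) = (-1) ^+ (p && p1) * (-1) ^+ (p && p2) :> C.
Proof. by case: p p1 p2 => -[] [] /=; ring. Qed.

Lemma signr_and_odd (p : bool) n : (-1) ^+ (p && odd n) = ((-1) ^+ p) ^+ n :> C.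
Proof. by case: p => /=; rewrite ?expr1 ?signr_odd // expr0 expr1n. Qed.

(** Compares coefficients in the first hexagon: on the left [F^(i+j)] is expanded on a tensor
    product, on the right the second crossing meets the weight and parity of [E^i a]. *)
Lemma brc_hexagon (l : C) p (m : C) p1 (n : C) p2 i j : (i + j < r0)%N ->
  brc r l p (m + n) (p1 (+) p2) (i + j) * (gauss (om r) (i + j) i * ((-1) ^+ p1 / qp m) ^+ j)
  = brc r l p m p1 i * brc r (l + 2 * i%:R) (p (+) odd i) n p2 j.
Proof.
move=> ij; rewrite !brcE.
rewrite signr_addb_and [(p (+) odd i) && p2]andbC signr_addb_and signr_and_odd [p2 && p]andbC.
have -> : qp (l * (m + n) / 2) = qp (l * m / 2) * qp (l * n / 2).
  by rewrite -qexpD; congr qexp; rewrite mulrDr mulrDl.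
have -> : qp ((l + 2 * i%:R) * n / 2) = qp (l * n / 2) * qp n ^+ i.
  rewrite -qexpMn -qexpD -halfD; congr qexp; congr (_ / _).
  by rewrite -mulr_natl; ring.
have -> : (-1) ^+ p2 * qp (n - (l + 2 * i%:R)) = (-1) ^+ p2 * qp (n - l) * q ^- (2 * i).
  by rewrite opprD addrA (qexpB _ (n - l)) qexp2n mulrA.
rewrite signr_addb (exprD _ i j) [in LHS]qexpB.
have := gcoefD hr0 ij; move: (gauss _ _ _) (gcoef r (i + j)) => G g e.
transitivity ((-1) ^+ (p && p1) * (-1) ^+ (p && p2) * (qp (l * m / 2) * qp (l * n / 2)) *
  (g * G * ((-1) ^+ p1 * (-1) ^+ p2 * (qp (m + n) / qp l)) ^+ i *
   (((-1) ^+ p1 * (-1) ^+ p2 * (qp (m + n) / qp l)) * ((-1) ^+ p1 / qp m)) ^+ j)).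
  by rewrite [(_ * (_ / qp m)) ^+ j]exprMn; ring.
rewrite e.
have -> : (-1) ^+ p1 * (-1) ^+ p2 * (qp (m + n) / qp l) * ((-1) ^+ p1 / qp m)
   = (-1) ^+ p2 * qp (n - l).
  rewrite qexpD qexpB; have := qexp_neq0 r l; have := qexp_neq0 r m.
  move: (qp l) (qp m) => x y y0 x0.
  by have [->|->] := sign_cases C p1; field; rewrite x0 y0.
have -> : (-1) ^+ p1 * (-1) ^+ p2 * (qp (m + n) / qp l)
   = ((-1) ^+ p1 * qp (m - l)) * ((-1) ^+ p2 * qp n).
  by rewrite (qexpD _ m n) (qexpB _ m l); ring.
rewrite [((-1) ^+ p1 * qp (m - l) * _) ^+ i]exprMn [((-1) ^+ p2 * qp n) ^+ i]exprMn.
rewrite [(_ / q ^+ (2 * i)) ^+ j]exprMn exprVn mulnA [q ^+ (2 * i * j)]exprM.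
by ring.
Qed.

(** The counterpart for the coproduct of [E]; the second crossing now meets the weight and parity of
    [F^j d]. *)
Lemma brc_hexagon_inv (l : C) p (m : C) p1 (n : C) p2 i j : (j + i < r0)%N ->
  brc r (l + m) (p (+) p1) n p2 (j + i)
    * (gauss (om r) (j + i) j * qp m ^+ i * (-1) ^+ ((p + i) * j)%N)
  = brc r m p1 n p2 j * brc r l p (n - 2 * j%:R) (p2 (+) odd j) i.
Proof.
move=> ij; rewrite !brcE.
rewrite signr_addb_and [(p (+) p1) && p2]andbC signr_addb_and signr_and_odd ![p2 && _]andbC.
have -> : qp ((l + m) * n / 2) = qp (l * n / 2) * qp (m * n / 2).
  by rewrite -qexpD; congr qexp; rewrite mulrDl mulrDl.
have -> : qp (l * (n - 2 * j%:R) / 2) = qp (l * n / 2) / qp l ^+ j.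
  rewrite -qexpMn -qexpN -qexpD -halfD; congr qexp; congr (_ / _).
  by rewrite -mulr_natl; ring.
have -> : (-1) ^+ (p2 (+) odd j) * qp (n - 2 * j%:R - l)
    = (-1) ^+ j * q ^- (2 * j) * ((-1) ^+ p2 * qp (n - l)).
  by rewrite signr_addb signr_odd addrAC (qexpB _ (n - l)) qexp2n; ring.
have -> : (-1) ^+ p2 * qp (n - (l + m)) = ((-1) ^+ p2 * qp (n - m)) / qp l.
  by rewrite opprD addrA addrAC (qexpB _ (n - m)) mulrA.
rewrite (exprD _ j i).
have := gcoefD hr0 ij; move: (gauss _ _ _) (gcoef r (j + i)) => G g e.
have -> : (-1) ^+ ((p + i) * j)%N = ((-1) ^+ p) ^+ j * ((-1) ^+ j) ^+ i :> C.
  by rewrite mulnDl exprD !exprM [((-1) ^+ i) ^+ j]exprAC.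
transitivity ((-1) ^+ (p && p2) * (-1) ^+ (p1 && p2) * (qp (l * n / 2) * qp (m * n / 2)) *
  (g * G * ((-1) ^+ p2 * qp (n - m) / qp l) ^+ j *
   ((-1) ^+ p2 * qp (n - m) / qp l * qp m) ^+ i * (((-1) ^+ p) ^+ j * ((-1) ^+ j) ^+ i))).
  by rewrite [(_ * qp m) ^+ i]exprMn; ring.
rewrite e.
have -> : (-1) ^+ p2 * qp (n - m) / qp l * qp m = (-1) ^+ p2 * qp (n - l).
  rewrite !qexpB; have := qexp_neq0 r l; have := qexp_neq0 r m.
  by move: (qp l) (qp m) => x y y0 x0; field; rewrite x0 y0.
rewrite [((-1) ^+ p2 * qp (n - m) / qp l) ^+ j]exprMn exprVn.
rewrite [((-1) ^+ j * q ^- (2 * j) * _) ^+ i]exprMn [((-1) ^+ j * q ^- (2 * j)) ^+ i]exprMn.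
rewrite exprVn mulnA [q ^+ (2 * j * i)]exprM.
by ring.
Qed.

Section Hexagons.
Context {A B D : @opspace R} (mA : wmod A) (mB : wmod B) (mD : wmod D).

Lemma braiding_hexagon :
  (wasc B D A \o braiding A (wtens B D) \o wasc A B D
   = tmap \1 (braiding A D) \o wasc B A D \o tmap (braiding A B) \1)%VF.
Proof.
apply: (generating_pure (generating_pure (generating_hwt mA) (generating_hwt mB))
  (generating_hwt mD)).
move=> _ [_ [d [[a [b [[l [p ha]] [m [p1 hb]] ->]]] [n [p2 hd]] ->]]].
rewrite 2![LHS]comp_lfunE 2![RHS]comp_lfunE wasc_pure.
rewrite (braiding_hwt r3 r8 mA (mtens mB mD) ha (hwt_tens mB mD hb hd)).
rewrite tmap_pure (braiding_hwt r3 r8 mA mB ha hb) id_lfunE pure_suml !hom_sum.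
(* The terms of the two successive crossings; they vanish for [i + j >= r0], so they can be grouped
   by [k = i + j], the index of the single crossing. *)
pose f i j := (brc r l p m p1 i * brc r (l + 2 * i%:R) (p (+) odd i) n p2 j) *:
  pure (lfun_exp (opF B) i b) (pure (lfun_exp (opF D) j d) (lfun_exp (opE A) (j + i) a)).
have f0 i j : (r0 <= i + j)%N -> f i j = 0.
  by move=> h; rewrite /f (lfun_exp_ge0 _ (rel_E0 mA)) 1?addnC // !pure0r scaler0.
transitivity (\sum_(i < r0) \sum_(j < r0) f i j); last first.
  apply: eq_bigr => i _; rewrite pureZl !homZ wasc_pure tmap_pure id_lfunE.
  rewrite (braiding_hwt r3 r8 mA mD (hwt_En mA i ha) hd) pure_sumr scaler_sumr.
  by apply: eq_bigr => j _; rewrite pureZr scalerA -lfun_expD.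
rewrite (triangular_sum f0); apply: eq_bigr => k _.
rewrite homZ (tensFn mB _ _ hb) pure_suml hom_sum scaler_sumr.
apply: eq_bigr => -[i ik] _ /=; rewrite pureZl homZ wasc_pure scalerA /f subnK //.
congr (_ *: _); have kr : (i + (k - i) < r0)%N by rewrite subnKC.
move: kr; rewrite -{-1}[nat_of_ord k](subnKC (ik : i <= k)%N) ?addKn.
move: (k - i)%N => j kr; rewrite ?addKn.
exact: brc_hexagon.
Qed.

Lemma braiding_hexagon_inv :
  (wasci D A B \o braiding (wtens A B) D \o wasci A B D
   = tmap (braiding A D) \1 \o wasci A D B \o tmap \1 (braiding B D))%VF.
Proof.
apply: (generating_pure (generating_hwt mA) (generating_pure (generating_hwt mB)
  (generating_hwt mD))).
move=> _ [a [_ [[l [p ha]] [b [d [[m [p1 hb]] [n [p2 hd]] ->]]] ->]]].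
rewrite 2![LHS]comp_lfunE 2![RHS]comp_lfunE wasci_pure.
rewrite (braiding_hwt r3 r8 (mtens mA mB) mD (hwt_tens mA mB ha hb) hd).
rewrite tmap_pure (braiding_hwt r3 r8 mB mD hb hd) id_lfunE pure_sumr !hom_sum.
pose f j i := (brc r m p1 n p2 j * brc r l p (n - 2 * j%:R) (p2 (+) odd j) i) *:
  pure (pure (lfun_exp (opF D) (i + j) d) (lfun_exp (opE A) i a)) (lfun_exp (opE B) j b).
have f0 j i : (r0 <= j + i)%N -> f j i = 0.
  by move=> h; rewrite /f (lfun_exp_ge0 _ (rel_F0 mD)) 1?addnC // !pure0l scaler0.
transitivity (\sum_(j < r0) \sum_(i < r0) f j i); last first.
  apply: eq_bigr => j _; rewrite pureZr !homZ wasci_pure tmap_pure id_lfunE.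
  rewrite (braiding_hwt r3 r8 mA mD ha (hwt_Fn mD j hd)) pure_suml scaler_sumr.
  by apply: eq_bigr => i _; rewrite pureZl scalerA -lfun_expD.
rewrite (triangular_sum f0); apply: eq_bigr => k _.
rewrite homZ (tensEn mA mB _ ha hb) pure_sumr hom_sum scaler_sumr.
apply: eq_bigr => -[j jk] _ /=; rewrite pureZr homZ wasci_pure scalerA /f subnK //.
congr (_ *: _); have kr : (j + (k - j) < r0)%N by rewrite subnKC.
move: kr; rewrite -{-1}[nat_of_ord k](subnKC (jk : j <= k)%N) ?addKn.
move: (k - j)%N => i kr; rewrite ?addKn.
exact: brc_hexagon_inv.
Qed.

End Hexagons.

Lemma weight_braided (s : int) : braided (weight_category R r r0 s).
Proof.
split.
- move=> A B mA mB; have [g [gc cg]] := braiding_iso mA mB.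
  have mc := weight_mor_braiding r3 r8 hr0 mA mB.
  exists g; split=> //.
  exact: (weight_mor_inv (V := wtens A B) (W := wtens B A) gc cg mc).
- by move=> A A' B B' f g *; exact: braiding_nat.
- by move=> A B D mA mB mD; exact: braiding_hexagon.
by move=> A B D mA mB mD; exact: braiding_hexagon_inv.
Qed.

End BraidedCategory.

(** * The twist *)

Lemma sum_pair (U : nmodType) (I J : finType) (F : I * J -> U) :
  \sum_p F p = \sum_i \sum_j F (i, j).
Proof. by rewrite pair_bigA; apply: eq_bigr => -[]. Qed.

(** Treats a crossing as if it came from an R-matrix [sum_i a_i (x) b_i]; compositions and partial
    traces then become sums of products of linear maps. *)
Definition presents (k : fieldType) (V W V' W' : vectType k) (f : 'Hom(tens V W, tens W' V'))
    (I : finType) (a : I -> 'Hom(V, V')) (b : I -> 'Hom(W, W')) : Prop :=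
  forall v w, f (pure v w) = \sum_i pure (b i w) (a i v).

(** The index set consists of matrix entries: a basis vector in each source factor and one in the
    first target factor. *)
Lemma presentation_exists (k : fieldType) (V W V' W' : vectType k)
    (f : 'Hom(tens V W, tens W' V')) :
  exists (I : finType) (a : I -> 'Hom(V, V')) (b : I -> 'Hom(W, W')), presents f a b.
Proof.
pose I : finType := ('I_(\dim {:V}) * 'I_(\dim {:W}) * 'I_(\dim {:W'}))%type.
have exa (i : I) : exists A : 'Hom(V, V'), forall v, A v =
    (dcoord i.1.1 v : k) *: f (pure (vbasis {:V})`_i.1.1 (vbasis {:W})`_i.1.2) (dcoord i.2).
  pose g v := (dcoord i.1.1 v : k) *:
    f (pure (vbasis {:V})`_i.1.1 (vbasis {:W})`_i.1.2) (dcoord i.2).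
  have gl : linear g by move=> c x y; rewrite /g linearP scalerDl -scalerA.
  by exists (linfun g) => v; rewrite (linfunE gl).
have exb (i : I) : exists B : 'Hom(W, W'), forall w, B w =
    (dcoord i.1.2 w : k) *: (vbasis {:W'})`_i.2.
  pose g w := (dcoord i.1.2 w : k) *: (vbasis {:W'})`_i.2.
  have gl : linear g by move=> c x y; rewrite /g linearP scalerDl -scalerA.
  by exists (linfun g) => w; rewrite (linfunE gl).
have [a aE] := choice exa; have [b bE] := choice exb.
exists I, a, b => v w; rewrite !sum_pair {1}[v]vbasis_dcoord pure_suml hom_sum.
apply: eq_bigr => i _; rewrite {1}[w]vbasis_dcoord pure_sumr hom_sum.
apply: eq_bigr => j _; rewrite pureZl pureZr !homZ [f _]tens_pureE !scaler_sumr.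
apply: eq_bigr => m _; rewrite aE bE /= pureZl pureZr !scalerA; congr (_ *: _).
exact: mulrC.
Qed.

(** As a composite of structure morphisms the twist is a morphism, before any formula for it is
    known. *)
Lemma ismor_ptr_twist (k : fieldType) (X : cat_data k) :
    linear_monoidal_category X -> rigid X -> braided X ->
  forall A : ob X, isob A -> ismor (ptr_twist A).
Proof.
move=> M D B A oA; have L := mon_linear M; have oI := ob_one M.
have oD := ob_dual D oA; have T := ob_tens M.
have [g [mc _ _ _]] := brd_iso B oA oA.
have [m1 m7 _ _] := ruK M oA; have [m3 m5 _ _] := ascK M oA oA oD.
have mI A' : isob A' -> ismor (idm A') := @mor_id _ _ L A'.
have m2 : ismor (tmor (idm A) (evr A)).
  by apply: (mor_tens M); auto; exact: (mor_evr D).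
have m4 : ismor (tmor (brd A A) (idm (dual A))).
  by apply: (mor_tens M); auto.
have m6 : ismor (tmor (idm A) (coevl A)).
  by apply: (mor_tens M); auto; exact: (mor_coevl D).
have o1 := T _ _ oA oI; have o2 := T _ _ oA (T _ _ oA oD); have o3 := T _ _ (T _ _ oA oA) oD.
by do 6! (apply: (mor_comp L) => //).
Qed.

Definition pure_l (k : fieldType) (V W : vectType k) (w : W) : 'Hom(V, tens V W) :=
  linfun (fun v : V => pure v w).

Definition pure_r (k : fieldType) (V W : vectType k) (v : V) : 'Hom(W, tens V W) :=
  linfun (fun w : W => pure v w).

Lemma pure_lE (k : fieldType) (V W : vectType k) (w : W) (v : V) : pure_l V w v = pure v w.
Proof. by rewrite /pure_l linfunE //; exact: pure_linl. Qed.

Lemma pure_rE (k : fieldType) (V W : vectType k) (w : W) (v : V) : pure_r W v w = pure v w.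
Proof. by rewrite /pure_r linfunE //; exact: pure_linr. Qed.

Section Twist.
Context {R : realType}.
Local Notation C := R[i].
Variables (r r0 : nat) (s : int).
Local Notation qp := (@qexp R r).
Local Notation q := (qp 1).
Local Notation wmod := (@weight_module R r r0).
Hypotheses (r3 : (3 <= r)%N) (r8 : (r %% 8 != 4)%N) (hr0 : least_zero_qbr R r r0).
Hypothesis hs : qp (2 * s)%:~R = 1.
Local Notation mtens := (weight_module_tens r3 r8 hr0).
Local Notation braiding := (wbraiding r r0).
Local Notation cat := (weight_category R r r0 s).
Local Notation th := (@ptr_twist C cat).
Local Notation piv := (fun V : @opspace R => pivot V (1 - s)).

(** The dual bases of the closing strand contract to the identity, and [evr] leaves the pivot. With
    [v] fixed, the operators [b i] may depend on its weight and parity. *)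
Lemma ptr_twist_at (V : @opspace R) (mV : wmod V) v (I : finType) (b : I -> 'End(V)) (x : I -> V) :
    (forall w, braiding V V (pure v w) = \sum_i pure (b i w) (x i)) ->
  (th V : 'End(V)) v = \sum_i b i (piv V (x i)).
Proof.
move=> cE; rewrite /ptr_twist /ptr_right /= 6!comp_lfunE.
rewrite wruiE tmap_pure wcoevlE scale1r id_lfunE pure_sumr !hom_sum.
transitivity (\sum_(j < \dim {:V}) \sum_i
  b i ((dcoord j (piv V (x i)) : C) *: (vbasis {:V})`_j)).
  apply: eq_bigr => j _.
  rewrite wasci_pure tmap_pure cE id_lfunE pure_suml !hom_sum.
  apply: eq_bigr => i _.
  by rewrite wasc_pure tmap_pure id_lfunE (wevr_pure s _ _ mV) wru_pure -homZ.
rewrite exchange_big /=; apply: eq_bigr => i _.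
by rewrite -hom_sum -vbasis_dcoord.
Qed.

Lemma ptr_twist_presents (V : @opspace R) (mV : wmod V) (I : finType) (a b : I -> 'End(V)) :
    presents (braiding V V) a b ->
  forall v, (th V : 'End(V)) v = \sum_i b i (piv V (a i v)).
Proof. by move=> cE v; apply: ptr_twist_at => // w; exact: cE. Qed.

(** In the exponent [l^2 / 2] comes from [upsilon] and [(1 - s) l] from the pivot. *)
Definition tw (l : C) : C := locked (qp (l * l / 2 + (1 - s)%:~R * l)).

(** At weight [l + 2 n] the exponent of [q] gains [2 n] from the pivot and [2 n^2] from the braiding
    coefficient. *)
Definition bcf (n : nat) : C := locked (gcoef r n * q ^+ (2 * (n * n.+1))).

Lemma tw_neq0 l : tw l != 0.
Proof. by rewrite /tw -lock qexp_neq0. Qed.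

Lemma twist_coef l p n :
  (-1) ^+ (p (+) odd n) * qp ((1 - s)%:~R * (l + 2 * n%:R))
    * brc r l p (l + 2 * n%:R) (p (+) odd n) n
  = tw l * (bcf n * qp l ^+ n).
Proof.
rewrite brcE /tw /bcf -!lock.
have -> : qp ((1 - s)%:~R * (l + 2 * n%:R)) = qp ((1 - s)%:~R * l) * q ^+ (2 * n).
  elim: n => [|n IH]; first by rewrite mulr0 addr0 muln0 mulr1.
  have -> : l + 2 * n.+1%:R = l + 2 * n%:R + 2 :> C by rewrite -[n.+1]addn1 natrD; ring.
  by rewrite (qexp_piv hs) IH (mulnS 2 n) addnC exprD mulrA.
have -> : qp (l * (l + 2 * n%:R) / 2) = qp (l * l / 2) * qp l ^+ n.
  rewrite -qexpMn -qexpD -halfD; congr qexp; congr (_ / _).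
  by rewrite -mulr_natl; ring.
have -> : l + 2 * n%:R - l = 2 * n%:R :> C by ring.
rewrite qexp2n exprMn -exprM (qexpD _ (l * l / 2)).
have -> : (2 * (n * n.+1) = 2 * n + 2 * n * n)%N by nia.
rewrite exprD -exprM.
have -> : (-1) ^+ ((p (+) odd n) * n)%N = (-1) ^+ ((p (+) odd n) && odd n) :> C.
  by rewrite -signr_odd oddM oddb.
by case: p (odd n) => -[] /=; rewrite ?expr0 ?expr1; ring.
Qed.

Lemma twist_hwt (V : @opspace R) (mV : wmod V) l p (v : V) : hwt l p v ->
  (th V : 'End(V)) v = tw l *: \sum_(n < r0)
    (bcf n * qp l ^+ n) *: lfun_exp (opF V) n (lfun_exp (opE V) n v).
Proof.
move=> hv.
(* The braiding coefficients depend on the weight of the second argument, so they enter as diagonal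
   operators. *)
have exD (n : nat) : exists D : 'End(V), forall m p' w, hwt m p' w ->
    D w = brc r l p m p' n *: w.
  exact: (diagonal_op mV (fun m p' => brc r l p m p' n)).
have [D DP] := choice exD.
have cE w : braiding V V (pure v w)
    = \sum_(n < r0) pure ((lfun_exp (opF V) n \o D n)%VF w) (lfun_exp (opE V) n v).
  pose c1 := (braiding V V \o pure_r V v)%VF.
  have c1E w' : c1 w' = braiding V V (pure v w').
    by rewrite /c1 [LHS]comp_lfunE pure_rE.
  pose c2 (n : 'I_r0) : 'Hom(V, tens V V) :=
    (pure_l V (lfun_exp (opE V) n v) \o (lfun_exp (opF V) n \o D n))%VF.
  have c2E n w' : c2 n w' = pure ((lfun_exp (opF V) n \o D n)%VF w') (lfun_exp (opE V) n v).
    by rewrite /c2 [LHS]comp_lfunE pure_lE.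
  rewrite -c1E; under eq_bigr => n _ do rewrite -c2E.
  rewrite -sum_lfunE; apply: lfun_eq; apply: (lfun_hwt mV) => m p' x hx.
  rewrite c1E (braiding_hwt r3 r8 mV mV hv hx) sum_lfunE; apply: eq_bigr => n _.
  by rewrite c2E comp_lfunE (DP _ _ _ _ hx) homZ pureZl.
rewrite (ptr_twist_at mV cE) scaler_sumr; apply: eq_bigr => n _.
have hE := hwt_En mV n hv.
rewrite comp_lfunE (pivot_hwt mV _ hE) homZ (DP _ _ _ _ hE) !homZ !scalerA.
by rewrite twist_coef.
Qed.

Lemma weight_mor_twist (V : @opspace R) : wmod V -> @weight_mor R V V (th V : 'End(V)).
Proof.
exact: (ismor_ptr_twist (X := cat) (weight_monoidal_category r3 r8 hr0 s)
  (weight_rigid r3 r8 hr0 hs) (weight_braided r3 r8 hr0 s)).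
Qed.

Lemma pivot_tens (V W : @opspace R) (mV : wmod V) (mW : wmod W) :
  pivot (wtens V W) (1 - s) = tmap (piv V) (piv W).
Proof.
apply: (hwt_tens_ext mV mW) => l p v m p' w hv hw.
rewrite tmap_pure (pivot_hwt mV _ hv) (pivot_hwt mW _ hw).
rewrite (pivot_hwt (mtens mV mW) _ (hwt_tens mV mW hv hw)) pureZl pureZr scalerA.
by rewrite signr_addb mulrDr qexpD mulrACA.
Qed.

(** A hexagon, read as a rule for presentations: a strand crosses a tensor product by crossing its
    factors one after the other. *)
Lemma presents_tens_left (A B D : @opspace R) (mA : wmod A) (mB : wmod B) (mD : wmod D)
    (I J : finType) (a : I -> 'End(A)) (d : I -> 'End(D)) (b : J -> 'End(B)) (d' : J -> 'End(D)) :
    presents (braiding A D) a d -> presents (braiding B D) b d' ->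
  presents (braiding (wtens A B) D)
    (fun k : J * I => tmap (a k.2) (b k.1)) (fun k => (d k.2 \o d' k.1)%VF).
Proof.
move=> pA pB t x.
have e : forall u v, braiding (wtens A B) D (pure (pure u v) x)
    = \sum_(k : J * I) pure ((d k.2 \o d' k.1)%VF x) (tmap (a k.2) (b k.1) (pure u v)).
  move=> u v; have := lfun_eq (braiding_hexagon_inv r3 r8 hr0 mA mB mD) (pure u (pure v x)).
  rewrite 2![LHS]comp_lfunE 2![RHS]comp_lfunE wasci_pure => /(congr1 (wasc D A B)).
  rewrite -[LHS]comp_lfunE wasciK id_lfunE => ->.
  rewrite tmap_pure pB id_lfunE pure_sumr !hom_sum sum_pair; apply: eq_bigr => j _.
  rewrite wasci_pure tmap_pure pA id_lfunE pure_suml !hom_sum; apply: eq_bigr => i _.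
  by rewrite wasc_pure tmap_pure comp_lfunE.
rewrite [t]tens_pureE pure_suml hom_sum.
under eq_bigr => i _ do rewrite e.
rewrite exchange_big; apply: eq_bigr => k _.
by rewrite hom_sum pure_sumr.
Qed.

Lemma presents_tens_right (A B D : @opspace R) (mA : wmod A) (mB : wmod B) (mD : wmod D)
    (I J : finType) (a : I -> 'End(A)) (b : I -> 'End(B)) (a' : J -> 'End(A)) (d : J -> 'End(D)) :
    presents (braiding A B) a b -> presents (braiding A D) a' d ->
  presents (braiding A (wtens B D))
    (fun k : I * J => (a' k.2 \o a k.1)%VF) (fun k => tmap (b k.1) (d k.2)).
Proof.
move=> pB pD x t.
have e : forall u v, braiding A (wtens B D) (pure x (pure u v))
    = \sum_(k : I * J) pure (tmap (b k.1) (d k.2) (pure u v)) ((a' k.2 \o a k.1)%VF x).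
  move=> u v; have := lfun_eq (braiding_hexagon r3 r8 hr0 mA mB mD) (pure (pure x u) v).
  rewrite 2![LHS]comp_lfunE 2![RHS]comp_lfunE wasc_pure => /(congr1 (wasci B D A)).
  rewrite -[LHS]comp_lfunE wascK id_lfunE => ->.
  rewrite tmap_pure pB id_lfunE pure_suml !hom_sum sum_pair; apply: eq_bigr => i _.
  rewrite wasc_pure tmap_pure pD id_lfunE pure_sumr !hom_sum; apply: eq_bigr => j _.
  by rewrite wasci_pure tmap_pure comp_lfunE.
rewrite [t]tens_pureE pure_sumr hom_sum.
under eq_bigr => i _ do rewrite e.
rewrite exchange_big; apply: eq_bigr => k _.
by rewrite hom_sum pure_suml.
Qed.

Lemma twist_nat (V W : @opspace R) (mV : wmod V) (mW : wmod W) (f : 'Hom(V, W)) :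
  weight_mor f -> ((th W : 'End(W)) \o f = f \o (th V : 'End(V)))%VF.
Proof.
move=> mf; apply: (lfun_hwt mV) => l p v hv.
rewrite 2!comp_lfunE (twist_hwt mV hv) (twist_hwt mW (mor_hwt mf hv)) homZ hom_sum.
congr (_ *: _); apply: eq_bigr => n _.
by rewrite homZ (morFn mf) (morEn mf).
Qed.

End Twist.

(** * Invertibility of the twist and its compatibility with tensor products *)

Section TwistProperties.
Context {R : realType}.
Local Notation C := R[i].
Variables (r r0 : nat) (s : int).
Local Notation qp := (@qexp R r).
Local Notation q := (qp 1).
Local Notation wmod := (@weight_module R r r0).
Hypotheses (r3 : (3 <= r)%N) (r8 : (r %% 8 != 4)%N) (hr0 : least_zero_qbr R r r0).
Hypothesis hs : qp (2 * s)%:~R = 1.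
Local Notation mtens := (weight_module_tens r3 r8 hr0).
Local Notation braiding := (wbraiding r r0).
Local Notation cat := (weight_category R r r0 s).
Local Notation th V := (@ptr_twist C cat V : 'End(V)).
Local Notation piv := (fun V : @opspace R => pivot V (1 - s)).

(* On the kernel of [E] the twist acts by the invertible operator [tw]. *)
Lemma twist_inj (V : @opspace R) : wmod V -> lker (th V) == 0%VS.
Proof.
move=> mV; have mt := weight_mor_twist r3 r8 hr0 hs mV.
have rP := r0_gt0 hr0; have [N eN] : exists N, r0 = N.+1 by exists r0.-1; rewrite prednK.
have [T TP] := diagonal_op mV (fun l _ => tw r s l).
have [T' TP'] := diagonal_op mV (fun l _ => (tw r s l)^-1).
have T'T : (T' \o T = \1)%VF.
  apply: (lfun_hwt mV) => l p v hv; rewrite comp_lfunE id_lfunE (TP _ _ _ hv) homZ.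
  by rewrite (TP' _ _ _ hv) scalerA divff ?scale1r // tw_neq0.
have exD (n : nat) : exists D : 'End(V), forall m p' w, hwt m p' w ->
    D w = (tw r s (m - 2) * (bcf r n * qp (m - 2) ^+ n)) *: w.
  exact: (diagonal_op mV (fun m _ => tw r s (m - 2) * (bcf r n * qp (m - 2) ^+ n))).
have [D DP] := choice exD.
(* The terms with [n >= 1] factor through [E]. Since [E] has raised the weight by 2, the diagonal
   operators [D] use [m - 2]. *)
have thE : th V =
    T + ((\sum_(n < N) (lfun_exp (opF V) n.+1 \o lfun_exp (opE V) n \o D n.+1)) \o opE V)%VF.
  apply: (lfun_hwt mV) => l p v hv.
  rewrite (twist_hwt r3 r8 hs mV hv) add_lfunE (TP _ _ _ hv) comp_lfunE sum_lfunE.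
  rewrite eN big_ord_recl scalerDr scaler_sumr !lfun_exp0; congr (_ + _).
    by rewrite /bcf /gcoef -!lock !muln0 oppr0 qexp0 qpoch0 !expr0 divr1 !mulr1 scale1r.
  apply: eq_bigr => n _; rewrite [in RHS]comp_lfunE [in RHS]comp_lfunE.
  rewrite (DP _ _ _ _ (hwt_E mV hv)) addrK !homZ scalerA.
  by rewrite lift0 (lfun_expSr (opE V)).
apply/lker0P => x1 x2 e12; apply/eqP; rewrite -subr_eq0; set x := x1 - x2.
have tx : th V x = 0 by rewrite /x homB e12 subrr.
suff Ek d k : (r0 <= k + d)%N -> lfun_exp (opE V) k x = 0.
  by apply/eqP; have := Ek r0 0%N; rewrite add0n lfun_exp0; apply.
elim: d k => [|d IH] k kd; first by rewrite (lfun_exp_ge0 _ (rel_E0 mV)) // -[k]addn0.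
have : th V (lfun_exp (opE V) k x) = 0 by rewrite (morEn mt) tx hom0.
rewrite thE add_lfunE [X in _ + X]comp_lfunE -lfun_expS (IH k.+1) ?addSnnS //.
rewrite hom0 addr0 => e.
by rewrite -[LHS]id_lfunE -T'T comp_lfunE e hom0.
Qed.

Lemma weight_natural_automorphism : natural_automorphism (fun V : ob cat => @ptr_twist C cat V).
Proof.
split.
  move=> V mV; have k0 := twist_inj mV; have mt := weight_mor_twist r3 r8 hr0 hs mV.
  exists ((th V)^-1)%VF; split=> //; [|exact: lker0_compVf|exact: lker0_compfV].
  exact: (weight_mor_inv (lker0_compVf k0) (lker0_compfV k0) mt).
by move=> V W f mV mW mf; exact: twist_nat.
Qed.

(** The strand of [V (x) W] is closed one factor at a time. Closing [W] creates its twist, which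
    slides out of the diagram; the Yang-Baxter equation then frees the loop of [V], and naturality
    moves the resulting twist of [V] past the remaining crossing. *)
Lemma twist_tens_eq (V W : @opspace R) (mV : wmod V) (mW : wmod W) :
  th (wtens V W) = (braiding W V \o braiding V W \o tmap (th V) (th W))%VF.
Proof.
have mA := mtens mV mW; have mB := mtens mW mV.
have mthV := weight_mor_twist r3 r8 hr0 hs mV.
have mthW := weight_mor_twist r3 r8 hr0 hs mW.
have [Iu [au [bu pu]]] := presentation_exists (braiding V V).
have [It [at_ [bt pt]]] := presentation_exists (braiding W V).
have [In [an [bn pn]]] := presentation_exists (braiding V W).
have [Im [am [bm pm]]] := presentation_exists (braiding W W).
have pA := presents_tens_right r3 r8 hr0 mA mV mW
  (presents_tens_left r3 r8 hr0 mV mW mV pu pt) (presents_tens_left r3 r8 hr0 mV mW mW pn pm).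
have thV := ptr_twist_presents s mV pu; have thW := ptr_twist_presents s mW pm.
apply: tens_ext => v w; set w1 := th W w.
pose G : 'End(V) := pivot V (1 - s).
(* Sliding the twist of [W] below the crossing of [W] with [V]. *)
have slide x y : \sum_t pure (bt t x) (th W (at_ t y)) = \sum_t pure (bt t x) (at_ t (th W y)).
  have := lfun_eq (braiding_nat r3 r8 mW mW mV mV mthW (weight_mor_id V)) (pure y x).
  rewrite [LHS]comp_lfunE [RHS]comp_lfunE tmap_pure id_lfunE !pt => ->.
  by rewrite hom_sum; apply: eq_bigr => t _; rewrite tmap_pure id_lfunE.
(* The Yang-Baxter equation, then partially traced over the third strand. *)
have YB x : \sum_t \sum_u \sum_n
      pure ((bu u \o bt t)%VF x) (pure (bn n (at_ t w1)) (an n (au u v)))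
    = \sum_n \sum_u \sum_t
      pure ((bt t \o bu u)%VF x) (pure (at_ t (bn n w1)) (au u (an n v))).
  have := lfun_eq (braiding_nat r3 r8 mA mB mV mV (weight_mor_braiding r3 r8 hr0 mV mW)
    (weight_mor_id V)) (pure (pure v w1) x).
  rewrite [LHS]comp_lfunE [RHS]comp_lfunE tmap_pure id_lfunE pn pure_suml hom_sum.
  rewrite (presents_tens_left r3 r8 hr0 mV mW mV pu pt) hom_sum sum_pair /= => e.
  transitivity (\sum_t \sum_u tmap \1 (braiding V W)
    (pure ((bu u \o bt t)%VF x) (tmap (au u) (at_ t) (pure v w1)))).
    apply: eq_bigr => t _; apply: eq_bigr => u _.
    by rewrite !tmap_pure id_lfunE pn pure_sumr.
  rewrite -e; apply: eq_bigr => n _.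
  rewrite (presents_tens_left r3 r8 hr0 mW mV mV pt pu) sum_pair /=.
  by apply: eq_bigr => u _; apply: eq_bigr => t _; rewrite tmap_pure.
have yb : \sum_t \sum_u \sum_n pure ((bu u \o bt t)%VF (G (an n (au u v)))) (bn n (at_ t w1))
    = \sum_n \sum_u \sum_t pure ((bt t \o bu u)%VF (G (au u (an n v)))) (at_ t (bn n w1)).
  (* [kj j] pairs the last factor, after the pivot, with the [j]-th coordinate. Feeding the [j]-th
     basis vector into the first factor and summing over [j] is the partial trace. *)
  pose kj (j : 'I_(\dim {:V})) : 'Hom(tens V (tens W V), tens V W) :=
    (wru (tens V W) \o tmap \1 (dcoord j \o G) \o wasci V W V)%VF.
  have kjE j x y z : kj j (pure x (pure y z)) = (dcoord j (G z) : C) *: pure x y.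
    rewrite /kj 2!comp_lfunE wasci_pure tmap_pure id_lfunE wru_pure.
    by rewrite comp_lfunE.
  have contract (J : finType) (f : J -> 'End(V)) (y : J -> W) (z : J -> V) :
      \sum_k pure (f k (G (z k))) (y k)
      = \sum_j kj j (\sum_k pure (f k (vbasis {:V})`_j) (pure (y k) (z k))).
    under [RHS]eq_bigr => j _ do rewrite hom_sum.
    rewrite exchange_big; apply: eq_bigr => k _.
    rewrite [G (z k)]vbasis_dcoord hom_sum pure_suml; apply: eq_bigr => j _.
    by rewrite kjE homZ pureZl.
  have := contract (It * Iu * In)%type (fun k => (bu k.1.2 \o bt k.1.1)%VF)
    (fun k => bn k.2 (at_ k.1.1 w1)) (fun k => an k.2 (au k.1.2 v)).
  have := contract (In * Iu * It)%type (fun k => (bt k.2 \o bu k.1.2)%VF)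
    (fun k => at_ k.2 (bn k.1.1 w1)) (fun k => au k.1.2 (an k.1.1 v)).
  rewrite !sum_pair /= => -> ->; apply: eq_bigr => j _; congr (kj j _).
  by rewrite !sum_pair /=; exact: YB.
rewrite (ptr_twist_presents s mA pA) sum_pair /=.
transitivity (\sum_t \sum_u \sum_n pure ((bu u \o bt t)%VF (G (an n (au u v)))) (bn n (th W (at_ t w)))).
  rewrite sum_pair; apply: eq_bigr => t _; apply: eq_bigr => u _.
  rewrite sum_pair exchange_big; apply: eq_bigr => n _.
  rewrite thW hom_sum pure_sumr; apply: eq_bigr => m _.
  rewrite (pivot_tens s r3 r8 hr0 mV mW) comp_lfunE !tmap_pure.
  by rewrite !comp_lfunE.
transitivity (\sum_t \sum_u \sum_n pure ((bu u \o bt t)%VF (G (an n (au u v)))) (bn n (at_ t w1))).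
  rewrite exchange_big [RHS]exchange_big; apply: eq_bigr => u _.
  rewrite exchange_big [RHS]exchange_big; apply: eq_bigr => n _.
  have := congr1 (tmap (bu u) (bn n)) (slide (G (an n (au u v))) w).
  rewrite !hom_sum => e.
  transitivity (\sum_t tmap (bu u) (bn n) (pure (bt t (G (an n (au u v)))) (th W (at_ t w)))).
    by apply: eq_bigr => t _; rewrite tmap_pure comp_lfunE.
  by rewrite e; apply: eq_bigr => t _; rewrite tmap_pure comp_lfunE.
rewrite yb [RHS]comp_lfunE [X in _ = X]comp_lfunE.
have := lfun_eq (braiding_nat r3 r8 mV mV mW mW mthV (weight_mor_id W)) (pure v w1).
rewrite [LHS]comp_lfunE [RHS]comp_lfunE !tmap_pure id_lfunE => ->.
rewrite pn !hom_sum; apply: eq_bigr => n _.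
rewrite tmap_pure id_lfunE pt exchange_big; apply: eq_bigr => t _.
rewrite thV hom_sum pure_suml; apply: eq_bigr => u _.
by rewrite comp_lfunE.
Qed.

End TwistProperties.

(** * Verma modules and the twist on duals *)

Section Verma.
Context {R : realType}.
Local Notation C := R[i].
Variables (r r0 : nat) (s : int).
Local Notation qp := (@qexp R r).
Local Notation q := (qp 1).
Local Notation wmod := (@weight_module R r r0).
Hypotheses (r3 : (3 <= r)%N) (r8 : (r %% 8 != 4)%N) (hr0 : least_zero_qbr R r r0).

Local Notation rv := 'rV[C]_r0.

(** Zero for [n >= r0], which encodes [F^r0 = 0]. *)
Definition vb (n : nat) : rv := \row_j ((j : nat) == n)%:R.

Definition row_op (g : nat -> rv) : 'End(rv) :=
  linfun (fun v : rv => \sum_(i < r0) v 0 i *: g i).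

Lemma row_opE g v : row_op g v = \sum_(i < r0) v 0 i *: g i.
Proof.
rewrite /row_op linfunE // => a x y; rewrite scaler_sumr -big_split.
by apply: eq_bigr => i _; rewrite /= !mxE scalerDl scalerA.
Qed.

Lemma vb_big n : (r0 <= n)%N -> vb n = 0.
Proof.
move=> h; apply/rowP => j; rewrite !mxE; case: eqP => // e.
by have := ltn_ord j; rewrite e ltnNge h.
Qed.

Lemma row_op_vb g n : (n < r0)%N -> row_op g (vb n) = g n.
Proof.
move=> nr; rewrite row_opE (bigD1 (Ordinal nr)) //= mxE eqxx scale1r.
rewrite big1 ?addr0 // => j; rewrite -val_eqE /= => jn.
by rewrite mxE (negPf jn) scale0r.
Qed.

Lemma row_vb (v : rv) : v = \sum_(i < r0) v 0 i *: vb i.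
Proof.
apply/rowP => j; rewrite summxE (bigD1 j) //= !mxE eqxx mulr1 big1 ?addr0 // => i ij.
by rewrite !mxE val_eqE eq_sym (negPf ij) mulr0.
Qed.

(** [vb n] stands for [F^n] applied to the highest weight vector. At [n = 0] the predecessor in
    [opE] is harmless because [kap 0] is zero. *)
Definition verma (nu : C) : @opspace R :=
  @OpSpace R rv
    (fun p => row_op (fun n => if odd n == p then vb n else 0))
    (row_op (fun n => (nu - 2 * n%:R) *: vb n))
    (row_op (fun n => qp (nu - 2 * n%:R) *: vb n))
    (row_op (fun n => (qp (nu - 2 * n%:R))^-1 *: vb n))
    (row_op (fun n => kap r n (qp nu) *: vb n.-1))
    (row_op (fun n => vb n.+1)).

Variable nu : C.
Local Notation M := (verma nu).

Lemma vermaE n : (n < r0)%N -> opE M (vb n.+1) = kap r n.+1 (qp nu) *: vb n.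
Proof.
rewrite leq_eqVlt => /orP[/eqP e|nr]; last by rewrite /= row_op_vb.
(* The boundary case [n + 1 = r0]: the left side is [E 0], the right side vanishes because [kap r0]
   does. *)
by rewrite vb_big e // hom0 (kap_r0 r3 r8 hr0) scale0r.
Qed.

Lemma vermaE0 : opE M (vb 0) = 0.
Proof. by rewrite /= row_op_vb ?(r0_gt0 hr0) // kap0 scale0r. Qed.

Lemma vermaF n : opF M (vb n) = vb n.+1.
Proof.
have [nr|nr] := ltnP n r0; first by rewrite /= row_op_vb.
by rewrite vb_big // hom0 vb_big // ltnW.
Qed.

Lemma vermaFn k n : lfun_exp (opF M) k (vb n) = vb (n + k).
Proof.
elim: k => [|k IH]; first by rewrite lfun_exp0 addn0.
by rewrite lfun_expS IH vermaF addnS.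
Qed.

Lemma verma_homog n : (n < r0)%N -> @homog R r M (nu - 2 * n%:R) (odd n) (vb n).
Proof.
by move=> nr; split; rewrite /= row_op_vb ?eqxx //; case: (odd n).
Qed.

Lemma homog0 (V : @opspace R) l p : @homog R r V l p 0.
Proof. by split; rewrite hom0 ?scaler0. Qed.

Lemma weight_module_verma : wmod M.
Proof.
apply: (weight_moduleI (V := M) (X := [seq vb i | i <- iota 0 r0])).
  apply/eqP; rewrite eqEsubv subvf /=; apply/subvP => v _.
  rewrite [v]row_vb memv_suml // => i _; rewrite memvZ // memv_span //.
  by apply: map_f; rewrite mem_iota /= ltn_ord.
move=> v /mapP[n]; rewrite mem_iota /= add0n => nr ->.
exists (nu - 2 * n%:R), (odd n); split; first exact: verma_homog.
- case: n nr => [|n] nr; first by rewrite vermaE0; exact: homog0.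
  rewrite vermaE 1?ltnW //; apply: homogZ.
  have -> : nu - 2 * n.+1%:R + 2 = nu - 2 * n%:R by rewrite -[n.+1]addn1 natrD; ring.
  by rewrite /= negbK; apply: verma_homog; rewrite ltnW.
- rewrite vermaF; have [nr1|nr1] := ltnP n.+1 r0; last by rewrite vb_big //; exact: homog0.
  have -> : nu - 2 * n%:R - 2 = nu - 2 * n.+1%:R by rewrite -[n.+1]addn1 natrD; ring.
  exact: (verma_homog nr1).
split.
- rewrite vermaF vermaE //.
  have -> : opF M (opE M (vb n)) = kap r n (qp nu) *: vb n.
    case: n nr => [|n] nr; first by rewrite vermaE0 hom0 kap0 scale0r.
    by rewrite vermaE 1?ltnW // homZ vermaF.
  rewrite -scalerDl (kapS r3 r8); congr (_ *: _).
  by rewrite (qexpB _ nu) qexp2n invf_div [_ / qp nu]mulrC.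
- have E0 k : forall m, (m < k)%N -> lfun_exp (opE M) k (vb m) = 0.
    elim: k => // k IH m; rewrite ltnS => mk; rewrite lfun_expSr.
    case: m mk => [|m] mk; first by rewrite vermaE0 hom0.
    have [mr|mr] := ltnP m r0; last by rewrite [vb m.+1]vb_big ?hom0 // ltnW.
    by rewrite vermaE // homZ IH ?scaler0.
  exact: E0.
by rewrite vermaFn vb_big // leq_addl.
Qed.

Lemma verma_hwt n : (n < r0)%N -> @hwt R M (nu - 2 * n%:R) (odd n) (vb n).
Proof. by case/verma_homog. Qed.

Lemma verma_ext (U : vectType C) (f g : 'Hom(rv, U)) :
  (forall n, (n < r0)%N -> f (vb n) = g (vb n)) -> f = g.
Proof.
move=> fg; apply/lfunP => v; rewrite [v]row_vb !hom_sum; apply: eq_bigr => i _.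
by rewrite !homZ fg.
Qed.

Hypothesis hs : qp (2 * s)%:~R = 1.
Local Notation cat := (weight_category R r r0 s).
Local Notation th V := (@ptr_twist C cat V : 'End(V)).

Lemma bcf0 : bcf r 0 = 1 :> C.
Proof. by rewrite /bcf /gcoef -!lock !muln0 oppr0 qexp0 qpoch0 !expr0 divr1 !mulr1. Qed.

Lemma twist_highest (V : @opspace R) (mV : wmod V) l p (v : V) :
  hwt l p v -> opE V v = 0 -> th V v = tw r s l *: v.
Proof.
move=> hv Ev; rewrite (twist_hwt r3 r8 hs mV hv).
have [N eN] : exists N, r0 = N.+1 by exists r0.-1; rewrite prednK ?(r0_gt0 hr0).
rewrite eN big_ord_recl big1 ?addr0; last first.
  by move=> i _; rewrite lift0 (lfun_expSr (opE V)) Ev !hom0 scaler0.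
by rewrite !lfun_exp0 bcf0 expr0 mulr1 scale1r.
Qed.

(** The twist commutes with [F], so its value on the highest weight vector, where only the term
    [n = 0] survives, determines it. *)
Lemma verma_twist n : (n < r0)%N -> th M (vb n) = tw r s nu *: vb n.
Proof.
move=> nr; have mM := weight_module_verma.
have := vermaFn n 0; rewrite add0n => <-.
rewrite (morFn (weight_mor_twist r3 r8 hr0 hs mM)).
rewrite (twist_highest mM (verma_hwt (r0_gt0 hr0)) vermaE0) mulr0 subr0.
by rewrite homZ.
Qed.

(** The sum over a predicate allows a bare number as index, without a proof of [n < r0]. *)
Definition covb (n : nat) : ldual rv := linfun (fun v : rv => \sum_(i < r0 | i == n :> nat) v 0 i : C^o).

Lemma covbE n m : (n < r0)%N -> (m < r0)%N -> covb n (vb m) = (n == m)%:R :> C.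
Proof.
move=> nr mr; rewrite /covb linfunE.
  by rewrite (big_pred1 (Ordinal nr)) ?mxE // => i; rewrite -val_eqE.
move=> a x y; rewrite scaler_sumr -big_split; apply: eq_bigr => i _.
by rewrite !mxE.
Qed.

Local Notation D := (wdual M).

Lemma covb_cohwt n : (n < r0)%N -> @cohwt R M (nu - 2 * n%:R) (odd n) (covb n).
Proof.
move=> nr m p v [gv Hv] ne.
have eH : (covb n \o opH M = (nu - 2 * n%:R) *: covb n)%VF.
  apply: verma_ext => k kr; rewrite comp_lfunE scale_lfunE /= row_op_vb // homZ covbE //.
  by case: eqP => [->|_]; rewrite ?scaler0.
have eg : (covb n \o gr M p = (odd n == p)%:R *: covb n)%VF.
  apply: verma_ext => k kr; rewrite comp_lfunE scale_lfunE /= row_op_vb // covbE //.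
  case: (eqVneq n k) => [<-|nk]; last by case: ifP => _; rewrite ?hom0 ?covbE ?(negPf nk) ?scaler0.
  by case: ifP => _; rewrite ?hom0 ?covbE ?eqxx ?scale1r ?scale0r.
case/orP: ne => ne; last first.
  have := lfun_eq eg v; rewrite comp_lfunE scale_lfunE gv => ->.
  by rewrite eq_sym (negPf ne) scale0r.
have := lfun_eq eH v; rewrite comp_lfunE scale_lfunE Hv homZ => /eqP.
by rewrite -subr_eq0 -scalerBl scaler_eq0 subr_eq0 (negPf ne) => /eqP.
Qed.

(** The dual of the lowest vector is a highest weight vector of the dual, and [F] takes [covb n.+1]
    to a nonzero multiple of [covb n], whence the descending induction. *)
Lemma verma_dual_twist n : (n < r0)%N ->
  th D (covb n) = tw r s (- (nu - 2 * r0.-1%:R)) *: covb n :> ldual rv.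
Proof.
have mM := weight_module_verma; have mD := weight_module_dual mM.
have mt := weight_mor_twist r3 r8 hr0 hs mD; have rP := r0_gt0 hr0.
have top : (r0.-1 < r0)%N by rewrite prednK.
have hD k : (k < r0)%N -> @hwt R D (- (nu - 2 * k%:R)) (odd k) (covb k).
  by move=> kr; have [] := cohwt_homog mM (covb_cohwt kr).
move=> nr; have [d ed] : exists d, (n + d = r0.-1)%N.
  by exists (r0.-1 - n)%N; rewrite subnKC // -ltnS prednK.
elim: d n nr ed => [|d IH] n nr ed.
  rewrite addn0 in ed; rewrite ed; apply: (twist_highest mD (hD _ top)).
  apply: verma_ext => m mr; rewrite (dualE mM _ (verma_hwt mr)) zero_lfunE.
  case: m mr => [|m] mr; first by rewrite vermaE0 hom0 mulr0.
  rewrite vermaE 1?ltnW // ldualZ covbE // 1?ltnW //.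
  by rewrite gtn_eqF ?mulr0 // -ltnS prednK.
have nr1 : (n.+1 < r0)%N by rewrite -(prednK rP) ltnS -ed addnS leq_addr.
set c := (-1) ^+ odd n * qp (nu - 2 * n%:R - 2).
have c0 : c != 0 by rewrite mulf_neq0 ?signr_eq0 ?qexp_neq0.
have FD : opF D (covb n.+1) = c *: covb n :> ldual rv.
  apply: verma_ext => m mr; rewrite (dualF mM _ (verma_hwt mr)) vermaF scale_lfunE.
  rewrite (covbE nr mr); have [mr1|mr1] := ltnP m.+1 r0; last first.
    rewrite vb_big // hom0 mulr0 ltn_eqF ?scaler0 //.
    by rewrite -ltnS (leq_trans nr1).
  rewrite covbE // eqSS; have [e|_] := eqVneq n m; first by rewrite /c e.
  by rewrite mulr0 scaler0.
have -> : covb n = c^-1 *: opF D (covb n.+1) by rewrite FD scalerA mulVf ?scale1r.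
rewrite homZ (morF mt) IH // ?addSnnS // homZ !scalerA.
by rewrite mulrC.
Qed.

End Verma.

(** * Polynomials in an endomorphism *)

Section PolynomialAction.
Context {R : realType}.
Local Notation C := R[i].
Context {V : vectType C}.
Implicit Types (A : 'End(V)) (p : {poly C}) (u : V).

Definition poly_act A p u : V := \sum_(k < size p) p`_k *: lfun_exp A k u.

Lemma poly_act_widen N A p u : (size p <= N)%N ->
  poly_act A p u = \sum_(k < N) p`_k *: lfun_exp A k u.
Proof.
move=> pN; rewrite /poly_act (big_ord_widen N (fun k => p`_k *: lfun_exp A k u)) //.
rewrite big_mkcond; apply: eq_bigr => k _; case: ltnP => // h.
by rewrite nth_default ?scale0r.
Qed.

Lemma poly_actD A p p' u : poly_act A (p + p') u = poly_act A p u + poly_act A p' u.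
Proof.
pose N := maxn (size p) (size p').
rewrite !(@poly_act_widen N) ?leq_maxl ?leq_maxr ?size_polyD // -big_split.
by apply: eq_bigr => k _; rewrite coefD scalerDl.
Qed.

Lemma poly_actZ A c p u : poly_act A (c *: p) u = c *: poly_act A p u.
Proof.
rewrite !(@poly_act_widen (size p)) ?size_scale_leq // scaler_sumr.
by apply: eq_bigr => k _; rewrite coefZ scalerA.
Qed.

Lemma poly_act_sum A I (S : seq I) (P : pred I) (F : I -> {poly C}) u :
  poly_act A (\sum_(i <- S | P i) F i) u = \sum_(i <- S | P i) poly_act A (F i) u.
Proof.
elim/big_rec2: _ => [|i x y _ <-]; last by rewrite poly_actD.
by rewrite /poly_act size_poly0 big_ord0.
Qed.

Lemma poly_act_lin A p c u u' :
  poly_act A p (c *: u + u') = c *: poly_act A p u + poly_act A p u'.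
Proof.
rewrite /poly_act scaler_sumr -big_split; apply: eq_bigr => k _ /=.
by rewrite homD homZ scalerDr !scalerA mulrC.
Qed.

Lemma poly_act1 A u : poly_act A 1 u = u.
Proof. by rewrite /poly_act size_poly1 big_ord1 lfun_exp0 coef1 scale1r. Qed.

Lemma poly_actMX A p u : poly_act A (p * 'X) u = poly_act A p (A u).
Proof.
rewrite (@poly_act_widen (size p).+1); last first.
  by rewrite (leq_trans (size_polyMleq _ _)) // size_polyX addn2.
rewrite big_ord_recl coefMX scale0r add0r; apply: eq_bigr => k _.
by rewrite coefMX lift0 /= lfun_expSr.
Qed.

Lemma poly_act_linear A p a b u :
  poly_act A (p * (a *: 'X + b%:P)) u = poly_act A p (a *: A u + b *: u).
Proof.
rewrite mulrDr -scalerAr [p * b%:P]mulrC mul_polyC.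
rewrite poly_actD !poly_actZ poly_actMX -[b *: u]addr0 !poly_act_lin.
by rewrite [poly_act A p 0]/poly_act big1 ?addr0 // => k _; rewrite hom0 scaler0.
Qed.

Lemma poly_act_eigen A p u z : A u = z *: u -> poly_act A p u = p.[z] *: u.
Proof.
move=> Au; rewrite horner_coef scaler_suml; apply: eq_bigr => k _.
rewrite -scalerA; congr (_ *: _); elim: (nat_of_ord k) => [|n IH].
  by rewrite lfun_exp0 scale1r.
by rewrite lfun_expSr Au homZ IH scalerA exprS.
Qed.

End PolynomialAction.

(** Every positive integer is some [expR t], so [p] has at least [size p] roots. *)
Lemma poly_eq0_expR (R : realType) (p : {poly R[i]}) :
  (forall t : R, p.[(expR t)%:C%C] = 0) -> p = 0.
Proof.
move=> p0; apply/eqP; apply: contraT => pn0.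
pose rs := [seq (n.+1%:R : R[i]) | n <- iota 0 (size p)].
have : (size rs < size p)%N.
  apply: max_poly_roots => //.
    apply/allP => _ /mapP[n _ ->]; apply/eqP.
    have := p0 (ln n.+1%:R); rewrite lnK ?posrE ?ltr0n //.
    by rewrite rmorph_nat.
  by rewrite map_inj_uniq ?iota_uniq // => m n /eqP; rewrite eqr_nat => /eqP [].
by rewrite size_map size_iota ltnn.
Qed.

(** * The duality condition as a polynomial identity *)

Section DualTwist.
Context {R : realType}.
Local Notation C := R[i].
Variables (r r0 : nat).
Local Notation qp := (@qexp R r).
Local Notation q := (qp 1).
Local Notation wmod := (@weight_module R r r0).
Hypotheses (r3 : (3 <= r)%N) (r8 : (r %% 8 != 4)%N) (hr0 : least_zero_qbr R r r0).

(* [W] stands for [Y^2] with [Y = q^l] on vectors of weight [l], and ['X] for [Y F E];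
   then [FEpoly n] and [EFpoly n] act as [Y^n F^n E^n] and [Y^n E^n F^n]. *)
Local Notation W := ('X : {poly C}).

(** Multiplying [kap n Y] by [Y] makes it a polynomial in [Y^2]; the factor is available because [n]
    powers of [Y] accompany [F^n E^n]. Likewise [kapV] stands for [Y] times [kap n Y^-1], and [brW]
    for [Y] times the value of [(K - K^-1) / (q - q^-1)]. *)
Definition kapW (n : nat) : {poly C} :=
  ((q * (q ^- (2 * n) - (-1) ^+ n)) / rho r) *: W
  - ((q^-1 * (q ^+ (2 * n) - (-1) ^+ n)) / rho r)%:P.

Definition kapV (n : nat) : {poly C} :=
  ((q * (q ^- (2 * n) - (-1) ^+ n)) / rho r)%:P
  - ((q^-1 * (q ^+ (2 * n) - (-1) ^+ n)) / rho r) *: W.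

Definition brW : {poly C} := (q - q^-1)^-1 *: (W - 1).

Fixpoint FEpoly (n : nat) : {poly {poly C}} :=
  if n is m.+1 then
    FEpoly m * (((-1) ^+ m) *: 'X + ((-1) ^+ m.+1 * brW - kapV m.+1)%:P)
  else 1.

Fixpoint EFpoly (n : nat) : {poly {poly C}} :=
  if n is m.+1 then EFpoly m * (((-1) ^+ m.+1) *: 'X + (kapW m.+1)%:P) else 1.

Lemma kapW_eval n Y : Y != 0 -> (kapW n).[Y ^+ 2] = Y * kap r n Y.
Proof.
move=> Y0; rewrite /kapW /kap -lock !(hornerD, hornerN, hornerZ, hornerX, hornerC).
by move: (q * _) (q^-1 * _) (rho r)^-1 => a b e; field.
Qed.

Lemma kapV_eval n Y : Y != 0 -> (kapV n).[Y ^+ 2] = Y * kap r n Y^-1.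
Proof.
move=> Y0; rewrite /kapV /kap -lock !(hornerD, hornerN, hornerZ, hornerX, hornerC) invrK.
by move: (q * _) (q^-1 * _) (rho r)^-1 => a b e; field.
Qed.

Lemma brW_eval Y : Y != 0 -> brW.[Y ^+ 2] = Y * ((Y - Y^-1) / (q - q^-1)).
Proof.
move=> Y0; rewrite /brW !(hornerD, hornerN, hornerZ, hornerX, hornerC).
by move: (q - q^-1)^-1 => a; field.
Qed.

Definition ev (w : C) (p : {poly {poly C}}) : {poly C} := map_poly (horner_eval w) p.

Lemma evZ w c p : ev w (c *: p) = c.[w] *: ev w p.
Proof. by rewrite /ev map_polyZ. Qed.

Lemma size_FEpoly n : (size (FEpoly n) <= n.+1)%N.
Proof.
elim: n => [|n IH] /=; first by rewrite size_poly1.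
apply: leq_trans (size_polyMleq _ _) _.
have h : (size (((-1) ^+ n) *: 'X + ((-1) ^+ n.+1 * brW - kapV n.+1)%:P : {poly {poly C}})%R <= 2)%N.
  rewrite (leq_trans (size_polyD _ _)) // geq_max (leq_trans (size_scale_leq _ _)) ?size_polyX //.
  by rewrite (leq_trans (size_polyC_leq1 _)).
by rewrite -ltnS; move: (leq_add IH h); case: (size _ + _)%N => // k; rewrite addn2.
Qed.

Lemma size_EFpoly n : (size (EFpoly n) <= n.+1)%N.
Proof.
elim: n => [|n IH] /=; first by rewrite size_poly1.
apply: leq_trans (size_polyMleq _ _) _.
have h : (size (((-1) ^+ n.+1) *: 'X + (kapW n.+1)%:P : {poly {poly C}})%R <= 2)%N.
  rewrite (leq_trans (size_polyD _ _)) // geq_max (leq_trans (size_scale_leq _ _)) ?size_polyX //.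
  by rewrite (leq_trans (size_polyC_leq1 _)).
by rewrite -ltnS; move: (leq_add IH h); case: (size _ + _)%N => // k; rewrite addn2.
Qed.

Section OneWeight.
Context {V : @opspace R} (mV : wmod V) (l : C) (p : bool).
Let A : 'End(V) := qp l *: (opF V \o opE V)%VF.
Local Notation Y := (qp l).

Lemma weight_opE u : A u = Y *: opF V (opE V u).
Proof. by rewrite scale_lfunE comp_lfunE. Qed.

Lemma weight_op_hwt u : @hwt R V l p u -> @hwt R V l p (A u).
Proof.
move=> hu; rewrite weight_opE; apply: hwtZ.
by have := hwt_F mV (hwt_E mV hu); rewrite negbK addrK.
Qed.

(** The innermost [F] is moved past [E^(n+1)] and the resulting [E F] is rewritten through [F E];
    each step contributes one factor of degree 1 in [Y F E]. *)
Lemma FEpoly_act n u : @hwt R V l p u ->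
  Y ^+ n *: lfun_exp (opF V) n (lfun_exp (opE V) n u) = poly_act A (ev (Y ^+ 2) (FEpoly n)) u.
Proof.
have Y0 := qexp_neq0 r l.
elim: n u => [|n IH] u hu /=.
  by rewrite /ev rmorph1 poly_act1 !lfun_exp0 scale1r.
have hA := weight_op_hwt hu.
rewrite /ev rmorphM rmorphD /= map_polyZ map_polyX map_polyC /= poly_act_linear.
rewrite -/(ev _ _) -IH; last by apply: hwtD; exact: hwtZ.
transitivity (Y ^+ n *: lfun_exp (opF V) n (lfun_exp (opE V) n
  (Y *: ((-1) ^+ n.+1 *: opE V (opF V u) - kap r n.+1 Y^-1 *: u)))).
  rewrite (lfun_expSr (opF V)) (FEn_hwt r3 r8 mV n hu) (lfun_expSr (opE V)).
  by rewrite !homZ !homB !homZ scalerA -exprSr.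
congr (_ *: lfun_exp _ _ (lfun_exp _ _ _)).
rewrite weight_opE (EF_hwt mV hu) /horner_eval hornerD hornerN hornerM (brW_eval Y0) (kapV_eval _ Y0).
rewrite !(horner_exp, hornerN, hornerC) [(-1) ^+ n.+1]exprS.
by scalar_forms; ring.
Qed.

Lemma EFpoly_act n u : @hwt R V l p u ->
  Y ^+ n *: lfun_exp (opE V) n (lfun_exp (opF V) n u) = poly_act A (ev (Y ^+ 2) (EFpoly n)) u.
Proof.
have Y0 := qexp_neq0 r l.
elim: n u => [|n IH] u hu /=.
  by rewrite /ev rmorph1 poly_act1 !lfun_exp0 scale1r.
have hA := weight_op_hwt hu.
rewrite /ev rmorphM rmorphD /= map_polyZ map_polyX map_polyC /= poly_act_linear.
rewrite -/(ev _ _) -IH; last by apply: hwtD; exact: hwtZ.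
transitivity (Y ^+ n *: lfun_exp (opE V) n (lfun_exp (opF V) n
  (Y *: ((-1) ^+ n.+1 *: opF V (opE V u) + kap r n.+1 Y *: u)))).
  rewrite (lfun_expSr (opE V)) (EFn_hwt r3 r8 mV n hu) (lfun_expSr (opF V)).
  by rewrite !homZ !homD !homZ scalerA -exprSr.
congr (_ *: lfun_exp _ _ (lfun_exp _ _ _)).
rewrite weight_opE /horner_eval (kapW_eval _ Y0) !(horner_exp, hornerN, hornerC).
by scalar_forms; ring.
Qed.

End OneWeight.

(** The twist of the dual has coefficients in [Y^-n] and, for [s = r0], the relative factor
    [W^(r0-1)], see [tw_opp]. As [EFpoly n] already contains [Y^n], what remains is [W^(r0-1-n)], a
    genuine polynomial for [n < r0]. *)
Definition dual_poly : {poly {poly C}} :=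
  \sum_(n < r0) (bcf r n)%:P *: FEpoly n
  - \sum_(n < r0) ((bcf r n * (-1) ^+ n)%:P * W ^+ (r0.-1 - n)) *: EFpoly n.

Lemma size_dual_poly : (size dual_poly <= r0)%N.
Proof.
rewrite (leq_trans (size_polyD _ _)) // size_polyN geq_max; apply/andP; split.
  apply: (leq_trans (size_sum _ _ _)); apply/bigmax_leqP => n _.
  exact: leq_trans (size_scale_leq _ _) (leq_trans (size_FEpoly n) (ltn_ord n)).
apply: (leq_trans (size_sum _ _ _)); apply/bigmax_leqP => n _.
exact: leq_trans (size_scale_leq _ _) (leq_trans (size_EFpoly n) (ltn_ord n)).
Qed.

Definition sumFE (V : @opspace R) (l : C) (u : V) : V :=
  \sum_(n < r0) (bcf r n * qp l ^+ n) *: lfun_exp (opF V) n (lfun_exp (opE V) n u).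

Definition sumEF (V : @opspace R) (l : C) (u : V) : V :=
  \sum_(n < r0) (bcf r n * ((qp l)^-1 ^+ n * (-1) ^+ n)) *: lfun_exp (opE V) n (lfun_exp (opF V) n u).

Lemma dual_poly_act (V : @opspace R) (mV : wmod V) l p (u : V) : hwt l p u ->
  poly_act (qp l *: (opF V \o opE V)%VF) (ev (qp l ^+ 2) dual_poly) u
  = sumFE l u - (qp l ^+ 2) ^+ r0.-1 *: sumEF l u.
Proof.
move=> hu; rewrite /ev /dual_poly rmorphB !rmorph_sum poly_actD; congr (_ + _).
  rewrite poly_act_sum; apply: eq_bigr => n _.
  rewrite -[X in poly_act _ X _]/(ev (qp l ^+ 2) _) evZ hornerC poly_actZ.
  by rewrite -(FEpoly_act mV _ hu) scalerA.
rewrite -scaleN1r poly_actZ scaleN1r poly_act_sum; congr (- _).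
rewrite scaler_sumr; apply: eq_bigr => n _.
rewrite -[X in poly_act _ X _]/(ev (qp l ^+ 2) _) evZ poly_actZ -(EFpoly_act mV _ hu) !scalerA.
congr (_ *: _).
rewrite hornerM hornerC horner_exp hornerX.
have nN : (n <= r0.-1)%N by rewrite -ltnS prednK ?(r0_gt0 hr0).
have Y0 := qexp_neq0 r l; rewrite -{2}(subnK nN) exprD.
have -> : (qp l ^+ 2) ^+ n = qp l ^+ n * qp l ^+ n by rewrite -exprMn -expr2.
have : qp l ^+ n != 0 by rewrite expf_neq0.
rewrite exprVn; move: (qp l ^+ n) ((-1) ^+ n) (_ ^+ (_ - _)) (bcf _ _) => a b c d a0.
by field.
Qed.

(** The eigenvalue of [Y F E] on [vb i] in the Verma module of highest weight [l + 2 i], as a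
    polynomial in [Y^2]. The shift of the highest weight gives [vb i] the weight [l] for every
    [i]. *)
Definition zeta (i : nat) : {poly C} :=
  (q * (1 - om r ^+ i) / rho r) *: W - (q^-1 * (1 - (-1) ^+ i * q ^- (2 * i)) / rho r)%:P.

(** The coefficients of [W] already differ: [om^i] takes distinct values for [i < r0]. *)
Lemma zeta_inj i j : (i < r0)%N -> (j < r0)%N -> zeta i = zeta j -> i = j.
Proof.
wlog ij : i j / (i <= j)%N.
  by move=> h ir jr e; case: (leqP i j) => [|/ltnW] ij; [|apply/esym]; apply: h.
move=> ir jr /(congr1 (fun p : {poly C} => p`_1)).
rewrite /zeta !coefB !coefZ !coefX !coefC /= !subr0 !mulr1.
have q0 := q_neq0 (R := R) r; have rh := rho_neq0 r3 r8 (R := R).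
move=> /(mulIf (invr_neq0 rh)) /(mulfI q0) /addrI /oppr_inj e.
apply/eqP; rewrite eqn_leq ij /= leqNgt; apply/negP => lt_ij.
have w0 := om_neq0 (R := R) r.
have := om_n hr0 (n := (j - i)%N); rewrite subn_gt0 lt_ij (leq_ltn_trans (leq_subr _ _)) //= => /(_ isT).
by rewrite -(inj_eq (mulfI (expf_neq0 i w0))) -exprD subnKC // mulr1 -e eqxx.
Qed.

Section SpecialPivot.
Hypothesis hs : qp (2 * r0%:Z)%:~R = 1.
Local Notation cat := (weight_category R r r0 r0%:Z).
Local Notation th V := (@ptr_twist C cat V : 'End(V)).
Local Notation tw0 := (@tw R r r0%:Z).

Lemma one_sub_r0 : (1 - r0%:Z)%:~R = - r0.-1%:R :> C.
Proof.
rewrite -{1}(prednK (r0_gt0 hr0)) intrB -[r0.-1.+1]addn1 PoszD intrD.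
by rewrite -pmulrn opprD addrCA subrr addr0.
Qed.

Lemma tw_opp l : tw0 (- l) = tw0 l * (qp l ^+ 2) ^+ r0.-1.
Proof.
rewrite /tw -!lock one_sub_r0 -exprM -qexpMn -qexpD; congr qexp.
rewrite -[l *+ _]mulr_natl natrM mulrNN.
by move: (r0.-1%:R : C) => N; ring.
Qed.

(** With [N = r0 - 1] the exponent of [tw] is [((l - N)^2 - N^2) / 2], symmetric about [N]. *)
Lemma tw_dual nu : tw0 (- (nu - 2 * r0.-1%:R)) = tw0 nu.
Proof.
rewrite /tw -!lock one_sub_r0; congr qexp.
have t0 : 2 != 0 :> C by rewrite pnatr_eq0.
by move: (r0.-1%:R : C) => N; field.
Qed.

Lemma twist_dual_sum (V : @opspace R) (mV : wmod V) l p (v : V) l' p' (f : ldual V) :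
  hwt l p v -> @hwt R (wdual V) l' p' f ->
  (th (wdual V) f : ldual V) v = tw0 l' * \sum_(n < r0)
    bcf r n * (qp l' ^+ n * (-1) ^+ n) * (f (lfun_exp (opE V) n (lfun_exp (opF V) n v)) : C) :> C.
Proof.
move=> hv hf; rewrite (twist_hwt r3 r8 hs (weight_module_dual mV) hf) scale_lfunE sum_lfunE.
congr (_ * _); apply: eq_bigr => n _; rewrite scale_lfunE (dual_FnEn mV n _ hv).
by rewrite /GRing.scale /= !mulrA.
Qed.

(** On [vb i] both sums act by scalars that the twists of the Verma module and of its dual
    determine, and [tw_dual] makes these agree. This holds at every positive real value of [W],
    hence identically. *)
Lemma dual_poly_root i : (i < r0)%N -> root dual_poly (zeta i).
Proof.
move=> ir; apply/rootP; apply: poly_eq0_expR => t.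
have [l el] := @qexp_expR R r r3 (t / 2).
have wE : (expR t)%:C%C = qp l ^+ 2 :> C.
  by rewrite el -rmorphXn -expRM_natl; congr (_%:C%C); congr expR; rewrite mulr2n; field.
(* The highest weight for which [vb i] has weight [l], where [(q^l)^2] is the prescribed value of
   [W]. *)
pose nu := l + 2 * i%:R; have mM := weight_module_verma r3 r8 hr0 nu.
have lE : nu - 2 * i%:R = l by rewrite /nu addrK.
have hi : @hwt R (verma r r0 nu) l (odd i) (vb r0 i) by have := verma_hwt r nu ir; rewrite lE.
have Y0 := qexp_neq0 r l.
pose A : 'End(verma r r0 nu) := qp l *: (opF (verma r r0 nu) \o opE (verma r r0 nu))%VF.
have AE : A (vb r0 i) = (zeta i).[qp l ^+ 2] *: vb r0 i.
  rewrite scale_lfunE comp_lfunE.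
  have -> : opF (verma r r0 nu) (opE (verma r r0 nu) (vb r0 i)) = kap r i (qp nu) *: vb r0 i.
    case: (i) (ir) => [|k] kr; first by rewrite (vermaE0 hr0) hom0 kap0 scale0r.
    by rewrite (vermaE r3 r8 hr0) 1?ltnW // homZ vermaF.
  rewrite scalerA; congr (_ *: _).
  rewrite /zeta !(hornerD, hornerN, hornerZ, hornerX, hornerC) /kap -lock /nu qexpD qexp2n omX.
  have : q ^+ (2 * i) != 0 by rewrite expf_neq0 ?q_neq0.
  move: q^-1 (rho r)^-1 ((-1) ^+ i) (q ^+ (2 * i)) => c d b a a0.
  move: q => e.
  by field; rewrite Y0 a0.
rewrite wE -[LHS]/(horner_eval (qp l ^+ 2) _) -horner_map /=.
have := dual_poly_act mM hi; rewrite (poly_act_eigen _ AE) => /(congr1 (covb r0 i)).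
rewrite ldualZ (covbE ir ir) eqxx mulr1 => ->.
rewrite homB homZ.
have twl := tw_neq0 r r0%:Z l.
have hFE : covb r0 i (@sumFE (verma r r0 nu) l (vb r0 i)) = tw0 nu / tw0 l :> C.
  have := twist_hwt r3 r8 hs mM hi; rewrite (verma_twist r3 r8 hr0 nu hs ir).
  move=> /(congr1 (covb r0 i)).
  rewrite !ldualZ (covbE ir ir) eqxx mulr1 => ->.
  by rewrite mulrC mulKf.
rewrite [X in X - _]hFE.
have hD : @hwt R (wdual (verma r r0 nu)) (- l) (odd i) (covb r0 i).
  by have [] := cohwt_homog mM (covb_cohwt ir); rewrite lE.
have := twist_dual_sum mM hi hD.
rewrite (verma_dual_twist r3 r8 hr0 nu hs ir) scale_lfunE (covbE ir ir) eqxx tw_dual.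
rewrite /GRing.scale /= mulr1 tw_opp => e.
have -> : covb r0 i (@sumEF (verma r r0 nu) l (vb r0 i)) = tw0 nu / (tw0 l * (qp l ^+ 2) ^+ r0.-1) :> C.
  rewrite e hom_sum mulrC mulKf.
    by apply: eq_bigr => n _; rewrite ldualZ qexpN.
  by rewrite mulf_neq0 ?expf_neq0.
have : (qp l ^+ 2) ^+ r0.-1 != 0 by rewrite !expf_neq0.
move: (tw0 nu) (tw0 l) twl (_ ^+ _) => a b b0 c c0.
by field; rewrite b0 c0.
Qed.

(** A polynomial over the domain [{poly C}] of size at most [r0] cannot have the [r0] distinct roots
    [zeta i] unless it is zero. *)
Lemma dual_poly0 : dual_poly = 0.
Proof.
apply/eqP; apply: contraT => p0.
have := max_poly_roots (rs := [seq zeta i | i <- iota 0 r0]) p0.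
rewrite size_map size_iota ltnNge size_dual_poly; apply.
  by rewrite all_map; apply/allP => i; rewrite mem_iota /= add0n; exact: dual_poly_root.
rewrite map_inj_in_uniq ?iota_uniq // => i j; rewrite !mem_iota /= !add0n.
exact: zeta_inj.
Qed.

Lemma sumFE_EF (V : @opspace R) (mV : wmod V) l p (u : V) : hwt l p u ->
  sumFE l u = (qp l ^+ 2) ^+ r0.-1 *: sumEF l u.
Proof.
move=> hu; have := dual_poly_act mV hu; rewrite dual_poly0 /ev rmorph0.
rewrite /poly_act size_poly0 big_ord0 => /esym/eqP.
by rewrite subr_eq0 => /eqP.
Qed.

Lemma twist_dual_eq (V : @opspace R) (mV : wmod V) (f : ldual V) :
  th (wdual V) f = (f \o th V)%VF :> ldual V.
Proof.
have mD := weight_module_dual mV.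
pose tr : 'End(ldual V) := linfun (fun f : ldual V => (f \o th V)%VF : ldual V).
have trE g : tr g = (g \o th V)%VF.
  by rewrite /tr linfunE // => a x y; rewrite comp_lfunDl comp_lfunZl.
rewrite -trE; apply: lfun_eq; apply: (lfun_hwt mD) => l' p' g hg; rewrite trE.
apply: (lfun_hwt mV) => l p v hv; rewrite (twist_dual_sum mV hv hg) comp_lfunE.
rewrite (twist_hwt r3 r8 hs mV hv) -/(sumFE l v) (sumFE_EF mV hv) ldualZ ldualZ hom_sum.
rewrite mulrA -tw_opp.
have hEF n : @hwt R V l p (lfun_exp (opE V) n (lfun_exp (opF V) n v)).
  have := hwt_En mV n (hwt_Fn mV n hv); rewrite subrK -addbA addbb addbF; exact.
have [->|ne] := eqVneq l' (- l).
  by congr (_ * _); apply: eq_bigr => n _; rewrite ldualZ qexpN.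
(* The operators [E^n F^n] preserve the weight, so every pairing vanishes unless [g] has the
   opposite weight. *)
rewrite !big1 ?mulr0 // => n _; rewrite ?homZ;
  have [->|[e _]] := dual_pairing mV hg (hEF n); rewrite ?scaler0 ?mulr0 //;
  by rewrite e eqxx in ne.
Qed.

End SpecialPivot.

End DualTwist.

(** * The ribbon criterion *)

Section Ribbon.
Context {R : realType}.
Local Notation C := R[i].
Variables (r r0 : nat) (s : int).
Local Notation qp := (@qexp R r).
Local Notation wmod := (@weight_module R r r0).
Local Notation cat := (weight_category R r r0 s).
Local Notation th V := (@ptr_twist C cat V : 'End(V)).
Hypotheses (r3 : (3 <= r)%N) (r8 : (r %% 8 != 4)%N) (hr0 : least_zero_qbr R r r0).
Hypothesis hs : qp (2 * s)%:~R = 1.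

Lemma dual_morE (V : @opspace R) (g : 'End(V)) (f : ldual V) :
  (@dual_mor C cat V V g : 'End(wdual V)) f = (f \o g)%VF.
Proof.
rewrite /dual_mor /= 5!comp_lfunE wruiE tmap_pure wcoevlE.
rewrite scale1r id_lfunE pure_sumr !hom_sum [RHS]functional_dcoord; apply: eq_bigr => i _.
rewrite !tmap_pure !id_lfunE wasci_pure tmap_pure wlu_pure id_lfunE wevl_pure.
by rewrite comp_lfunE.
Qed.

Lemma weight_ribbon : s = r0%:Z ->
  linear_ribbon_category (fun V : ob cat => @ptr_twist C cat V).
Proof.
move=> es; split.
- exact: weight_monoidal_category.
- exact: weight_rigid.
- exact: weight_braided.
split.
- exact: weight_natural_automorphism.
- by move=> V W mV mW; exact: twist_tens_eq.
move=> V mV; apply/lfunP => f; rewrite dual_morE.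
by move: hs; rewrite es => hs'; exact: (twist_dual_eq r3 r8 hr0 hs' mV).
Qed.

Lemma ribbon_pivot : (forall V : ob cat, isob V ->
  @ptr_twist C cat (dual V) = dual_mor (@ptr_twist C cat V)) -> s = r0%:Z.
Proof.
move=> tdual; apply/eqP; apply: contraT => ne.
have rp : (0 < r0)%N by case: hr0.
have two0 : 2 != 0 :> C by rewrite pnatr_eq0.
have d0 : (r0%:Z - s)%:~R != 0 :> C by rewrite intr_eq0 subr_eq0 eq_sym.
have [x ex] := @qexp_expR R r r3 1.
(* The exponents of the twists on the dual and on the Verma module differ by
   [2 (r0 - 1 - nu) (r0 - s)]. This [nu] makes the difference equal to [x], and [q^x = expR 1] is
   not 1. *)
pose nu := r0.-1%:R - x / (r0%:Z - s)%:~R / 2.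
have mM := weight_module_verma r3 r8 hr0 nu.
have := congr1 (fun g : 'End(wdual (verma r r0 nu)) => (g (covb r0 0) : ldual _) (vb r0 0) : C)
  (tdual _ mM).
have dE := @dual_morE (verma r r0 nu) (th (verma r r0 nu)) (covb r0 0).
rewrite (verma_dual_twist r3 r8 hr0 nu hs rp).
rewrite [X in _ = X -> _](congr1 (fun h : ldual (verma r r0 nu) => (h (vb r0 0) : C)) dE) comp_lfunE.
rewrite (verma_twist r3 r8 hr0 nu hs rp) ldualZ scale_lfunE (covbE rp rp).
rewrite /GRing.scale /= !mulr1 /tw -!lock => /eqP.
rewrite -(inj_eq (mulfI (qexp_neq0 r (- (nu * nu / 2 + (1 - s)%:~R * nu))))) -!qexpD addNr qexp0.
have -> : - (nu * nu / 2 + (1 - s)%:~R * nu)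
   + (- (nu - 2 * r0.-1%:R) * - (nu - 2 * r0.-1%:R) / 2 + (1 - s)%:~R * - (nu - 2 * r0.-1%:R)) = x.
  have -> : (1 - s)%:~R = (r0%:Z - s)%:~R - r0.-1%:R :> C.
    rewrite !intrB -pmulrn -{1}(prednK rp) mulrSr.
    by move: (s%:~R : C) => t; ring.
  rewrite /nu; move: d0; move: (_ - s)%:~R (r0.-1%:R : C) => d N d0.
  by field.
by rewrite ex (inj_eq (@complexI R) _ 1) gt_eqF // expR_gt1 ltr01.
Qed.

End Ribbon.

Theorem proposition2p23 (R : realType) (r r0 : nat) (s : int)
    (hr : (3 <= r)%N) (hr8 : (r %% 8 != 4)%N)
    (hr0 : least_zero_qbr R r r0)
    (hs : qpow r (2 * s)%:~R = 1 :> R[i]) :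
  natural_automorphism (@ptr_twist R[i] (weight_category R r r0 s)) /\
  (linear_ribbon_category (@ptr_twist R[i] (weight_category R r r0 s)) <->
   s = r0%:Z).
Proof.
have hq : qexp r (2 * s)%:~R = 1 :> R[i] by rewrite qexpE.
split; first exact: weight_natural_automorphism.
split=> [[_ _ _ [_ _ tdual]]|]; last exact: weight_ribbon.
exact: (ribbon_pivot hr hr8 hr0 hq tdual).
Qed.
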